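(* Let $\lambda\in\mathbb{D}$ and let $f\in L^2(\mathbb{T})$ be a real valued function. Then $T_f$ is distributed as $f\circ b_{-\lambda}$ in the sense of the eigenvalues relative to the sequence of model spaces $(K_{b_\lambda^n})_{n\in\mathbb{N}}$; that is, for every continuous function $G$ with compact support, $$\lim_{n\to\infty}\frac{1}{\dim K_{b_\lambda^n}}\sum_{k=1}^{\dim K_{b_\lambda^n}}G(\lambda_k(T_{f,K_{b_\lambda^n}}))=\frac{1}{2\pi}\int_{\mathbb{T}}G\big((f\circ b_{-\lambda})(\xi)\big)\,d\xi.$$ Moreover, $T_f$ is distributed as $|f\circ b_{-\lambda}|$ in the sense of the singular values relative to the sequence of model spaces $(K_{b_\lambda^n})_{n\in\mathbb{N}}$; that is, for every continuous function $G$ with compact support, $$\lim_{n\to\infty}\frac{1}{\dim K_{b_\lambda^n}}\sum_{k=1}^{\dim K_{b_\lambda^n}}G(\sigma_k(T_{f,K_{b_\lambda^n}}))=\frac{1}{2\pi}\int_{\mathbb{T}}G\big(|f\circ b_{-\lambda}|(\xi)\big)\,d\xi.$$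
   Context: $\mathbb{T}$ is the unit circle, $\mathbb{D}$ the open unit disc, $L^2(\mathbb{T})$ has inner product $\langle f,g\rangle=\int_{\mathbb{T}}f\overline{g}\,\frac{d\xi}{2\pi}$ ($d\xi$ is arc length), and $H^2=\{f\in L^2(\mathbb{T}):\hat f(n)=0\text{ for }n<0\}$ is the Hardy space. For $\lambda\in\mathbb{D}$, $b_\lambda(z)=\frac{z-\lambda}{1-\overline{\lambda}z}$, so $b_{-\lambda}(z)=\frac{z+\lambda}{1+\overline{\lambda}z}$. For an inner function $\theta$, the model space is $K_\theta=H^2\ominus\theta H^2$. When $\theta$ is a finite Blaschke product (e.g. $\theta=b_\lambda^n$), $K_\theta$ is finite dimensional and consists of bounded functions; for $f\in L^2(\mathbb{T})$, $T_{f,K_\theta}:K_\theta\to K_\theta$ is the operator $T_{f,K_\theta}(g)=P_{K_\theta}(fg)$, where $P_{K_\theta}$ is the orthogonal projection onto $K_\theta$ (the compression to $K_\theta$ of the Toeplitz operator $T_f$). For an operator $A$ on a finite-dimensional Hilbert space, $(\lambda_k(A))_k$ are its eigenvalues and $(\sigma_k(A))_k$ its singular values, counted with multiplicity. *)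

(* Defs.v *)
(* Functions on the unit circle are represented by functions on the complex
   plane R[i]; every notion below only looks at their restriction to the circle,
   through the arc-length parametrization t |-> exp(it), 0 <= t <= 2pi.
   Elements of L^2 are such functions, up to a.e. equality. *)
From mathcomp Require Import all_boot all_order all_algebra.
From mathcomp Require Import complex.
From mathcomp Require Import all_classical all_reals all_analysis.

Set Implicit Arguments.
Unset Strict Implicit.
Unset Printing Implicit Defensive.

Import Order.TTheory GRing.Theory Num.Theory.
Import numFieldNormedType.Exports.

Local Open Scope classical_set_scope.
Local Open Scope ring_scope.
Local Open Scope sesquilinear_scope.

Section Circle.
Variable R : realType.
Local Notation C := R[i].
Local Notation mu := (@lebesgue_measure R).
Local Notation I := `[0, 2 * pi : R]%classic.

Definition expi (t : R) : C := (cos t +i* sin t)%C.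

Definition circle_ae_eq (g h : C -> C) : Prop :=
  {ae mu, forall t, I t -> g (expi t) = h (expi t)}.

(* (1 / 2pi) * integral of F over the circle with respect to arc length,
   computed on the real and the imaginary part. *)
Definition circle_mean (F : C -> C) : C :=
  ((2 * pi)^-1 * Rintegral mu I (fun t => complex.Re (F (expi t)))
   +i* ((2 * pi)^-1 * Rintegral mu I (fun t => complex.Im (F (expi t)))))%C.

Definition L2 : set (C -> C) := [set g : C -> C |
  [/\ measurable_fun I (fun t => complex.Re (g (expi t))),
      measurable_fun I (fun t => complex.Im (g (expi t))) &
      mu.-integrable I (fun t => (complex.Re (`|g (expi t)| ^+ 2 : C))%:E)]].

Definition inner (g h : C -> C) : C := circle_mean (fun z => g z * (h z)^*).

Definition fourier_coef (g : C -> C) (n : int) : C := inner g (fun z => (z ^ n)%R).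

Definition hardy2 : set (C -> C) :=
  [set g : C -> C | L2 g /\ forall n : int, n < 0 -> fourier_coef g n = 0].

Definition model_space (theta : C -> C) : set (C -> C) :=
  [set g : C -> C | hardy2 g /\
           forall h, hardy2 h -> inner g (fun z => theta z * h z) = 0].

Definition blaschke (lam z : C) : C := (z - lam) / (1 - lam^* * z).

(* The orthogonal projection of h onto K; it is unique only up to a.e.
   equality, so one representative is chosen. *)
Definition orth_proj (K : set (C -> C)) (h : C -> C) : C -> C :=
  xget (fun=> 0)
    [set p : C -> C | K p /\ forall q, K q -> inner (fun z => h z - p z) q = 0].

Definition toeplitz_compression (f : C -> C) (K : set (C -> C)) (g : C -> C) :
    C -> C :=
  orth_proj K (fun z => f z * g z).

Definition is_orthonormal_basis (K : set (C -> C)) (e : seq (C -> C)) : Prop :=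
  [/\ forall i : 'I_(size e), K e`_i,
      forall i j : 'I_(size e), inner e`_i e`_j = (i == j)%:R &
      forall g, K g ->
        circle_ae_eq g (fun z => \sum_(i < size e) inner g e`_i * e`_i z)].

(* Junk value [::] when K is not a finite-dimensional subspace. *)
Definition orthonormal_basis (K : set (C -> C)) : seq (C -> C) :=
  xget [::] (is_orthonormal_basis K).

Definition hdim (K : set (C -> C)) : nat := size (orthonormal_basis K).

Definition matrix_of (K : set (C -> C)) (A : (C -> C) -> (C -> C)) :
    'M[C]_(hdim K) :=
  \matrix_(i, j) inner (A (orthonormal_basis K)`_j) (orthonormal_basis K)`_i.

(* Roots of the characteristic polynomial, repeated according to their
   algebraic multiplicity. *)
Definition mx_eigenvalues (n : nat) (M : 'M[C]_n) : seq C :=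
  sval (closed_field_poly_normal (char_poly M)).

Definition eigenvalues (K : set (C -> C)) (A : (C -> C) -> (C -> C)) : seq C :=
  mx_eigenvalues (matrix_of K A).

(* The basis being orthonormal, the conjugate transpose represents the adjoint;
   the eigenvalues of A^* A are nonnegative real numbers. *)
Definition singular_values (K : set (C -> C)) (A : (C -> C) -> (C -> C)) :
    seq R :=
  [seq Num.sqrt (complex.Re z)
     | z <- mx_eigenvalues ((matrix_of K A)^t* *m matrix_of K A)].

Definition has_compact_support (T : topologicalType) (G : T -> C) : Prop :=
  compact (closure [set x | G x != 0]).

End Circle.

(* Main.v *)
(* With kappa = sqrt(1 - |lam|^2) / (1 - conj lam z) and b = b_lam, the functions
   kappa b^k (k < n) form the Takenaka-Malmquist orthonormal basis of the model
   space of b^n. In this basis the compression of T_f is the Hermitian matrix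
   M_n(i, j) = int f b^j conj(b)^i dnu, where dnu is the Poisson measure
   |kappa|^2 dt / 2pi.

   Let d_k be the eigenvalues of M_n, with unit eigenvectors q_k, and let
   w_k = |sum_i q_k(i) conj(b)^i|^2. Then int w_k dnu = 1, int f w_k dnu = d_k
   and sum_k w_k = n because |b| = 1, so that
     (1/n) sum_k int (d_k - f)^2 w_k dnu = int f^2 dnu - (1/n) sum_ij |M_n(i, j)|^2.
   Call this number D_n(f). If |G x - G y| <= eps + c (x - y)^2, it follows that
   |(1/n) sum_k G(d_k) - int G(f) dnu| <= eps + c D_n(f).

   D_n(f) tends to 0: D_n(f + g) <= 2 D_n(f) + 2 D_n(g) and D_n(g) <= int g^2 dnu,
   so f may be taken continuous on the circle, and then
   |f(s) - f(t)|^2 <= eps + c |b(s) - b(t)|^2 is integrated against the kernel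
   |sum_i b(s)^i conj(b(t))^i|^2.

   Finally int G(f) dnu is the mean of G(f o b_{-lam}), by the change of variable
   t |-> arg b_{-lam}(exp(it)). *)
Require Import Defs.
From HB Require Import structures.
From mathcomp Require Import all_boot all_order all_algebra.
From mathcomp Require Import complex.
From mathcomp Require Import all_classical all_reals all_analysis.
From mathcomp Require Import measurable_realfun.
From mathcomp Require Import ring lra.
Import Order.TTheory GRing.Theory Num.Theory.
Import numFieldNormedType.Exports.
Local Open Scope classical_set_scope.
Local Open Scope ring_scope.

Set Implicit Arguments.
Unset Strict Implicit.
Unset Printing Implicit Defensive.

(** * Means over the circle *)

Section CircleIntegral.
Variable R : realType.
Local Notation C := R[i].
Local Notation mu := (@lebesgue_measure R).
Local Notation I := `[0, 2 * pi : R]%classic.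
Local Notation Re := complex.Re.
Local Notation Im := complex.Im.

(** The statement takes its matrix in an unspecified orthonormal basis of K whose members are
    determined only almost everywhere. A unitary W carries it to the Takenaka-Malmquist basis, whose
    members are bounded; this matters because f is merely square integrable.

    The Hardy-space facts are derived from Fourier coefficients alone, without analytic extension to
    the disc: evaluation at lam is the pairing with 1 / (1 - conj lam z).

    The second moment tr M_n^2 is the only spectral moment that enters. It suffices because a
    continuous G of compact support has, for every eps, a modulus of the quadratic form used above.
    That D_n is a quadratic form is clear from its definition; that it is nonnegative comes from its
    spectral expression as a mean of squares. Both together give the parallelogram law behind the
    inequality for f + g, and thus the passage from continuous functions to L^2.

    The continuous case is Korovkin's scheme: the kernel has total mass n, while its integral
    against |b(s) - b(t)|^2 is 2 for every n, so it concentrates on the diagonal at rate 1/n.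

    As M_n is Hermitian, the singular values are |d_k|, and the second claim is the limit for G
    composed with the absolute value. *)

Lemma cReD (x y : C) : Re (x + y) = Re x + Re y. Proof. by case: x; case: y. Qed.
Lemma cImD (x y : C) : Im (x + y) = Im x + Im y. Proof. by case: x; case: y. Qed.
Lemma cReM (x y : C) : Re (x * y) = Re x * Re y - Im x * Im y.
Proof. by case: x; case: y. Qed.
Lemma cImM (x y : C) : Im (x * y) = Re x * Im y + Im x * Re y.
Proof. by case: x => a b; case: y => c d /=; rewrite addrC [b * c]mulrC mulrC addrC. Qed.
Lemma cReJ (x : C) : Re x^* = Re x. Proof. by case: x. Qed.
Lemma cImJ (x : C) : Im x^* = - Im x. Proof. by case: x. Qed.
Lemma complexP (x y : C) : Re x = Re y -> Im x = Im y -> x = y.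
Proof. by case: x; case: y => a b c d /= -> ->. Qed.
Lemma sqr_norm_ReIm (x : C) : `|x| ^+ 2 = (Re x ^+ 2 + Im x ^+ 2)%:C%C.
Proof. by rewrite add_Re2_Im2. Qed.

Definition rmean (u : R -> R) : R := (2 * pi)^-1 * Rintegral mu I u.
Definition rint (u : R -> R) : Prop := mu.-integrable I (EFin \o u).

(** [circle_mean F] is convertible to [cmean (F \o @expi R)], so [inner] and [fourier_coef] unfold
    to means of functions of the angle; many rewrites below rely on this. *)
Definition cmean (u : R -> C) : C :=
  (rmean (fun t => Re (u t)) +i* rmean (fun t => Im (u t)))%C.
Definition cintegrable (u : R -> C) : Prop :=
  rint (fun t => Re (u t)) /\ rint (fun t => Im (u t)).
Definition cmeas (u : R -> C) : Prop :=
  measurable_fun I (fun t => Re (u t)) /\ measurable_fun I (fun t => Im (u t)).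
Definition cbounded (u : R -> C) : Prop :=
  cmeas u /\ exists M, forall t, I t -> `|Re (u t)| <= M /\ `|Im (u t)| <= M.
Definition cL2 (u : R -> C) : Prop :=
  cmeas u /\ rint (fun t => Re (u t) ^+ 2 + Im (u t) ^+ 2).

Lemma mI : @measurable _ (measurableTypeR R) I. Proof. exact: measurable_itv. Qed.
Hint Resolve mI : core.
Lemma twopi_gt0 : 0 < 2 * pi :> R. Proof. by rewrite mulr_gt0// pi_gt0. Qed.
Lemma muI : mu I = (2 * pi)%:E.
Proof. by rewrite lebesgue_measure_itv/= lte_fin twopi_gt0 oppr0 adde0. Qed.
Lemma muI_fin : (mu I < +oo)%E. Proof. by rewrite muI ltry. Qed.

Implicit Types (r M : R) (u v : R -> R) (F G H : R -> C).

Lemma rint_meas u : rint u -> measurable_fun I u.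
Proof. by case/integrableP => /measurable_EFinP. Qed.

Lemma eq_rint u v : {in I, u =1 v} -> rint u -> rint v.
Proof.
by move=> e; apply: eq_integrable => // x xI; rewrite /= e.
Qed.

Lemma rint_le u v : measurable_fun I u -> (forall t, I t -> `|u t| <= v t) ->
  rint v -> rint u.
Proof.
move=> mu_ le iv; apply: (le_integrable _ _ _ iv) => //.
  exact/measurable_EFinP.
move=> t It /=; rewrite lee_fin (le_trans (le _ It))// ler_norm//.
Qed.

Lemma rint_cst r : rint (fun=> r).
Proof.
apply: measurable_bounded_integrable => //; first exact: muI_fin.
by exists `|r|; split; [exact: num_real | move=> M /ltW h t _ /=].
Qed.

Lemma rintD u v : rint u -> rint v -> rint (fun t => u t + v t).
Proof. by move=> iu iv; have := integrableD mI iu iv. Qed.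

Lemma rintZ r u : rint u -> rint (fun t => r * u t).
Proof. by move=> iu; have := integrableZl mI r iu. Qed.

Lemma rintN u : rint u -> rint (fun t => - u t).
Proof. by move=> /(rintZ (-1)); apply: eq_rint => t _; rewrite mulN1r. Qed.

Lemma rintB u v : rint u -> rint v -> rint (fun t => u t - v t).
Proof. by move=> iu iv; apply: rintD => //; exact: rintN. Qed.

Lemma rint_norm u : rint u -> rint (fun t => `|u t|).
Proof. by move=> /integrable_norm. Qed.

Lemma rint_bounded u M : measurable_fun I u -> (forall t, I t -> `|u t| <= M) ->
  rint u.
Proof. by move=> mu_ b; apply: (rint_le mu_ b); exact: rint_cst. Qed.

Lemma rintM_bounded u v M : rint u -> measurable_fun I v ->
  (forall t, I t -> `|v t| <= M) -> rint (fun t => u t * v t).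
Proof.
move=> iu mv b; apply: (@rint_le _ (fun t => M * `|u t|)).
- by apply: measurable_funM => //; exact: rint_meas.
- by move=> t It; rewrite normrM mulrC ler_wpM2r// b.
- exact/rintZ/rint_norm.
Qed.

Lemma rint_sum (J : Type) (s : seq J) (u : J -> R -> R) :
  (forall j, rint (u j)) -> rint (fun t => \sum_(j <- s) u j t).
Proof.
move=> iu; elim: s => [|j s IH].
  by apply: (eq_rint _ (rint_cst 0)) => t _; rewrite big_nil.
by apply: (eq_rint _ (rintD (iu j) IH)) => t _; rewrite big_cons.
Qed.

Lemma eq_rmean u v : {in I, u =1 v} -> rmean u = rmean v.
Proof. by move=> e; congr (_ * _); exact: eq_Rintegral. Qed.

Lemma rmeanD u v : rint u -> rint v ->
  rmean (fun t => u t + v t) = rmean u + rmean v.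
Proof. by move=> iu iv; rewrite /rmean RintegralD// mulrDr. Qed.

Lemma rmeanZ r u : rint u -> rmean (fun t => r * u t) = r * rmean u.
Proof. by move=> iu; rewrite /rmean RintegralZl// mulrCA. Qed.

Lemma rmeanN u : rint u -> rmean (fun t => - u t) = - rmean u.
Proof.
move=> iu; rewrite -mulN1r -rmeanZ//; apply: eq_rmean => t _.
by rewrite mulN1r.
Qed.

Lemma rmeanB u v : rint u -> rint v ->
  rmean (fun t => u t - v t) = rmean u - rmean v.
Proof. by move=> iu iv; rewrite rmeanD ?rmeanN//; exact: rintN. Qed.

Lemma rmean_cst r : rmean (fun=> r) = r.
Proof.
rewrite /rmean Rintegral_cst// [fine _](congr1 fine muI)/= mulrCA mulVf ?mulr1//.
exact/lt0r_neq0/twopi_gt0.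
Qed.

Lemma rmean_sum (J : Type) (s : seq J) (u : J -> R -> R) :
  (forall j, rint (u j)) ->
  rmean (fun t => \sum_(j <- s) u j t) = \sum_(j <- s) rmean (u j).
Proof.
move=> iu; elim: s => [|j s IH].
  by rewrite big_nil -[RHS](rmean_cst 0); apply: eq_rmean => t _; rewrite big_nil.
rewrite big_cons -IH -rmeanD//; last exact: rint_sum.
by apply: eq_rmean => t _; rewrite big_cons.
Qed.

Lemma rmean_ge0 u : (forall t, I t -> 0 <= u t) -> 0 <= rmean u.
Proof.
move=> u0; rewrite mulr_ge0// ?invr_ge0 ?(ltW twopi_gt0)//.
exact: Rintegral_ge0.
Qed.

Lemma le_rmean u v : rint u -> rint v -> (forall t, I t -> u t <= v t) ->
  rmean u <= rmean v.
Proof.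
move=> iu iv le; apply: ler_wpM2l; first by rewrite invr_ge0 (ltW twopi_gt0).
exact: le_Rintegral.
Qed.

Lemma norm_rmean u : rint u -> `|rmean u| <= rmean (fun t => `|u t|).
Proof.
move=> iu; rewrite normrM ger0_norm; last by rewrite invr_ge0 (ltW twopi_gt0).
apply: ler_wpM2l; first by rewrite invr_ge0 (ltW twopi_gt0).
exact: le_normr_Rintegral.
Qed.

Lemma ae_imply (P Q : R -> Prop) : (forall t, P t -> Q t) ->
  {ae mu, forall t, P t} -> {ae mu, forall t, Q t}.
Proof. by move=> PQ; apply: negligibleS => t /= nQ p; apply/nQ/PQ. Qed.

Lemma ae_imply2 (P1 P2 Q : R -> Prop) : (forall t, P1 t -> P2 t -> Q t) ->
  {ae mu, forall t, P1 t} -> {ae mu, forall t, P2 t} -> {ae mu, forall t, Q t}.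
Proof.
move=> PQ h1 h2; apply: (negligibleS _ (negligibleU h1 h2)) => t /= nQ.
by apply: contrapT => /not_orP[/contrapT p1 /contrapT p2]; apply/nQ/PQ.
Qed.

Lemma ae_eq_rmean u v : measurable_fun I u -> measurable_fun I v ->
  {ae mu, forall t, I t -> u t = v t} -> rmean u = rmean v.
Proof.
move=> mu_ mv e; congr (_ * _); congr fine; apply: ae_eq_integral => //.
- exact/measurable_EFinP.
- exact/measurable_EFinP.
- by apply: ae_imply e => t h It /=; rewrite h.
Qed.

Lemma rmean_eq0 u : rint u -> (forall t, I t -> 0 <= u t) -> rmean u = 0 ->
  {ae mu, forall t, I t -> u t = 0}.
Proof.
move=> iu u0 /eqP; rewrite mulf_eq0 invr_eq0 (gt_eqF twopi_gt0)/= => /eqP e.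
have : (\int[mu]_(x in I) `|(u x)%:E| = 0)%E.
  transitivity (\int[mu]_(x in I) (u x)%:E)%E.
    apply: eq_integral => x /set_mem xI.
    by rewrite gee0_abs// lee_fin u0.
  rewrite -[LHS]fineK; last exact: integrable_fin_num.
  by rewrite [fine _]e.
move/integrableP: iu => [mu_ _].
move=> /(ae_eq_integral_abs _ mI mu_).
by apply: ae_imply => t h It; have [] := h It.
Qed.

Lemma rint_sqr_meas u v : measurable_fun I u -> measurable_fun I v ->
  measurable_fun I (fun t => u t ^+ 2 + v t ^+ 2).
Proof.
by move=> mu_ mv; apply: measurable_funD; apply: measurable_funX.
Qed.

Lemma eq_meas u v : u =1 v -> measurable_fun I v -> measurable_fun I u.
Proof. by move=> /funext ->. Qed.

Lemma cmeas_cst (c : C) : cmeas (fun=> c).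
Proof. by split; exact: measurable_cst. Qed.
Lemma cmeasD F G : cmeas F -> cmeas G -> cmeas (fun t => F t + G t).
Proof.
move=> [a b] [c d]; split.
- by apply: (eq_meas (fun=> cReD _ _)); exact: measurable_funD.
- by apply: (eq_meas (fun=> cImD _ _)); exact: measurable_funD.
Qed.
Lemma cmeasM F G : cmeas F -> cmeas G -> cmeas (fun t => F t * G t).
Proof.
move=> [a b] [c d]; split.
- apply: (eq_meas (fun=> cReM _ _)).
  by apply: measurable_funB; exact: measurable_funM.
- apply: (eq_meas (fun=> cImM _ _)).
  by apply: measurable_funD; exact: measurable_funM.
Qed.
Lemma cmeas_conj F : cmeas F -> cmeas (fun t => (F t)^*).
Proof.
move=> [a b]; split; first exact: (eq_meas (fun=> cReJ _)).
by apply: (eq_meas (fun=> cImJ _)); exact: measurableT_comp.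
Qed.

Lemma cb_cst (c : C) : cbounded (fun=> c).
Proof.
split; first exact: cmeas_cst.
by exists (`|Re c| + `|Im c|) => t _; rewrite lerDl lerDr !normr_ge0.
Qed.
Lemma cbD F G : cbounded F -> cbounded G -> cbounded (fun t => F t + G t).
Proof.
move=> [mF [M hM]] [mG [N hN]]; split; first exact: cmeasD.
exists (M + N) => t It; have [a b] := hM t It; have [c d] := hN t It.
by rewrite cReD cImD; split; rewrite (le_trans (ler_normD _ _))// lerD.
Qed.
Lemma cbM F G : cbounded F -> cbounded G -> cbounded (fun t => F t * G t).
Proof.
move=> [mF [M hM]] [mG [N hN]]; split; first exact: cmeasM.
exists (M * N + M * N) => t It; have [a b] := hM t It; have [c d] := hN t It.
rewrite cReM cImM; split.
  by rewrite (le_trans (ler_normB _ _))// !normrM lerD// ler_pM.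
by rewrite (le_trans (ler_normD _ _))// !normrM lerD// ler_pM.
Qed.
Lemma cb_conj F : cbounded F -> cbounded (fun t => (F t)^*).
Proof.
move=> [mF [M hM]]; split; first exact: cmeas_conj.
by exists M => t It; have [a b] := hM t It; rewrite cReJ cImJ normrN.
Qed.
Lemma cbZ c F : cbounded F -> cbounded (fun t => c * F t).
Proof. exact/cbM/cb_cst. Qed.
Lemma cbN F : cbounded F -> cbounded (fun t => - F t).
Proof. by under eq_fun do rewrite -mulN1r; exact: cbZ. Qed.
Lemma cbB F G : cbounded F -> cbounded G -> cbounded (fun t => F t - G t).
Proof. by move=> bF bG; apply: cbD => //; exact: cbN. Qed.
Lemma cbX F n : cbounded F -> cbounded (fun t => F t ^+ n).
Proof.
move=> bF; elim: n => [|n IH]; first exact: cb_cst.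
by under eq_fun do rewrite exprS; exact: cbM.
Qed.
Lemma cb_sum (J : Type) (s : seq J) (F : J -> R -> C) :
  (forall j, cbounded (F j)) -> cbounded (fun t => \sum_(j <- s) F j t).
Proof.
move=> h; elim: s => [|j s IH].
  by under eq_fun do rewrite big_nil; exact: cb_cst.
by under eq_fun do rewrite big_cons; exact: cbD.
Qed.

Lemma ci_cb F : cbounded F -> cintegrable F.
Proof.
by move=> [[a b] [M hM]]; split; apply: (@rint_bounded _ M) => // t /hM[].
Qed.
Lemma ciD F G : cintegrable F -> cintegrable G -> cintegrable (fun t => F t + G t).
Proof.
move=> [a b] [c d]; split.
- by under eq_fun do rewrite cReD; exact: rintD.
- by under eq_fun do rewrite cImD; exact: rintD.
Qed.
Lemma ciM F G : cintegrable F -> cbounded G -> cintegrable (fun t => F t * G t).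
Proof.
move=> [a b] [[c d] [M hM]].
have hR t : I t -> `|Re (G t)| <= M by move=> /hM[].
have hI t : I t -> `|Im (G t)| <= M by move=> /hM[].
split.
- by under eq_fun do rewrite cReM; apply: rintB; exact: (@rintM_bounded _ _ M).
- by under eq_fun do rewrite cImM; apply: rintD; exact: (@rintM_bounded _ _ M).
Qed.
Lemma ci_conj F : cintegrable F -> cintegrable (fun t => (F t)^*).
Proof.
move=> [a b]; split; first by under eq_fun do rewrite cReJ.
by under eq_fun do rewrite cImJ; exact: rintN.
Qed.
Lemma ciZ c F : cintegrable F -> cintegrable (fun t => c * F t).
Proof.
move=> iF; under eq_fun do rewrite mulrC; apply: ciM => //; exact: cb_cst.
Qed.
Lemma ciN F : cintegrable F -> cintegrable (fun t => - F t).
Proof. by under eq_fun do rewrite -mulN1r; exact: ciZ. Qed.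
Lemma ciB F G : cintegrable F -> cintegrable G -> cintegrable (fun t => F t - G t).
Proof. by move=> bF bG; apply: ciD => //; exact: ciN. Qed.
Lemma ci_sum (J : Type) (s : seq J) (F : J -> R -> C) :
  (forall j, cintegrable (F j)) -> cintegrable (fun t => \sum_(j <- s) F j t).
Proof.
move=> h; elim: s => [|j s IH].
  by under eq_fun do rewrite big_nil; exact/ci_cb/cb_cst.
by under eq_fun do rewrite big_cons; exact: ciD.
Qed.
Lemma ci_meas F : cintegrable F -> cmeas F.
Proof. by move=> [a b]; split; exact: rint_meas. Qed.
Lemma eq_ci F G : {in I, F =1 G} -> cintegrable F -> cintegrable G.
Proof. by move=> e [a b]; split; [move: a|move: b]; apply: eq_rint => t It; rewrite e. Qed.

Lemma cL2_cb F : cbounded F -> cL2 F.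
Proof.
move=> [[a b] [M hM]]; split=> //.
apply: (@rint_bounded _ (M ^+ 2 + M ^+ 2)); first exact: rint_sqr_meas.
move=> t /hM[c d]; rewrite ger0_norm ?addr_ge0 ?sqr_ge0//.
rewrite -[_ ^+ 2]real_normK ?num_real// -[Im _ ^+ 2]real_normK ?num_real//.
by rewrite lerD// lerXn2r// nnegrE// (le_trans _ c).
Qed.
(** The real and imaginary parts of the product are dominated by |F|^2 + |G|^2, an elementary form
    of Cauchy-Schwarz. *)
Lemma cL2M F G : cL2 F -> cL2 G -> cintegrable (fun t => F t * G t).
Proof.
move=> [mF iF] [mG iG]; have [a b] := cmeasM mF mG.
split; apply: (rint_le _ _ (rintD iF iG)) => // t _.
- rewrite cReM; set x := Re (F t); set y := Im (F t).
  set z := Re (G t); set w := Im (G t).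
  have := (sqr_ge0 (x - z), sqr_ge0 (y - w), sqr_ge0 (x + z), sqr_ge0 (y + w),
    sqr_ge0 x, sqr_ge0 y, sqr_ge0 z, sqr_ge0 w).
  by rewrite ler_norml => -[[[[[[[]]]]]]] *; apply/andP; split; nra.
- rewrite cImM; set x := Re (F t); set y := Im (F t).
  set z := Re (G t); set w := Im (G t).
  have := (sqr_ge0 (x - w), sqr_ge0 (y - z), sqr_ge0 (x + w), sqr_ge0 (y + z),
    sqr_ge0 x, sqr_ge0 y, sqr_ge0 z, sqr_ge0 w).
  by rewrite ler_norml => -[[[[[[[]]]]]]] *; apply/andP; split; nra.
Qed.
Lemma cL2D F G : cL2 F -> cL2 G -> cL2 (fun t => F t + G t).
Proof.
move=> [mF iF] [mG iG]; have [a b] := cmeasD mF mG; split=> //.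
apply: (rint_le _ _ (rintZ 2 (rintD iF iG))); first exact: rint_sqr_meas.
move=> t _; rewrite cReD cImD; set x := Re (F t); set y := Im (F t).
set z := Re (G t); set w := Im (G t).
have := sqr_ge0 (x - z); have := sqr_ge0 (y - w).
have := sqr_ge0 (x + z); have := sqr_ge0 (y + w).
by rewrite ler_norml => *; apply/andP; split; nra.
Qed.
Lemma cL2Mb F G : cL2 F -> cbounded G -> cL2 (fun t => F t * G t).
Proof.
move=> [mF iF] bG; have [mG _] := bG; have [a b] := cmeasM mF mG; split=> //.
have [_ iG] := cL2_cb bG; have [_ [M hM]] := bG.
apply: (rint_le _ _ (rintZ (M ^+ 2 + M ^+ 2) iF)); first exact: rint_sqr_meas.
move=> t /hM[c d]; rewrite cReM cImM.
set x := Re (F t); set y := Im (F t); set z := Re (G t) in c d *; set w := Im (G t) in c d *.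
rewrite ger0_norm ?addr_ge0 ?sqr_ge0//.
have -> : (x * z - y * w) ^+ 2 + (x * w + y * z) ^+ 2 =
  (z ^+ 2 + w ^+ 2) * (x ^+ 2 + y ^+ 2) by ring.
rewrite ler_wpM2r ?addr_ge0 ?sqr_ge0//.
rewrite -[z ^+ 2]real_normK ?num_real// -[w ^+ 2]real_normK ?num_real//.
by rewrite lerD// lerXn2r// nnegrE// (le_trans _ c).
Qed.
Lemma cL2_conj F : cL2 F -> cL2 (fun t => (F t)^*).
Proof.
move=> [mF iF]; split; first exact: cmeas_conj.
by apply: eq_rint iF => t _; rewrite cReJ cImJ sqrrN.
Qed.
Lemma cL2_ci F : cL2 F -> cintegrable F.
Proof.
move=> lF; apply: (eq_ci _ (cL2M lF (cL2_cb (cb_cst 1)))) => t _.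
by rewrite mulr1.
Qed.
Lemma cL2Z c F : cL2 F -> cL2 (fun t => c * F t).
Proof.
move=> iF; under eq_fun do rewrite mulrC; apply: cL2Mb => //; exact: cb_cst.
Qed.
Lemma cL2N F : cL2 F -> cL2 (fun t => - F t).
Proof. by under eq_fun do rewrite -mulN1r; exact: cL2Z. Qed.
Lemma cL2B F G : cL2 F -> cL2 G -> cL2 (fun t => F t - G t).
Proof. by move=> bF bG; apply: cL2D => //; exact: cL2N. Qed.

Lemma eq_cmean F G : {in I, F =1 G} -> cmean F = cmean G.
Proof.
by move=> e; apply: complexP => /=; apply: eq_rmean => t tI; rewrite e.
Qed.
Lemma ae_eq_cmean F G : cmeas F -> cmeas G ->
  {ae mu, forall t, I t -> F t = G t} -> cmean F = cmean G.
Proof.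
move=> [a b] [c d] e; apply: complexP => /=; apply: ae_eq_rmean => //;
  by apply: ae_imply e => t h /h ->.
Qed.
Lemma cmean_real u : cmean (fun t => (u t)%:C%C) = (rmean u)%:C%C.
Proof. by apply: complexP => //=; rewrite rmean_cst. Qed.
Lemma cmean_cst c : cmean (fun=> c) = c.
Proof. by apply: complexP => /=; rewrite rmean_cst. Qed.
Lemma cmeanD F G : cintegrable F -> cintegrable G ->
  cmean (fun t => F t + G t) = cmean F + cmean G.
Proof.
move=> [a b] [c d]; apply: complexP => /=; rewrite -rmeanD//;
  by apply: eq_rmean => t _; rewrite ?cReD ?cImD.
Qed.
Lemma cmeanZ c F : cintegrable F -> cmean (fun t => c * F t) = c * cmean F.
Proof.
move=> [a b]; apply: complexP; rewrite ?cReM ?cImM /= -?rmeanZ//.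
- rewrite -rmeanB; [|exact: rintZ|exact: rintZ].
  by apply: eq_rmean => t _; rewrite cReM.
- rewrite -rmeanD; [|exact: rintZ|exact: rintZ].
  by apply: eq_rmean => t _; rewrite cImM.
Qed.
Lemma cmeanN F : cintegrable F -> cmean (fun t => - F t) = - cmean F.
Proof.
by move=> iF; rewrite -mulN1r -cmeanZ//; apply: eq_cmean => t _; rewrite mulN1r.
Qed.
Lemma cmeanB F G : cintegrable F -> cintegrable G ->
  cmean (fun t => F t - G t) = cmean F - cmean G.
Proof. by move=> iF iG; rewrite cmeanD ?cmeanN//; exact: ciN. Qed.
Lemma cmean_sum (J : Type) (s : seq J) (F : J -> R -> C) :
  (forall j, cintegrable (F j)) ->
  cmean (fun t => \sum_(j <- s) F j t) = \sum_(j <- s) cmean (F j).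
Proof.
move=> h; elim: s => [|j s IH].
  by rewrite big_nil -[RHS](cmean_cst 0); apply: eq_cmean => t _; rewrite big_nil.
rewrite big_cons -IH -cmeanD//; last exact: ci_sum.
by apply: eq_cmean => t _; rewrite big_cons.
Qed.
Lemma cmean_conj F : cintegrable F -> cmean (fun t => (F t)^*) = (cmean F)^*.
Proof.
move=> [a b]; apply: complexP; rewrite ?cReJ ?cImJ /=.
  by apply: eq_rmean => t _; rewrite cReJ.
by rewrite -rmeanN//; apply: eq_rmean => t _; rewrite cImJ.
Qed.

End CircleIntegral.

(** * The parametrization of the circle and the means of powers of z *)

Section Exponential.
Variable R : realType.
Local Notation C := R[i].
Local Notation mu := (@lebesgue_measure R).
Local Notation I := `[0, 2 * pi : R]%classic.
Local Notation Re := complex.Re.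
Local Notation Im := complex.Im.
Implicit Types (r M : R) (u v : R -> R) (F G H : R -> C).

Definition ccont F := continuous (fun t => Re (F t)) /\ continuous (fun t => Im (F t)).

Lemma continuous_bounded u : continuous u -> exists M, forall t, I t -> `|u t| <= M.
Proof.
move=> cu; have := @EVT_max R (fun t => `|u t|) 0 (2 * pi) (ltW (twopi_gt0 R)).
case=> [|c _ h].
  by apply: continuous_subspaceT => t; apply: cvg_norm; exact: cu.
by exists `|u c| => t It; apply: h.
Qed.

Lemma cb_cont F : ccont F -> cbounded F.
Proof.
move=> [cR cI]; have [M hM] := continuous_bounded cR.
have [N hN] := continuous_bounded cI; split.
  by split; apply: measurable_funTS; exact: continuous_measurable_fun.
exists (M + N) => t It; split.
  by rewrite (le_trans (hM t It))// lerDl (le_trans _ (hN t It)).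
by rewrite (le_trans (hN t It))// lerDr (le_trans _ (hM t It)).
Qed.

Lemma FTC (F f : R -> R) (a b : R) : a < b -> continuous f ->
  (forall x : R, is_derive x 1 F (f x)) ->
  (\int[mu]_(x in `[a, b]) (f x)%:E = (F b - F a)%:E)%E.
Proof.
move=> ab cf dF.
have cF : continuous F.
  by move=> x; apply: differentiable_continuous; apply/derivable1_diffP; case: (dF x).
rewrite (continuous_FTC2 (F := F) ab) ?EFinB//.
- exact: continuous_subspaceT.
- split; first by move=> x _; case: (dF x).
    exact/cvg_at_right_filter/cF.
  exact/cvg_at_left_filter/cF.
- by move=> x _; rewrite derive1E; apply: derive_val.
Qed.

Lemma rmean_FTC (F f : R -> R) : continuous f ->
  (forall x : R, is_derive x 1 F (f x)) ->
  rmean f = (2 * pi)^-1 * (F (2 * pi) - F 0).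
Proof. by move=> cf dF; rewrite /rmean /Rintegral (FTC (twopi_gt0 R) cf dF). Qed.

Lemma expi_conj t : (expi t : C) * (expi t)^* = 1.
Proof.
apply: complexP; rewrite ?cReM ?cImM cReJ cImJ /=.
  by rewrite mulrN opprK -!expr2 cos2Dsin2.
by rewrite mulrN mulrC addrC subrr.
Qed.

Lemma expi_neq0 t : (expi t : C) != 0.
Proof.
by apply/eqP => h; have := expi_conj t; rewrite h mul0r => /esym/eqP; rewrite oner_eq0.
Qed.

Lemma conj_expi t : (expi t : C)^* = (expi t)^-1.
Proof. by rewrite -[LHS]mul1r -(mulVf (expi_neq0 t)) -mulrA expi_conj mulr1. Qed.

Lemma expiD s t : expi (s + t) = expi s * expi t :> C.
Proof.
apply: complexP; rewrite ?cReM ?cImM /= ?cosD ?sinD//.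
by rewrite addrC.
Qed.

Lemma expi0 : expi 0 = 1 :> C.
Proof. by apply: complexP; rewrite /= ?cos0 ?sin0. Qed.

Lemma expiX t n : (expi t : C) ^+ n = expi (n%:R * t).
Proof.
elim: n => [|n IH]; first by rewrite mul0r expi0.
by rewrite exprS IH -expiD -addn1 natrD mulrDl mul1r addrC.
Qed.

Lemma ccont_expi : ccont (@expi R).
Proof. by split; [exact: continuous_cos|exact: continuous_sin]. Qed.

Lemma cb_expi : cbounded (@expi R). Proof. exact/cb_cont/ccont_expi. Qed.
Lemma cb_expiX n : cbounded (fun t => (expi t : C) ^+ n).
Proof. exact/cbX/cb_expi. Qed.

(** The antiderivatives, sin and -cos of (n+1) t divided by n+1, take equal values at 0 and 2 pi. *)
Lemma cmean_expiX n : cmean (fun t => (expi t : C) ^+ n.+1) = 0.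
Proof.
have n0 : (n.+1%:R : R) != 0 by rewrite pnatr_eq0.
have np : cos (n.+1%:R * (2 * pi)) = 1 :> R /\ sin (n.+1%:R * (2 * pi)) = 0 :> R.
  have : (expi (n.+1%:R * (2 * pi)) : C) = 1.
    rewrite -expiX (_ : expi _ = 1) ?expr1n//.
    by apply: complexP; rewrite /= mulr_natl ?cos2pi ?sin2pi.
  by case.
apply: complexP => /=.
- transitivity (rmean (fun t : R => cos (n.+1%:R * t))).
    by apply: eq_rmean => t _; rewrite expiX.
  apply: (etrans (@rmean_FTC (fun t => n.+1%:R^-1 * sin (n.+1%:R * t)) _ _ _)).
  + move=> t; apply: continuous_comp; last exact: continuous_cos.
    by apply: cvgM; [exact: cvg_cst|exact: cvg_id].
  + move=> x; apply: is_derive_eq.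
    by rewrite /GRing.scale/=; field; rewrite addrC natr1.
  + by rewrite np.2 !mulr0 sin0 !mulr0 subrr mulr0.
- transitivity (rmean (fun t : R => sin (n.+1%:R * t))).
    by apply: eq_rmean => t _; rewrite expiX.
  apply: (etrans (@rmean_FTC (fun t => - n.+1%:R^-1 * cos (n.+1%:R * t)) _ _ _)).
  + move=> t; apply: continuous_comp; last exact: continuous_sin.
    by apply: cvgM; [exact: cvg_cst|exact: cvg_id].
  + move=> x; apply: is_derive_eq.
    by rewrite /GRing.scale/=; field; rewrite addrC natr1.
  + by rewrite np.1 !mulr0 cos0 !mulr1 subrr mulr0.
Qed.

End Exponential.

(** * The kernel 1 / (1 - conj lam z), the factor b_lam and the space H^1 *)

Section Poisson.
Variable R : realType.
Local Notation C := R[i].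
Local Notation mu := (@lebesgue_measure R).
Local Notation I := `[0, 2 * pi : R]%classic.
Local Notation Re := complex.Re.
Local Notation Im := complex.Im.
Implicit Types (r M : R) (u v : R -> R) (F G H : R -> C).
Variable lam : C.
Hypothesis hlam : `|lam| < 1.

Local Notation z t := (expi t : C).

(** The denominator of b_lam on the circle; its inverse [ck] is the Szego kernel of H^2 at lam. *)
Definition cden (t : R) : C := 1 - lam^* * expi t.
Definition ck (t : R) : C := (cden t)^-1.
Definition bt (t : R) : C := blaschke lam (expi t).

Lemma lam_lt1 : Re lam ^+ 2 + Im lam ^+ 2 < 1.
Proof. by rewrite -ltcR -sqr_norm_ReIm expr_lt1. Qed.

Lemma cdenE t : (cden t = (1 - (Re lam * cos t + Im lam * sin t))
   +i* - (Re lam * sin t - Im lam * cos t))%C.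
Proof.
by apply: complexP; rewrite /cden !(cReD,cImD,cReM,cImM,cReJ,cImJ)/=;
  case: lam => a b /=; ring.
Qed.

(** The real part of conj lam z is at most |lam| < 1. Positivity is stronger than nonvanishing: it
    makes atan (Im / Re) a globally smooth argument of [cden] in the change of variable. *)
Lemma cden_gt0 t : 0 < Re (cden t).
Proof.
rewrite cdenE/= subr_gt0; have := lam_lt1; have := cos2Dsin2 t.
set a := Re lam; set b := Im lam; set c := cos t; set d := sin t => e h.
have h' : (a * c + b * d) ^+ 2 < 1.
  (* Lagrange's identity gives Cauchy-Schwarz for the vectors (a, b) and (c, d), the latter of norm
     1. *)
  have := sqr_ge0 (a * d - b * c).
  have : (a * c + b * d) ^+ 2 + (a * d - b * c) ^+ 2 = (a ^+ 2 + b ^+ 2) * (c ^+ 2 + d ^+ 2) by ring.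
  by rewrite e mulr1 => e'; lra.
by rewrite ltNge; apply/negP => g; move: h'; rewrite ltNge exprn_ege1.
Qed.

Lemma cden_neq0 t : cden t != 0.
Proof. by apply/eqP => h; have := cden_gt0 t; rewrite h ltxx. Qed.

Lemma ccont_cden : ccont cden.
Proof.
have [cc cs] := ccont_expi R; split.
  rewrite (_ : (fun t => _) = (fun t => 1 - (Re lam * cos t + Im lam * sin t))).
    move=> t; apply: cvgB; first exact: cvg_cst.
    by apply: cvgD; apply: cvgM; (try exact: cvg_cst); [exact: cc|exact: cs].
  by apply/funext => t; rewrite cdenE.
rewrite (_ : (fun t => _) = (fun t => - (Re lam * sin t - Im lam * cos t))).
  move=> t; apply: cvgN.
  by apply: cvgB; apply: cvgM; (try exact: cvg_cst); [exact: cs|exact: cc].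
by apply/funext => t; rewrite cdenE.
Qed.

Lemma normr_cden_gt0 t : 0 < Re (cden t) ^+ 2 + Im (cden t) ^+ 2.
Proof. by rewrite ltr_wpDr ?sqr_ge0// exprn_gt0// cden_gt0. Qed.

Lemma ccont_ck : ccont ck.
Proof.
have [cR cI] := ccont_cden.
have cN : continuous (fun t => (Re (cden t) ^+ 2 + Im (cden t) ^+ 2)^-1).
  move=> t; apply: cvgV; first exact/lt0r_neq0/normr_cden_gt0.
  by apply: cvgD; rewrite expr2; apply: cvgM; [exact: cR|exact: cR|exact: cI|exact: cI].
split.
  rewrite (_ : (fun t => _) =
      (fun t => Re (cden t) * (Re (cden t) ^+ 2 + Im (cden t) ^+ 2)^-1)).
    by move=> t; apply: cvgM; [exact: cR|exact: cN].
  by apply/funext => t; rewrite /ck; case: (cden t).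
rewrite (_ : (fun t => _) =
    (fun t => - (Im (cden t) * (Re (cden t) ^+ 2 + Im (cden t) ^+ 2)^-1))).
  by move=> t; apply: cvgN; apply: cvgM; [exact: cI|exact: cN].
by apply/funext => t; rewrite /ck; case: (cden t).
Qed.

Lemma cb_ck : cbounded ck. Proof. exact/cb_cont/ccont_ck. Qed.

Lemma btE t : bt t = (z t - lam) * ck t. Proof. by []. Qed.
Lemma cb_bt : cbounded bt.
Proof. by apply: cbM; [apply: cbB; [exact: cb_expi|exact: cb_cst]|exact: cb_ck]. Qed.

(** Here |z| = 1 enters: numerator and denominator of b_lam are conjugate up to the factor z, which
    makes b_lam unimodular on the circle. *)
Lemma sub_lamE t : z t - lam = z t * (cden t)^*.
Proof.
rewrite /cden rmorphB rmorph1 rmorphM /= conjCK mulrBr mulr1.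
by rewrite mulrCA expi_conj mulr1.
Qed.

Lemma sub_lam_ckJ t : (z t - lam) * (ck t)^* = z t.
Proof.
rewrite sub_lamE /ck -mulrA -[RHS]mulr1; congr (_ * _).
by rewrite fmorphV mulfV// fmorph_eq0 cden_neq0.
Qed.

Lemma ck_cden t : cden t * ck t = 1.
Proof. by rewrite mulfV// cden_neq0. Qed.

(** One step of the geometric series with its remainder; iterating this identity replaces the
    expansion of the kernel. *)
Lemma ckE t : ck t = 1 + lam^* * z t * ck t.
Proof. by rewrite -{1}(ck_cden t) /cden; ring. Qed.

(** One factor b turns the antianalytic conj(ck) into the analytic z ck; all orthogonality relations
    below come from this. *)
Lemma ckJ_bt t : (ck t)^* * bt t = z t * ck t.
Proof. by rewrite btE mulrA [_^* * _]mulrC sub_lam_ckJ. Qed.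

Lemma bt_conj t : bt t * (bt t)^* = 1.
Proof.
rewrite btE rmorphM /= mulrACA [ck t * _]mulrC -mulrACA sub_lam_ckJ.
rewrite -[ck t in X in _ * X]conjCK -rmorphM sub_lam_ckJ.
exact: expi_conj.
Qed.

(** The space H^1: the mean of F z^(m+1) is the Fourier coefficient of index -(m+1). Integrability
    survives every multiplication by a bounded function; square integrability is tracked
    separately. *)
Definition hardy1 F := cintegrable F /\ forall m, cmean (fun t => F t * z t ^+ m.+1) = 0.

Lemma eq_hardy1 F G : {in I, F =1 G} -> hardy1 F -> hardy1 G.
Proof.
move=> e [a h]; split; first exact: eq_ci a.
by move=> m; rewrite -[RHS](h m); apply: eq_cmean => t It; rewrite e.
Qed.
Lemma hardy1D F G : hardy1 F -> hardy1 G -> hardy1 (fun t => F t + G t).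
Proof.
move=> [a h] [b k]; split; first exact: ciD.
move=> m; under eq_cmean do rewrite mulrDl.
by rewrite cmeanD ?h ?k ?addr0//; apply: ciM => //; exact: cb_expiX.
Qed.
Lemma hardy1Z c F : hardy1 F -> hardy1 (fun t => c * F t).
Proof.
move=> [a h]; split; first exact: ciZ.
move=> m; under eq_cmean do rewrite -mulrA.
by rewrite cmeanZ ?h ?mulr0//; apply: ciM => //; exact: cb_expiX.
Qed.
Lemma hardy1N F : hardy1 F -> hardy1 (fun t => - F t).
Proof. by under eq_fun do rewrite -mulN1r; exact: hardy1Z. Qed.
Lemma hardy1B F G : hardy1 F -> hardy1 G -> hardy1 (fun t => F t - G t).
Proof. by move=> hF hG; apply: hardy1D => //; exact: hardy1N. Qed.
Lemma hardy1z F : hardy1 F -> hardy1 (fun t => F t * z t).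
Proof.
move=> [a h]; split; first by apply: ciM => //; exact: cb_expi.
move=> m; rewrite -[RHS](h m.+1); apply: eq_cmean => t _.
by rewrite -mulrA -exprS.
Qed.
Lemma hardy1_cst c : hardy1 (fun=> c).
Proof.
split; first exact/ci_cb/cb_cst.
by move=> m; rewrite cmeanZ ?cmean_expiX ?mulr0//; exact/ci_cb/cb_expiX.
Qed.
Lemma hardy1_z F : hardy1 F -> cmean (fun t => F t * z t) = 0.
Proof. by move=> [_ h]; rewrite -[RHS](h 0%N). Qed.

Lemma norm_cmean F : cintegrable F -> 
  `|cmean F| <= (rmean (fun t => `|Re (F t)|) + rmean (fun t => `|Im (F t)|))%:C%C.
Proof.
move=> [a b]; rewrite [cmean F]complexE.
rewrite (le_trans (ler_normD _ _))// rmorphD/= lerD//.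
  by rewrite normc_def/= expr0n/= addr0 sqrtr_sqr lecR norm_rmean.
rewrite normrM (_ : `|'i%C| = 1 :> C) ?mul1r; last first.
  by rewrite normc_def/= expr0n/= add0r expr1n sqrtr1.
by rewrite normc_def/= expr0n/= addr0 sqrtr_sqr lecR norm_rmean.
Qed.

Lemma geometric_small (x q M : R) : `|q| < 1 -> (forall j, x <= q ^+ j * M) -> x <= 0.
Proof.
move=> q1 h.
have : (fun j => q ^+ j * M) @ \oo --> (0 * M : R).
  by apply: cvgM; [exact: cvg_expr|exact: cvg_cst].
rewrite mul0r => c; rewrite -(cvg_lim _ c)//.
by apply: limr_ge; [by apply/cvg_ex; exists 0|exact: nearW].
Qed.

(* Division by 1 - conj lam z preserves H^1: the coefficients c m of the quotient satisfy
   c m = conj lam * c m.+1 and are bounded, so they vanish. *)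
Lemma hardy1_ck F : hardy1 F -> hardy1 (fun t => F t * ck t).
Proof.
move=> [a h]; have iFk : cintegrable (fun t => F t * ck t) by apply: ciM => //; exact: cb_ck.
split=> // m.
pose c m := cmean (fun t => F t * ck t * z t ^+ m.+1).
have ic j : cintegrable (fun t => F t * ck t * z t ^+ j) by apply: ciM => //; exact: cb_expiX.
have cS j : c j = lam^* * c j.+1.
  rewrite /c -cmeanZ//; apply/eqP; rewrite -subr_eq0 -cmeanB//; last exact: ciZ.
  rewrite -[eqbRHS](h j); apply/eqP/eq_cmean => t _.
  by rewrite -[F t in RHS]mulr1 -(ck_cden t) /cden [z t ^+ j.+2]exprS; ring.
have cE j i : c i = lam^* ^+ j * c (i + j)%N.
  elim: j i => [|j IH] i; first by rewrite mul1r addn0.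
  by rewrite cS IH addSnnS exprS mulrA.
pose B := rmean (fun t => `|Re (F t * ck t)| + `|Im (F t * ck t)|).
have cB j : `|c j| <= (B + B)%:C%C.
  apply: (le_trans (norm_cmean (ic _))); rewrite lecR.
  have [iR iI] := iFk; have [iR' iI'] := ic j.+1.
  have i1 := rintD (rint_norm iR) (rint_norm iI).
  apply: lerD; apply: le_rmean => //; (try exact: rint_norm) => t _.
  - rewrite expiX; move: (F t * ck t) => X; rewrite cReM.
    by rewrite (le_trans (ler_normB _ _))// !normrM lerD// ler_piMr ?cos_max ?sin_max.
  - rewrite expiX; move: (F t * ck t) => X; rewrite cImM.
    by rewrite (le_trans (ler_normD _ _))// !normrM lerD// ler_piMr ?cos_max ?sin_max.
apply/eqP; rewrite -normr_le0 -/(c m).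
have nr (x : C) : `|x| = (Re `|x|)%:C%C by rewrite normc_def.
have r0 : 0 <= Re `|lam| by rewrite -lecR -nr; exact: normr_ge0.
have r1 : Re `|lam| < 1 by rewrite -ltcR -nr; exact: hlam.
rewrite nr lecR; apply: (@geometric_small _ (Re `|lam|) (B + B)).
  by rewrite ger0_norm.
move=> j; rewrite -lecR -nr (cE j) normrM normrX norm_conjC rmorphM rmorphXn/= -nr.
by rewrite ler_wpM2l// exprn_ge0.
Qed.

Lemma hardy1_bt F : hardy1 F -> hardy1 (fun t => F t * bt t).
Proof.
move=> hF; apply: (eq_hardy1 (F := fun t => (F t * z t - lam * F t) * ck t)).
  by move=> t _; rewrite btE mulrA mulrBr [F t * lam]mulrC.
by apply/hardy1_ck/hardy1B; [exact: hardy1z|exact: hardy1Z].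
Qed.
Lemma hardy1_btX F n : hardy1 F -> hardy1 (fun t => F t * bt t ^+ n).
Proof.
move=> hF; elim: n => [|n IH].
  by apply: eq_hardy1 hF => t _; rewrite mulr1.
by apply: eq_hardy1 (hardy1_bt IH) => t _; rewrite exprSr mulrA.
Qed.

(** By [ckE] the kernel is 1 plus z times an H^1 function, and the latter product has mean 0. *)
Lemma cmean_ck : cmean ck = 1.
Proof.
transitivity (cmean (fun t => 1 + (lam^* * ck t) * z t)).
  by apply: eq_cmean => t _; rewrite {1}ckE mulrAC.
have h : hardy1 (fun t => lam^* * ck t).
  apply/hardy1Z; apply: eq_hardy1 (hardy1_ck (hardy1_cst 1)) => t _; exact: mul1r.
rewrite cmeanD ?cmean_cst ?hardy1_z ?addr0//; first exact/ci_cb/cb_cst.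
by apply: ciM; [case: h|exact: cb_expi].
Qed.

(** This is 1 - |lam|^2, the inverse of the squared norm of [ck]. *)
Definition s2 : R := 1 - (Re lam ^+ 2 + Im lam ^+ 2).
Lemma s2_gt0 : 0 < s2. Proof. by rewrite subr_gt0 lam_lt1. Qed.
Lemma s2E : s2%:C%C = 1 - lam^* * lam.
Proof.
by rewrite /s2; apply: complexP; rewrite !(cReD,cImD,cReM,cImM,cReJ,cImJ)/=;
  case: lam => a b /=; rewrite ?cReM ?cImM ?cReJ ?cImJ /=; ring.
Qed.

(** Inserting [ckE] twice gives the linear equation c = 1 + |lam|^2 c for the squared norm c of the
    kernel. *)
Lemma cmean_ckJck : cmean (fun t => ck t * (ck t)^*) * s2%:C%C = 1.
Proof.
have cbk := cb_ck.
have ikk : cintegrable (fun t => ck t * (ck t)^*) by apply/ci_cb/cbM => //; exact: cb_conj.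
set c := cmean _.
have e : c = 1 + lam * (lam^* * c).
  transitivity (cmean (fun t => ck t + lam * ((ck t * z t)^* + lam^* * (ck t * (ck t)^*)))).
    apply: eq_cmean => t _.
    have E : ck t * (ck t)^* = ck t + lam * ((z t)^* * ck t * (ck t)^*).
      by rewrite {2}(ckE t) !(rmorphD,rmorphM,rmorph1)/= conjCK; ring.
    rewrite [LHS]E; congr (_ + lam * _); rewrite {1}(ckE t) rmorphM /=.
    transitivity ((ck t)^* * (z t)^* + lam^* * (((z t)^* * z t) * (ck t * (ck t)^*))).
      by ring.
    by rewrite [_^* * z t]mulrC expi_conj mul1r.
  have h : hardy1 ck by apply: eq_hardy1 (hardy1_ck (hardy1_cst 1)) => t _; exact: mul1r.
  have ikz : cintegrable (fun t => ck t * z t) by apply: ciM; [case: h|exact: cb_expi].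
  rewrite cmeanD; [|exact: ci_cb|]; last by apply/ciZ/ciD; [exact: ci_conj|exact: ciZ].
  rewrite cmean_ck cmeanZ; last by apply/ciD; [exact: ci_conj|exact: ciZ].
  rewrite cmeanD; [|exact: ci_conj|exact: ciZ].
  by rewrite cmean_conj// hardy1_z// rmorph0 add0r cmeanZ.
by rewrite s2E mulrBr mulr1 {1}e; ring.
Qed.

End Poisson.

(** * The Takenaka-Malmquist basis *)

Section ModelSpace.
Variable R : realType.
Local Notation C := R[i].
Local Notation mu := (@lebesgue_measure R).
Local Notation I := `[0, 2 * pi : R]%classic.
Local Notation Re := complex.Re.
Local Notation Im := complex.Im.
Implicit Types (r M : R) (u v : R -> R) (F G H : R -> C) (g h : C -> C).

Lemma L2_cL2 g : L2 g <-> cL2 (g \o @expi R).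
Proof.
have e t : complex.Re (`|g (expi t)| ^+ 2 : C) = Re (g (expi t)) ^+ 2 + Im (g (expi t)) ^+ 2.
  by rewrite sqr_norm_ReIm.
split; first by move=> [a b c]; split=> //; apply: eq_integrable c => // t _; exact: (congr1 EFin (e t)).
by move=> [[a b] c]; split=> //; apply: eq_integrable c => // t _; exact: (congr1 EFin (esym (e t))).
Qed.

Lemma hardy2P g : hardy2 g <-> cL2 (g \o @expi R) /\ hardy1 (g \o @expi R).
Proof.
(* [Negz m] is -(m+1), and [inner] conjugates its second argument: the negative coefficients are
   means against z^(m+1). *)
have e m t : ((expi t : C) ^ Negz m)^* = expi t ^+ m.+1.
  rewrite [_ ^ _](_ : _ = (expi t ^+ m.+1)^-1)//.
  by rewrite fmorphV rmorphXn /= conj_expi exprVn invrK.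
split.
  move=> [/L2_cL2 lg hg]; split=> //; split; first exact: cL2_ci.
  by move=> m; rewrite -[RHS](hg (Negz m))//; apply: eq_cmean => t _; rewrite e.
move=> [lg [_ hg]]; split; first exact/L2_cL2.
by case=> // m _; rewrite -[RHS](hg m); apply: eq_cmean => t _; rewrite e.
Qed.

Lemma inner_conj g h : cL2 (g \o @expi R) -> cL2 (h \o @expi R) ->
  inner h g = (inner g h)^*.
Proof.
move=> lg lh; rewrite [inner g h]/(cmean _) -cmean_conj; last exact/(cL2M lg)/cL2_conj.
by apply: eq_cmean => t _; rewrite rmorphM /= conjCK mulrC.
Qed.

Lemma innerDl g1 g2 h : cL2 (g1 \o @expi R) -> cL2 (g2 \o @expi R) ->
  cL2 (h \o @expi R) -> inner (fun z => g1 z + g2 z) h = inner g1 h + inner g2 h.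
Proof.
move=> l1 l2 lh; rewrite -[RHS]cmeanD; [|exact/(cL2M l1)/cL2_conj|exact/(cL2M l2)/cL2_conj].
by apply: eq_cmean => t _; rewrite mulrDl.
Qed.

Lemma innerZl c g h : cL2 (g \o @expi R) ->
  cL2 (h \o @expi R) -> inner (fun z => c * g z) h = c * inner g h.
Proof.
move=> l1 lh; rewrite -[RHS]cmeanZ; last exact/(cL2M l1)/cL2_conj.
by apply: eq_cmean => t _; rewrite mulrA.
Qed.

Lemma cL2_sum (J : Type) (s : seq J) (F : J -> R -> C) :
  (forall j, cL2 (F j)) -> cL2 (fun t => \sum_(j <- s) F j t).
Proof.
move=> h; elim: s => [|j s IH].
  by under eq_fun do rewrite big_nil; exact/cL2_cb/cb_cst.
by under eq_fun do rewrite big_cons; exact: cL2D.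
Qed.

Lemma inner_suml (J : Type) (s : seq J) (c : J -> C) (g : J -> C -> C) h :
  (forall j, cL2 (g j \o @expi R)) -> cL2 (h \o @expi R) ->
  inner (fun z => \sum_(j <- s) c j * g j z) h = \sum_(j <- s) c j * inner (g j) h.
Proof.
move=> lg lh.
transitivity (\sum_(j <- s) inner (fun z => c j * g j z) h).
  rewrite -[RHS]cmean_sum.
    by apply: eq_cmean => t _; rewrite mulr_suml.
  by move=> j; apply: cL2M; [exact: (cL2Z (c j) (lg j))|exact: cL2_conj].
by apply: eq_bigr => j _; rewrite innerZl.
Qed.

Lemma inner_eq0 g : cL2 (g \o @expi R) -> inner g g = 0 ->
  {ae mu, forall t, I t -> g (expi t) = 0}.
Proof.
move=> lg e.
have : rmean (fun t => Re (g (expi t)) ^+ 2 + Im (g (expi t)) ^+ 2) = 0.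
  suff : (rmean (fun t => Re (g (expi t)) ^+ 2 + Im (g (expi t)) ^+ 2))%:C%C = 0 :> C by case.
  rewrite -cmean_real -e; apply: eq_cmean => t _.
  by rewrite -sqr_norm_ReIm normCK.
move=> /(rmean_eq0 lg.2) h.
have : {ae mu, forall t, I t -> Re (g (expi t)) ^+ 2 + Im (g (expi t)) ^+ 2 = 0}.
  by apply: h => t _; rewrite addr_ge0 ?sqr_ge0.
apply: ae_imply => t h' It; have /eqP := h' It.
rewrite paddr_eq0 ?sqr_ge0// !sqrf_eq0 => /andP[/eqP a /eqP b].
exact: complexP.
Qed.

Lemma eq_inner g h g' h' : (forall t, I t -> g (expi t) = g' (expi t)) ->
  (forall t, I t -> h (expi t) = h' (expi t)) -> inner g h = inner g' h'.
Proof. by move=> e1 e2; apply: eq_cmean => t /set_mem It; rewrite e1 ?e2. Qed.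

Variable lam : C.
Hypothesis hlam : `|lam| < 1.
Local Notation z t := (expi t : C).
Local Notation ck := (ck lam).
Local Notation bt := (bt lam).
Local Notation s := (Num.sqrt (s2 lam)).

Definition takenaka (i : nat) (x : C) : C :=
  s%:C%C / (1 - lam^* * x) * blaschke lam x ^+ i.
Local Notation E := takenaka.

Lemma takenakaE i t : E i (expi t) = s%:C%C * ck t * bt t ^+ i.
Proof. by []. Qed.

Lemma s_sqr : s%:C%C * s%:C%C = (s2 lam)%:C%C :> C.
Proof. by rewrite -rmorphM /= -expr2 sqr_sqrtr// (ltW (s2_gt0 hlam)). Qed.

Lemma s_conj : (s%:C%C : C)^* = s%:C%C.
Proof. by apply: complexP; rewrite ?cReJ ?cImJ /= ?oppr0. Qed.

Lemma cb_takenaka i : cbounded (E i \o @expi R).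
Proof.
apply: cbM; last exact/cbX/(cb_bt hlam).
by apply: cbM; [exact: cb_cst|exact: (cb_ck hlam)].
Qed.

Lemma cL2_takenaka i : cL2 (E i \o @expi R).
Proof. exact/cL2_cb/cb_takenaka. Qed.

Lemma hardy1_ckbX n : hardy1 (fun t => ck t * bt t ^+ n).
Proof.
apply/(hardy1_btX hlam); apply: eq_hardy1 (hardy1_ck hlam (hardy1_cst 1)) => t _.
exact: mul1r.
Qed.

Lemma hardy_takenaka i : hardy2 (E i).
Proof.
apply/hardy2P; split; first exact: cL2_takenaka.
apply: eq_hardy1 (hardy1Z s%:C%C (hardy1_ckbX i)) => t _ /=.
by rewrite takenakaE mulrA.
Qed.

(** By [ckJ_bt] one of the m+1 factors b absorbs conj(ck) and leaves z times an H^1 function. *)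
Lemma hardy1_ckJ_bt F m : hardy1 F -> cmean (fun t => F t * (ck t)^* * bt t ^+ m.+1) = 0.
Proof.
move=> hF; rewrite -[RHS](hardy1_z (hardy1_btX hlam m (hardy1_ck hlam hF))).
apply: eq_cmean => t _; rewrite exprS mulrA -[F t * _ * _]mulrA (ckJ_bt hlam).
by ring.
Qed.

(** For j <= i the product b^i conj(b)^j collapses to b^(i-j). Off the diagonal a positive power of
    b remains and [hardy1_ckJ_bt] applies; on it the norm of the kernel remains. *)
Lemma takenaka_orth i j : inner (E i) (E j) = (i == j)%:R.
Proof.
wlog ij : i j / (j <= i)%N.
  move=> W; have /orP[|] := leq_total j i; first exact: W.
  move=> /W e; rewrite inner_conj ?e ?conjC_nat; [|exact: cL2_takenaka..].
  by rewrite eq_sym.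
transitivity ((s2 lam)%:C%C * cmean (fun t => ck t * (ck t)^* * bt t ^+ (i - j))).
  rewrite -cmeanZ; last first.
    apply/ci_cb/cbM; last exact/cbX/(cb_bt hlam).
    by apply: cbM; [|apply: cb_conj]; exact: (cb_ck hlam).
  apply: eq_cmean => t _; rewrite !takenakaE -s_sqr -{1}(subnK ij) exprD.
  rewrite !rmorphM /= rmorphXn s_conj.
  have : bt t ^+ j * (bt t)^* ^+ j = 1 by rewrite -exprMn (bt_conj hlam) expr1n.
  move: (bt t ^+ (i - j)) (bt t ^+ j) => x y e.
  transitivity (s%:C%C * s%:C%C * (ck t * (ck t)^* * x) * (y * (bt t)^* ^+ j)); first by ring.
  by rewrite e mulr1.
have [->|/eqP ne] := eqVneq i j.
  rewrite subnn mulrC -[RHS](cmean_ckJck hlam); congr (_ * _).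
  by apply: eq_cmean => t _; rewrite mulr1.
have -> : (i - j = (i - j).-1.+1)%N by rewrite prednK// subn_gt0 ltn_neqAle ij eq_sym andbT; apply/eqP.
rewrite hardy1_ckJ_bt ?mulr0//.
by apply: eq_hardy1 (hardy1_ckbX 0) => t _; rewrite mulr1.
Qed.

Local Notation K n := (model_space (fun x => blaschke lam x ^+ n)).

Lemma cL2_btXM n h : cL2 (h \o @expi R) ->
  cL2 ((fun x => blaschke lam x ^+ n * h x) \o @expi R).
Proof.
move=> lh; rewrite (_ : _ \o _ = fun t => h (expi t) * bt t ^+ n); last first.
  by apply/funext => t /=; rewrite mulrC.
by apply: cL2Mb => //; exact/cbX/(cb_bt hlam).
Qed.

(** The conjugated pairing contains conj(ck) b^(n-i) with n - i >= 1, so the cancellation of the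
    off-diagonal case applies. *)
Lemma takenaka_model n i : (i < n)%N -> K n (E i).
Proof.
move=> lt; split; first exact: hardy_takenaka.
move=> h /hardy2P[lh hh].
rewrite inner_conj; [|exact: cL2_btXM|exact: cL2_takenaka].
rewrite (_ : inner _ _ = s%:C%C * cmean (fun t => h (expi t) * (ck t)^* * bt t ^+ (n - i))).
  have -> : (n - i = (n - i).-1.+1)%N by rewrite prednK// subn_gt0.
  by rewrite hardy1_ckJ_bt// mulr0 rmorph0.
rewrite -cmeanZ; last first.
  apply: ciM; last exact/cbX/(cb_bt hlam).
  by apply: ciM; [case: hh|exact/cb_conj/(cb_ck hlam)].
apply: eq_cmean => t _; rewrite takenakaE -{1}(subnK (ltnW lt)) exprD.
rewrite !rmorphM /= rmorphXn s_conj.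
have : bt t ^+ i * (bt t)^* ^+ i = 1 by rewrite -exprMn (bt_conj hlam) expr1n.
rewrite -/(bt t); move: (bt t ^+ (n - i)) (bt t ^+ i) => x y e.
transitivity (s%:C%C * (h (expi t) * (ck t)^* * x) * (y * (bt t)^* ^+ i)); first by ring.
by rewrite e mulr1.
Qed.

(* h - <h, E_0> E_0 vanishes at lam, hence is divisible by b_lam. *)
Lemma hardy_step h : hardy2 h -> exists h1, hardy2 h1 /\
  forall t, h (expi t) = inner h (E 0) * E 0 (expi t) + bt t * h1 (expi t).
Proof.
move=> /hardy2P[lh hh]; set c := inner h (E 0).
have bt0 t : bt t != 0.
  by apply/eqP => e; have := bt_conj hlam t; rewrite e mul0r => /esym/eqP; rewrite oner_eq0.
exists (fun x => (h x - c * E 0 x) / blaschke lam x); split; last first.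
  by move=> t; rewrite [bt t * _]mulrCA -/(bt t) mulfV// mulr1 addrC subrK.
pose Q t := h (expi t) - c * E 0 (expi t).
have lQ : cL2 Q by apply: cL2B => //; exact/cL2Z/cL2_takenaka.
have hQ : hardy1 Q.
  by apply: hardy1B => //; apply: hardy1Z; have /hardy2P[] := hardy_takenaka 0.
have bkJ : cbounded (fun t => (ck t)^*) by exact/cb_conj/(cb_ck hlam).
have bzJ : cbounded (fun t => (z t)^*) by exact/cb_conj/cb_expi.
have iQk : cintegrable (fun t => Q t * (ck t)^*) by apply: ciM => //; exact: cL2_ci.
have ckJE t : (ck t)^* = 1 + lam * (z t)^* * (ck t)^*.
  by rewrite {1}(ckE hlam) !(rmorphD,rmorphM,rmorph1)/= conjCK.
(* This is the vanishing of Q at lam: [E 0] is a multiple of the kernel, and Q is orthogonal to it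
   by the choice of c. *)
have d0 : cmean (fun t => Q t * (ck t)^*) = 0.
  have s0 : s%:C%C != 0 :> C.
    by apply/eqP => e; have /eqP := s_sqr; rewrite e mul0r eq_sym => /eqP[] h0; have := s2_gt0 hlam; rewrite h0 ltxx.
  apply: (mulfI s0); rewrite mulr0 -cmeanZ//.
  transitivity (inner (fun x => h x + (- c) * E 0 x) (E 0)).
    by apply: eq_cmean => t _; rewrite /Q takenakaE !rmorphM /= s_conj mulr1 expr0 rmorph1; ring.
  rewrite innerDl; [|by []|exact/cL2Z/cL2_takenaka|exact: cL2_takenaka].
  rewrite innerZl; [|exact: cL2_takenaka..].
  by rewrite takenaka_orth eqxx mulr1 subrr.
(* With the negative coefficients, this puts Q conj(ck) in z H^1; dividing by z then stays in H^1.
   The induction multiplies [ckJE] by z^(m+1). *)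
have dm m : cmean (fun t => Q t * (ck t)^* * z t ^+ m) = 0.
  elim: m => [|m IH]; first by rewrite -[RHS]d0; apply: eq_cmean => t _; rewrite mulr1.
  transitivity (cmean (fun t => Q t * z t ^+ m.+1 + lam * (Q t * (ck t)^* * z t ^+ m))).
    apply: eq_cmean => t _; rewrite {1}ckJE [z t ^+ m.+1]exprS.
    transitivity (Q t * (z t * z t ^+ m) + lam * (Q t * (ck t)^* * z t ^+ m) * (z t * (z t)^*)); first by ring.
    by rewrite expi_conj mulr1.
  have i1 : cintegrable (fun t => Q t * (ck t)^* * z t ^+ m) by apply: ciM => //; exact: cb_expiX.
  rewrite cmeanD; [|by apply: ciM; [exact: cL2_ci|exact: cb_expiX]|exact: ciZ].
  by rewrite hQ.2 cmeanZ// IH mulr0 addr0.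
have hq : hardy1 (fun t => Q t * (ck t)^* * (z t)^*).
  split; first exact: ciM.
  move=> m; rewrite -[RHS](dm m); apply: eq_cmean => t _.
  by rewrite exprS mulrA -[_ * _ * z t]mulrA [_^* * z t]mulrC expi_conj mulr1.
(* 1/b is conj(z) conj(ck) times a polynomial of degree at most 1 in z, and multiplication by such a
   polynomial preserves H^1. *)
have e t : (bt t)^-1 = (ck t)^* * (z t)^* * cden lam t.
  apply: (mulfI (bt0 t)); rewrite mulfV// !mulrA [bt t * _]mulrC (ckJ_bt hlam).
  transitivity ((z t * (z t)^*) * (cden lam t * ck t)); last by ring.
  by rewrite expi_conj (ck_cden hlam) mulr1.
apply/hardy2P; split.
  rewrite (_ : _ \o _ = fun t => Q t * (bt t)^*).
    by apply: cL2Mb => //; exact/cb_conj/(cb_bt hlam).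
  apply/funext => t /=; rewrite -/(Q t) -/(bt t); congr (_ * _).
  by apply: (mulfI (bt0 t)); rewrite mulfV// (bt_conj hlam).
apply: (@eq_hardy1 _ (fun t => Q t * (ck t)^* * (z t)^* - lam^* * (Q t * (ck t)^* * (z t)^* * z t))).
  by move=> t _ /=; rewrite -/(bt t) e /cden /Q; ring.
by apply: hardy1B => //; apply/hardy1Z/hardy1z.
Qed.

(** Iterated division by b. For h in K the remainder b^n h1 is orthogonal to h, which is how
    completeness of the basis is obtained. *)
Lemma hardy_expand n h : hardy2 h -> exists (c : nat -> C) h1, hardy2 h1 /\
  forall t, h (expi t) = \sum_(i < n) c i * E i (expi t) + bt t ^+ n * h1 (expi t).
Proof.
elim: n h => [|n IH] h hh.
  by exists (fun=> 0), h; split=> // t; rewrite big_ord0 add0r mul1r.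
have [h1 [hh1 e1]] := hardy_step hh; have [c [h2 [hh2 e2]]] := IH _ hh1.
(* The coefficients of h1 move up by one index because b E_j = E_(j+1). *)
exists (fun i => if i is j.+1 then c j else inner h (E 0)), h2; split=> // t.
rewrite e1 e2 big_ord_recl /= -addrA mulrDr exprS -mulrA; congr (_ + (_ + _)).
rewrite mulr_sumr; apply: eq_bigr => i _.
by rewrite !takenakaE /bump /= add1n exprS; ring.
Qed.

Lemma modelB n g h : K n g -> K n h -> K n (fun x => g x - h x).
Proof.
move=> [/hardy2P[lg hg] og] [/hardy2P[lh hh] oh].
split; first by apply/hardy2P; split; [exact: cL2B|exact: hardy1B].
move=> k hk; have /hardy2P[lk _] := hk; have lbk := cL2_btXM n lk.
rewrite (_ : inner _ _ = inner (fun x => g x + (-1) * h x) (fun x => blaschke lam x ^+ n * k x)).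
  by rewrite innerDl ?innerZl ?og ?oh ?mulr0 ?addr0//; exact: cL2Z.
by apply: eq_cmean => t _; rewrite mulN1r.
Qed.

Lemma modelZ n c g : K n g -> K n (fun x => c * g x).
Proof.
move=> [/hardy2P[lg hg] og].
split; first by apply/hardy2P; split; [exact: cL2Z|exact: hardy1Z].
move=> k hk; have /hardy2P[lk _] := hk; have lbk := cL2_btXM n lk.
by rewrite innerZl ?og ?mulr0.
Qed.

Lemma model_sum n (J : Type) (r : seq J) (c : J -> C) (g : J -> C -> C) :
  (forall j, K n (g j)) -> K n (fun x => \sum_(j <- r) c j * g j x).
Proof.
move=> h.
have K0 : K n (fun=> 0).
  split.
    apply/hardy2P; split; first exact/cL2_cb/cb_cst.
    exact: hardy1_cst.
  move=> k _; rewrite -[RHS](cmean_cst 0); apply: eq_cmean => t _.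
  by rewrite mul0r.
elim: r => [|j r IH].
  move: K0; congr (model_space _ _); apply/funext => x.
  by rewrite big_nil.
have := modelB (modelZ (c j) (h j)) (modelZ (-1) IH).
congr (model_space _ _); apply/funext => x.
by rewrite big_cons mulN1r opprK.
Qed.

Lemma cL2_model n g : K n g -> cL2 (g \o @expi R).
Proof. by move=> [/hardy2P[]]. Qed.

Lemma inner_sumr (J : Type) (r : seq J) (c : J -> C) (g : J -> C -> C) h :
  (forall j, cL2 (g j \o @expi R)) -> cL2 (h \o @expi R) ->
  inner h (fun x => \sum_(j <- r) c j * g j x) = \sum_(j <- r) (c j)^* * inner h (g j).
Proof.
move=> lg lh.
have l1 : cL2 ((fun x => \sum_(j <- r) c j * g j x) \o @expi R).
  by apply: (cL2_sum r) => j; exact/cL2Z/lg.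
rewrite inner_conj// inner_suml// rmorph_sum; apply: eq_bigr => j _.
by rewrite rmorphM /= -inner_conj.
Qed.

(** The difference d of g and its projection is orthogonal to every E_i with i < n and, being in K,
    to b^n H^2. By [hardy_expand] d is a sum of such terms, so <d, d> = 0. *)
Lemma takenaka_complete n g : K n g ->
  circle_ae_eq g (fun x => \sum_(i < n) inner g (E i) * E i x).
Proof.
move=> Kg; have lg := cL2_model Kg; have lE := cL2_takenaka.
pose p x := \sum_(i < n) inner g (E i) * E i x.
have Kp : K n p by apply: model_sum => i; exact: takenaka_model.
have lp := cL2_model Kp.
pose d x := g x - p x.
have Kd : K n d by exact: modelB.
have ld := cL2_model Kd.
have dE j : (j < n)%N -> inner d (E j) = 0.
  move=> lt; rewrite (_ : inner _ _ = inner (fun x => g x + (-1) * p x) (E j)); last first.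
    by apply: eq_cmean => t _; rewrite mulN1r.
  rewrite innerDl ?innerZl ?inner_suml//; last exact: cL2Z.
  rewrite (bigD1 (Ordinal lt))//= takenaka_orth eqxx mulr1 big1 ?addr0 ?mulN1r ?subrr//.
  by move=> i ne; rewrite takenaka_orth (negbTE ne : (i : nat) == j = false) mulr0.
have : inner d d = 0.
  have [c [h1 [hh1 e]]] := hardy_expand n Kd.1.
  have /hardy2P[lh1 _] := hh1.
  rewrite (@eq_inner d d d (fun x => (\sum_(i < n) c i * E i x) + blaschke lam x ^+ n * h1 x))//.
  have ls : cL2 ((fun x => \sum_(i < n) c i * E i x) \o @expi R).
    exact: (cL2_sum _ (fun i : 'I_n => cL2Z (c i) (lE i))).
  have lb := cL2_btXM n lh1.
  rewrite inner_conj//; last exact: (cL2D ls lb).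
  rewrite innerDl//.
  rewrite rmorphD /= -!inner_conj// Kd.2// addr0 inner_sumr//.
  by rewrite big1// => i _; rewrite dE// mulr0.
move=> /(inner_eq0 ld); apply: ae_imply => t h It.
by apply/eqP; rewrite -subr_eq0; apply/eqP/h.
Qed.

Lemma takenaka_basis n : is_orthonormal_basis (K n) (mkseq E n).
Proof.
split; rewrite ?size_mkseq.
- by move=> i; rewrite nth_mkseq//; exact: takenaka_model.
- by move=> i j; rewrite !nth_mkseq// takenaka_orth.
- move=> g /takenaka_complete; apply: ae_imply => t h It; rewrite h//.
  by apply: eq_bigr => i _; rewrite nth_mkseq.
Qed.

End ModelSpace.

(** * Eigenvalues and the matrix of the compression *)

Section Matrices.
Local Open Scope sesquilinear_scope.
Variable R : realType.
Local Notation C := R[i].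

(** Rectangular V and W are allowed because [hdim (K n)] and n are only propositionally equal; the
    two inverse relations force N = n. *)
Lemma char_poly_similar n N (A : 'M[C]_n) (V : 'M[C]_(N, n)) (W : 'M[C]_(n, N)) :
  V *m W = 1%:M -> W *m V = 1%:M -> char_poly (V *m A *m W) = char_poly A.
Proof.
move=> VW WV; have nN : N = n.
  by apply/eqP; rewrite eqn_leq (mulmx1_min VW) (mulmx1_min WV).
subst N; rewrite /char_poly.
have e : char_poly_mx (V *m A *m W) = map_mx polyC V *m char_poly_mx A *m map_mx polyC W.
  rewrite /char_poly_mx !map_mxM mulmxBr mulmxBl; congr (_ - _).
  by rewrite scalar_mxC -mulmxA -map_mxM VW map_mx1 mulmx1.
rewrite e !det_mulmx mulrAC -det_mulmx -map_mxM VW map_mx1 det1 mul1r//.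
Qed.

(** The roots come in an unspecified order, hence [perm_eq]; sums over the spectrum do not see
    it. *)
Lemma mx_eigenvalues_diag n N (M : 'M[C]_N) (V : 'M[C]_(N, n)) (W : 'M[C]_(n, N))
    (d : 'rV[C]_n) :
  V *m W = 1%:M -> W *m V = 1%:M -> M = V *m diag_mx d *m W ->
  perm_eq (mx_eigenvalues M) [seq d 0 i | i <- enum 'I_n].
Proof.
move=> VW WV e; apply: prod_XsubC_eq; rewrite /mx_eigenvalues.
case: closed_field_poly_normal => /= r er.
have /monicP m1 := char_poly_monic M; rewrite m1 scale1r in er.
rewrite -er e char_poly_similar// char_poly_trig ?diag_mx_is_trig//.
by rewrite big_map big_enum/=; apply: eq_bigr => i _; rewrite mxE eqxx.
Qed.

Lemma real_diag_conj n (d : 'I_n -> R) :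
  (diag_mx (\row_i (d i)%:C%C) : 'M[C]_n)^t* = diag_mx (\row_i (d i)%:C%C).
Proof.
rewrite tr_diag_mx map_diag_mx; congr diag_mx; apply/rowP => i; rewrite !mxE.
by apply: complexP; rewrite ?cReJ ?cImJ /= ?oppr0.
Qed.

(** M is Hermitian, so its product with its adjoint has the eigenvalues d_i^2, whose square roots
    are |d_i|: the same d describes eigenvalues and singular values. *)
Lemma hermitian_eigenvalues_sum n N (M : 'M[C]_N) (W : 'M[C]_(n, N)) (d : 'I_n -> R) :
  W^t* *m W = 1%:M -> W *m W^t* = 1%:M ->
  M = W^t* *m diag_mx (\row_i (d i)%:C%C) *m W ->
  (forall G : C -> C, \sum_(k <- mx_eigenvalues M) G k = \sum_i G (d i)%:C%C) /\
  (forall G : R -> C, \sum_(x <- [seq Num.sqrt (complex.Re z)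
     | z <- mx_eigenvalues (M^t* *m M)]) G x = \sum_i G `|d i|).
Proof.
move=> WW WW' e; split=> G.
  rewrite (perm_big _ (mx_eigenvalues_diag WW WW' e))/= big_map big_enum/=.
  by apply: eq_bigr => i _; rewrite mxE.
have e2 : M^t* *m M = W^t* *m diag_mx (\row_i (d i ^+ 2)%:C%C) *m W.
  have -> : M^t* = M.
    by rewrite e !(trmx_mul, map_mxM) trmxCK real_diag_conj mulmxA.
  rewrite e !mulmxA -[_ *m W *m W^t*]mulmxA WW' mulmx1; congr (_ *m _).
  rewrite -mulmxA mulmx_diag; congr (_ *m diag_mx _).
  by apply/rowP => i; rewrite !mxE -rmorphM.
rewrite big_map (perm_big _ (mx_eigenvalues_diag WW WW' e2))/= big_map big_enum/=.
by apply: eq_bigr => i _; rewrite mxE/= sqrtr_sqr.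
Qed.

Lemma hermitian_diagonalization n (A : 'M[C]_n) : A^t* = A ->
  exists (Q : 'M[C]_n) (d : 'I_n -> R), [/\ Q *m Q^t* = 1%:M, Q^t* *m Q = 1%:M &
    A = Q^t* *m diag_mx (\row_i (d i)%:C%C) *m Q].
Proof.
move=> hA; have herm : A \is hermsymmx.
  by apply/is_hermitianmxP; rewrite expr0 scale1r.
have uni := spectral_unitarymx A; have /unitarymxP U1 := uni.
have /orthomx_spectralP := hermitian_normalmx herm.
rewrite invmx_unitary// => e.
exists (spectralmx A), (fun i => complex.Re (spectral_diag A 0 i)); split=> //.
  by apply: mulmx1C.
rewrite [LHS]e; congr (_ *m diag_mx _ *m _); apply/rowP => i; rewrite mxE.
by rewrite RRe_real//; have /mxOverP := hermitian_spectral_diag_real herm.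
Qed.

End Matrices.

(** * The compression in an arbitrary orthonormal basis *)

Section Compression.
Local Open Scope sesquilinear_scope.
Variable R : realType.
Local Notation C := R[i].
Local Notation mu := (@lebesgue_measure R).
Local Notation I := `[0, 2 * pi : R]%classic.
Local Notation Re := complex.Re.
Local Notation Im := complex.Im.
Implicit Types (r M : R) (u v : R -> R) (F G H : R -> C) (g h : C -> C).

(** Measurability of u is assumed separately because almost everywhere equality does not preserve
    Borel measurability. *)
Lemma rint_ae u v : measurable_fun I u -> {ae mu, forall t, I t -> u t = v t} ->
  rint v -> rint u.
Proof.
move=> mu_ e iv; have mv := rint_meas iv; apply/integrableP; split.
  exact/measurable_EFinP.
have /integrableP[_] := iv; apply: le_lt_trans; rewrite le_eqVlt; apply/orP; left.
apply/eqP/ae_eq_integral; [exact: mI|..].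
- by apply: measurableT_comp => //; exact/measurable_EFinP.
- by apply: measurableT_comp => //; exact/measurable_EFinP.
- by apply: ae_imply e => t h It /=; rewrite h.
Qed.

Lemma ci_ae F G : cmeas F -> {ae mu, forall t, I t -> F t = G t} -> cintegrable G -> cintegrable F.
Proof.
move=> [a b] e [c d]; split; [apply: rint_ae c => //|apply: rint_ae d => //];
  by apply: ae_imply e => t h It; rewrite h.
Qed.

Lemma cmeas_L2 F : cL2 F -> cmeas F. Proof. by case. Qed.

Variable lam : C.
Hypothesis hlam : `|lam| < 1.
Local Notation K n := (model_space (fun x => blaschke lam x ^+ n)).
Local Notation E := (takenaka lam).
Let lE i : cL2 (E i \o @expi R) := cL2_takenaka hlam i.
#[local] Hint Resolve lE : core.

Lemma model_basis n : is_orthonormal_basis (K n) (orthonormal_basis (K n)).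
Proof. by apply: xgetPex; exists (mkseq E n); exact: takenaka_basis. Qed.

Lemma bounded_takenaka_sum n (c : 'I_n -> C) :
  cbounded ((fun x => \sum_(i < n) c i * E i x) \o @expi R).
Proof. by apply: cb_sum => i; apply/cbZ; exact: cb_takenaka. Qed.

(** h is only assumed integrable, which is what [cL2M] gives for f e with e in K. The projection is
    still the sum of <h, E_k> E_k, since the E_k are bounded. *)
Lemma orth_proj_model n h : cintegrable (h \o @expi R) ->
  K n (orth_proj (K n) h) /\
  forall q, K n q -> inner (fun z => h z - orth_proj (K n) h z) q = 0.
Proof.
move=> ih; rewrite /orth_proj.
apply: (@xgetPex _ _ [set p : C -> C | K n p /\
  forall q, K n q -> inner (fun z => h z - p z) q = 0]).
pose p x := \sum_(k < n) inner h (E k) * E k x.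
have Kp : K n p by apply: model_sum => // k; exact: takenaka_model.
have lp := cL2_model Kp; have bp := bounded_takenaka_sum (fun k => inner h (E k)).
exists p; split=> // q Kq; have lq := cL2_model Kq.
have bE k := cb_takenaka hlam k.
have ihp : cintegrable (fun t => h (expi t) - p (expi t)) by exact: (ciB ih (cL2_ci lp)).
have idE k : cintegrable (fun t => (h (expi t) - p (expi t)) * (E k (expi t))^*).
  by apply: ciM; [|exact: (cb_conj (bE k))].
have hpE k : (k < n)%N -> inner (fun z => h z - p z) (E k) = 0.
  move=> lt.
  transitivity (inner h (E k) - inner p (E k)).
    rewrite -[RHS]cmeanB.
    - by apply: eq_cmean => t _; rewrite mulrBl.
    - by apply: ciM => //; exact: (cb_conj (bE k)).
    - by apply: cL2M => //; exact/cL2_conj/lE.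
  rewrite inner_suml// (bigD1 (Ordinal lt))//= takenaka_orth// eqxx mulr1 big1 ?addr0 ?subrr//.
  by move=> i ne; rewrite takenaka_orth// (negbTE ne : (i : nat) == k = false) mulr0.
(* As an element of K, q may be unbounded on a null set; its expansion is bounded, so the mean can
   be taken term by term. *)
transitivity (inner (fun z => h z - p z) (fun x => \sum_(i < n) inner q (E i) * E i x)).
  apply: ae_eq_cmean.
  - apply: cmeasM; first exact: ci_meas.
    exact: (cmeas_conj (cmeas_L2 lq)).
  - apply: cmeasM; first exact: ci_meas.
    exact/cmeas_conj/cmeas_L2/cL2_cb/(bounded_takenaka_sum (fun i => inner q (E i))).
  - by apply: ae_imply (takenaka_complete hlam Kq) => t e It; rewrite e.
transitivity (\sum_(i < n) (inner q (E i))^* * inner (fun z => h z - p z) (E i)).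
  transitivity (cmean (fun t => \sum_(i < n) (inner q (E i))^* * ((h (expi t) - p (expi t)) * (E i (expi t))^*))).
    apply: eq_cmean => t _; rewrite rmorph_sum mulr_sumr; apply: eq_bigr => i _.
    by rewrite rmorphM /=; ring.
  rewrite cmean_sum; last by move=> i; exact: ciZ.
  by apply: eq_bigr => i _; rewrite cmeanZ.
by rewrite big1// => i _; rewrite hpE// mulr0.
Qed.

(** W holds the coefficients <e_j, E_i>. Expanding e_j in the E_i gives W^* W = 1, and expanding E_i
    in the e_j gives W W^* = 1. *)
Lemma model_basis_change n : exists W : 'M[C]_(n, hdim (K n)),
  [/\ W^t* *m W = 1%:M, W *m W^t* = 1%:M &
   forall j : 'I_(hdim (K n)), circle_ae_eq (orthonormal_basis (K n))`_j
     (fun x => \sum_(i < n) W i j * E i x)].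
Proof.
have [Ke oe ce] := model_basis n.
set e := orthonormal_basis (K n) in Ke oe ce *.
have le (i : 'I_(size e)) := cL2_model (Ke i).
exists (\matrix_(i, j) inner e`_j (E i)); split.
- apply/matrixP => k j; rewrite mxE [RHS]mxE eq_sym -oe.
  transitivity (inner (fun x => \sum_(i < n) inner e`_j (E i) * E i x) e`_k).
    rewrite inner_suml//.
    apply: eq_bigr => i _; rewrite !mxE mulrC; congr (_ * _).
    by rewrite [RHS]inner_conj//; exact: lE.
  apply: ae_eq_cmean.
  + apply: cmeasM; first exact/cmeas_L2/cL2_cb/(bounded_takenaka_sum (fun i => inner e`_j (E i))).
    exact: (cmeas_conj (cmeas_L2 (le k))).
  + apply: cmeasM; first exact: (cmeas_L2 (le j)).
    exact: (cmeas_conj (cmeas_L2 (le k))).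
  + by apply: ae_imply (takenaka_complete hlam (Ke j)) => t h It; rewrite -h.
- apply/matrixP => k i; rewrite mxE [RHS]mxE.
  transitivity (inner (fun x => \sum_(j < size e) inner (E i) e`_j * e`_j x) (E k)).
    rewrite inner_suml//.
    apply: eq_bigr => j _; rewrite !mxE mulrC; congr (_ * _).
    by rewrite [RHS]inner_conj//; exact: lE.
  rewrite eq_sym -[RHS](takenaka_orth hlam).
  apply: ae_eq_cmean.
  + apply: cmeasM; last exact: (cmeas_conj (cmeas_L2 (lE k))).
    by apply: cmeas_L2; apply: cL2_sum => j; exact/cL2Z/le.
  + apply: cmeasM; first exact: (cmeas_L2 (lE i)).
    exact: (cmeas_conj (cmeas_L2 (lE k))).
  + by apply: ae_imply (ce _ (takenaka_model hlam (ltn_ord i))) => t h It; rewrite -h.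
- move=> j; apply: ae_imply (takenaka_complete hlam (Ke j)) => t h It; rewrite h//.
  by apply: eq_bigr => i _; rewrite mxE.
Qed.

Lemma hdim_model n : hdim (K n) = n.
Proof.
have [W [W1 W2 _]] := model_basis_change n.
by apply/eqP; rewrite eqn_leq (mulmx1_min W1) (mulmx1_min W2).
Qed.

Variable f : C -> C.
Hypothesis hf : cL2 (f \o @expi R).
Local Notation T n := (toeplitz_compression f (K n)).

Definition takenaka_mx n : 'M[C]_n :=
  \matrix_(l, k) inner (fun z => f z * E k z) (E l).

(** The projection disappears from the entries because e_i lies in K; what remains is a sesquilinear
    change of basis. *)
Lemma compression_mx n : exists W : 'M[C]_(n, hdim (K n)),
  [/\ W^t* *m W = 1%:M, W *m W^t* = 1%:M &
   matrix_of (K n) (T n) = W^t* *m takenaka_mx n *m W].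
Proof.
have [W [W1 W2 We]] := model_basis_change n; exists W; split=> //.
have [Ke _ _] := model_basis n.
set e := orthonormal_basis (K n) in Ke We *.
have le (i : 'I_(size e)) := cL2_model (Ke i).
(* Bounded representatives of the chosen basis: products with f and with each other are
   integrable. *)
pose e' j x := \sum_(i < n) W i j * E i x.
have be' j : cbounded (e' j \o @expi R) by exact: (bounded_takenaka_sum (W^~ j)).
have ife (j : 'I_(size e)) : cintegrable (fun t => f (expi t) * e`_j (expi t)).
  exact: (cL2M hf (le j)).
have mfee (i j : 'I_(size e)) : cmeas (fun t => f (expi t) * e`_j (expi t) * (e`_i (expi t))^*).
  by apply: cmeasM; [exact: (ci_meas (ife j))|exact: (cmeas_conj (cmeas_L2 (le i)))].
have iff' (i j : 'I_(size e)) : cintegrable (fun t => f (expi t) * e' j (expi t) * (e' i (expi t))^*).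
  by apply: ciM; [exact: (cL2_ci (cL2Mb hf (be' j)))|exact: (cb_conj (be' i))].
have aefee (i j : 'I_(size e)) : {ae mu, forall t, I t -> f (expi t) * e`_j (expi t) * (e`_i (expi t))^* =
    f (expi t) * e' j (expi t) * (e' i (expi t))^*}.
  by apply: ae_imply2 (We j) (We i) => t h1 h2 It; rewrite h1// h2.
have iE k l : cintegrable (fun t => f (expi t) * E k (expi t) * (E l (expi t))^*).
  apply: ciM; first exact: (cL2_ci (cL2Mb hf (cb_takenaka hlam k))).
  exact: (cb_conj (cb_takenaka hlam l)).
apply/matrixP => i j; rewrite mxE.
have [Kp op] := @orth_proj_model n (fun z => f z * e`_j z) (ife j).
have lp := cL2_model Kp.
transitivity (inner (fun z => f z * e`_j z) e`_i).
  apply/eqP; rewrite eq_sym -subr_eq0 -(op _ (Ke i)) -cmeanB.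
  - by apply/eqP/eq_cmean => t _; rewrite mulrBl.
  - exact: (ci_ae (mfee i j) (aefee i j) (iff' i j)).
  - exact: (cL2M lp (cL2_conj (le i))).
transitivity (inner (fun z => f z * e' j z) (e' i)).
  by apply: ae_eq_cmean => //; exact: ci_meas.
transitivity (\sum_(k < n) \sum_(l < n) (W k j * (W l i)^*) * takenaka_mx n l k).
  transitivity (cmean (fun t => \sum_(k < n) \sum_(l < n) (W k j * (W l i)^*) *
      (f (expi t) * E k (expi t) * (E l (expi t))^*))).
    apply: eq_cmean => t _; rewrite /e' rmorph_sum [f _ * _]mulr_sumr mulr_suml.
    apply: eq_bigr => k _; rewrite mulr_sumr; apply: eq_bigr => l _.
    by rewrite rmorphM /=; ring.
  rewrite cmean_sum => [|k]; last by apply: ci_sum => l; exact: ciZ.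
  apply: eq_bigr => k _; rewrite cmean_sum => [|l]; last exact: ciZ.
  by apply: eq_bigr => l _; rewrite cmeanZ// mxE.
rewrite mxE; apply: eq_bigr => k _; rewrite mxE mulr_suml.
by apply: eq_bigr => l _; rewrite !mxE; ring.
Qed.

End Compression.

(** * The Poisson measure and the spectral weights *)

Section Weighted.
Local Open Scope sesquilinear_scope.
Variable R : realType.
Local Notation C := R[i].
Local Notation I := `[0, 2 * pi : R]%classic.
Local Notation Re := complex.Re.
Local Notation Im := complex.Im.
Implicit Types (r M : R) (u v : R -> R) (F G H : R -> C).
Variable lam : C.
Hypothesis hlam : `|lam| < 1.
Local Notation ck := (ck lam).
Local Notation bt := (bt lam).

Definition poisson (t : R) : R := s2 lam * (Re (ck t) ^+ 2 + Im (ck t) ^+ 2).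
Local Notation p := poisson.

Lemma poissonE t : (p t)%:C%C = (s2 lam)%:C%C * (ck t * (ck t)^*).
Proof. by rewrite -normCK sqr_norm_ReIm -rmorphM. Qed.

Lemma continuous_poisson : continuous p.
Proof.
have [cR cI] := ccont_ck hlam.
move=> t; apply: cvgM; first exact: cvg_cst.
by apply: cvgD; rewrite expr2; apply: cvgM; [exact: cR|exact: cR|exact: cI|exact: cI].
Qed.

Lemma poisson_ge0 t : 0 <= p t.
Proof.
by apply: mulr_ge0; [exact: ltW (s2_gt0 hlam)|rewrite addr_ge0 ?sqr_ge0].
Qed.

Lemma meas_cont u : continuous u -> measurable_fun I u.
Proof. by move=> cu; apply: measurable_funTS; exact: continuous_measurable_fun. Qed.

Lemma rint_poisson u : rint u -> rint (fun t => u t * p t).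
Proof.
move=> iu; have [M hM] := continuous_bounded continuous_poisson.
exact: (rintM_bounded iu (meas_cont continuous_poisson) hM).
Qed.

Definition nu u : R := rmean (fun t => u t * p t).

Lemma eq_nu u v : {in I, u =1 v} -> nu u = nu v.
Proof. by move=> e; apply: eq_rmean => t It; rewrite e. Qed.
Lemma nuD u v : rint u -> rint v -> nu (fun t => u t + v t) = nu u + nu v.
Proof.
move=> iu iv; rewrite /nu -rmeanD; [|exact: rint_poisson..].
by apply: eq_rmean => t _; rewrite mulrDl.
Qed.
Lemma nuZ r u : rint u -> nu (fun t => r * u t) = r * nu u.
Proof.
move=> iu; rewrite /nu -rmeanZ; last exact: rint_poisson.
by apply: eq_rmean => t _; rewrite mulrA.
Qed.
Lemma nuB u v : rint u -> rint v -> nu (fun t => u t - v t) = nu u - nu v.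
Proof.
move=> iu iv; rewrite /nu -rmeanB; [|exact: rint_poisson..].
by apply: eq_rmean => t _; rewrite mulrBl.
Qed.
Lemma nu_sum (J : Type) (s : seq J) (u : J -> R -> R) :
  (forall j, rint (u j)) -> nu (fun t => \sum_(j <- s) u j t) = \sum_(j <- s) nu (u j).
Proof.
move=> iu; rewrite /nu -rmean_sum; last by move=> j; exact: rint_poisson.
by apply: eq_rmean => t _; rewrite mulr_suml.
Qed.
Lemma nu_ge0 u : (forall t, I t -> 0 <= u t) -> 0 <= nu u.
Proof. by move=> u0; apply: rmean_ge0 => t It; rewrite mulr_ge0 ?u0 ?poisson_ge0. Qed.
Lemma le_nu u v : rint u -> rint v -> (forall t, I t -> u t <= v t) -> nu u <= nu v.
Proof.
move=> iu iv le; apply: le_rmean; [exact: rint_poisson..|] => t It.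
by rewrite ler_wpM2r ?poisson_ge0 ?le.
Qed.
Lemma norm_nu u : rint u -> `|nu u| <= nu (fun t => `|u t|).
Proof.
move=> iu; rewrite /nu (le_trans (norm_rmean _))//; first exact: rint_poisson.
rewrite le_eqVlt; apply/orP; left; apply/eqP/eq_rmean => t _.
by rewrite normrM [`|p t|]ger0_norm ?poisson_ge0.
Qed.

Definition cnu F : C := cmean (fun t => F t * (p t)%:C%C).

Lemma cb_poisson : cbounded (fun t => (p t)%:C%C).
Proof.
by apply: cb_cont; split => //; [exact: continuous_poisson|exact: cst_continuous].
Qed.

Lemma ci_poisson F : cintegrable F -> cintegrable (fun t => F t * (p t)%:C%C).
Proof. by move=> iF; apply: ciM => //; exact: cb_poisson. Qed.

Lemma eq_cnu F G : {in I, F =1 G} -> cnu F = cnu G.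
Proof. by move=> e; apply: eq_cmean => t It; rewrite e. Qed.
Lemma cnuD F G : cintegrable F -> cintegrable G -> cnu (fun t => F t + G t) = cnu F + cnu G.
Proof.
move=> iF iG; rewrite /cnu -cmeanD; [|exact: ci_poisson..].
by apply: eq_cmean => t _; rewrite mulrDl.
Qed.
Lemma cnuB F G : cintegrable F -> cintegrable G -> cnu (fun t => F t - G t) = cnu F - cnu G.
Proof.
move=> iF iG; rewrite /cnu -cmeanB; [|exact: ci_poisson..].
by apply: eq_cmean => t _; rewrite mulrBl.
Qed.
Lemma cnuZ c F : cintegrable F -> cnu (fun t => c * F t) = c * cnu F.
Proof.
move=> iF; rewrite /cnu -cmeanZ; last exact: ci_poisson.
by apply: eq_cmean => t _; rewrite mulrA.
Qed.
Lemma cnu_sum (J : Type) (s : seq J) (F : J -> R -> C) : (forall j, cintegrable (F j)) ->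
  cnu (fun t => \sum_(j <- s) F j t) = \sum_(j <- s) cnu (F j).
Proof.
move=> iF; rewrite /cnu -cmean_sum; last by move=> j; exact: ci_poisson.
by apply: eq_cmean => t _; rewrite mulr_suml.
Qed.
Lemma cnu_conj F : cintegrable F -> cnu (fun t => (F t)^*) = (cnu F)^*.
Proof.
move=> iF; rewrite /cnu -cmean_conj; last exact: ci_poisson.
apply: eq_cmean => t _; rewrite [RHS]rmorphM; congr (_ * _).
by apply: complexP; rewrite ?cReJ ?cImJ /= ?oppr0.
Qed.
Lemma cnu_real u : cnu (fun t => (u t)%:C%C) = (nu u)%:C%C.
Proof.
rewrite /nu -cmean_real; apply: eq_cmean => t _.
by rewrite -rmorphM.
Qed.

Lemma takenakaJ i t : (takenaka lam i (expi t))^* =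
  (Num.sqrt (s2 lam))%:C%C * (ck t)^* * (bt t)^* ^+ i.
Proof.
rewrite takenakaE; move: (ck t) (bt t) => x y.
by rewrite !rmorphM rmorphXn /= s_conj.
Qed.

(** Orthonormality of the Takenaka functions, with their common factor |kappa|^2 absorbed in the
    measure. *)
Lemma cnu_btX i j : cnu (fun t => bt t ^+ j * (bt t)^* ^+ i) = (i == j)%:R.
Proof.
rewrite eq_sym -(takenaka_orth hlam); apply: eq_cmean => t _.
rewrite takenakaJ takenakaE poissonE -(s_sqr hlam).
by ring.
Qed.

Definition weighted_mx (n : nat) F : 'M[C]_n :=
  \matrix_(i, j) cnu (fun t => F t * (bt t ^+ j * (bt t)^* ^+ i)).

Lemma takenaka_mxE (f : C -> C) n : takenaka_mx lam f n = weighted_mx n (f \o @expi R).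
Proof.
apply/matrixP => i j; rewrite !mxE; apply: eq_cmean => t _ /=.
rewrite takenakaJ takenakaE poissonE -(s_sqr hlam).
by ring.
Qed.

Lemma cb_btij i j : cbounded (fun t => bt t ^+ j * (bt t)^* ^+ i).
Proof.
by apply: cbM; apply: cbX; [|apply: cb_conj]; exact: (cb_bt hlam).
Qed.

Definition normsq (x : C) : R := Re x ^+ 2 + Im x ^+ 2.
Lemma normsqE (x : C) : (normsq x)%:C%C = x * x^*.
Proof. by rewrite -normCK sqr_norm_ReIm. Qed.
Lemma normsq_ge0 (x : C) : 0 <= normsq x.
Proof. by rewrite addr_ge0 ?sqr_ge0. Qed.

Definition rL2 u := cL2 (fun t => (u t)%:C%C).
Lemma rL2_sqr u : rL2 u -> rint (fun t => u t ^+ 2).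
Proof. by move=> [_]; apply: eq_rint => t _ /=; rewrite expr0n addr0. Qed.
Lemma rL2_rint u : rL2 u -> rint u.
Proof. by move=> /cL2_ci[]. Qed.

Lemma wmx_herm n u : rL2 u -> (weighted_mx n (fun t => (u t)%:C%C))^t* = weighted_mx n (fun t => (u t)%:C%C).
Proof.
move=> lu; apply/matrixP => i j; rewrite !mxE -cnu_conj; last first.
  by apply: ciM; [exact: cL2_ci|exact: cb_btij].
apply: eq_cnu => t _; move: (bt t) => x.
rewrite !rmorphM !rmorphXn /= conjCK [_^* ^+ _ * _]mulrC.
by congr (_ * _); apply: complexP; rewrite ?cReJ ?cImJ /= ?oppr0.
Qed.

(* w k = |sum_i Q_ki conj(b)^i|^2. *)
Lemma spectral_weights n u : rL2 u ->
  exists (Q : 'M[C]_n) (d : 'I_n -> R) (w : 'I_n -> R -> R),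
  [/\ [/\ Q *m Q^t* = 1%:M, Q^t* *m Q = 1%:M &
    weighted_mx n (fun t => (u t)%:C%C) = Q^t* *m diag_mx (\row_i (d i)%:C%C) *m Q],
    \sum_k d k ^+ 2 = \sum_i \sum_j normsq (weighted_mx n (fun t => (u t)%:C%C) i j),
    (forall k, measurable_fun I (w k) /\ exists M, forall t, I t -> `|w k t| <= M),
    (forall k t, 0 <= w k t) /\ (forall t, \sum_k w k t = n%:R) &
    forall k, nu (w k) = 1 /\ nu (fun t => u t * w k t) = d k].
Proof.
move=> lu; set A := weighted_mx n _.
have hA : A^t* = A by exact: wmx_herm.
have [Q [d [Q1 Q2 AE]]] := hermitian_diagonalization hA.
pose q k t := \sum_i Q k i * (bt t)^* ^+ i.
have bq k : cbounded (q k).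
  by apply: cb_sum => i; apply/cbZ/cbX/cb_conj/(cb_bt hlam).
have qq k t : (normsq (q k t))%:C%C =
    \sum_i \sum_j (Q k i * (Q k j)^*) * (bt t ^+ j * (bt t)^* ^+ i).
  rewrite normsqE /q; move: (bt t) => x.
  rewrite rmorph_sum mulr_suml; apply: eq_bigr => i _.
  rewrite mulr_sumr; apply: eq_bigr => j _.
  by rewrite rmorphM rmorphXn /= conjCK; ring.
have bij i j : cbounded (fun t => bt t ^+ j * (bt t)^* ^+ i) by exact: cb_btij.
exists Q, d, (fun k t => normsq (q k t)); split=> //.
- suff e : (\sum_k d k ^+ 2)%:C%C = (\sum_i \sum_j normsq (A i j))%:C%C :> C by case: e.
  (* Both sides are the squared Hilbert-Schmidt norm of A, which is invariant under unitary
     conjugation. *)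
  transitivity (\tr (A *m A^t*)).
    rewrite hA {1}AE {1}AE !mulmxA -[_ *m Q *m Q^t*]mulmxA Q1 mulmx1.
    rewrite mxtrace_mulC mulmxA mulmxA Q1 mul1mx mulmx_diag mxtrace_diag rmorph_sum.
    by apply: eq_bigr => k _; rewrite !mxE -rmorphM.
  rewrite rmorph_sum; apply: eq_bigr => i _; rewrite mxE rmorph_sum.
  by apply: eq_bigr => j _; rewrite !mxE [RHS]normsqE.
- move=> k; have : cbounded (fun t => (normsq (q k t))%:C%C).
    rewrite (_ : (fun t => _) = (fun t => q k t * (q k t)^*)).
      exact: (cbM (bq k) (cb_conj (bq k))).
    by apply/funext => t; exact: normsqE.
  by move=> [[mw _] [M hM]]; split=> //; exists M => t /hM[].
- split; first by move=> k t; exact: normsq_ge0.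
  move=> t; suff e : (\sum_k normsq (q k t))%:C%C = n%:R%:C%C :> C by case: e.
  rewrite rmorph_sum; under eq_bigr do rewrite /= qq.
  rewrite exchange_big /=; under eq_bigr do rewrite exchange_big /=.
  transitivity (\sum_(i < n) \sum_(j < n) (i == j)%:R * (bt t ^+ j * (bt t)^* ^+ i)).
    apply: eq_bigr => i _; apply: eq_bigr => j _; rewrite -mulr_suml; congr (_ * _).
    have /matrixP/(_ j i) := Q2; rewrite !mxE eq_sym => <-.
    by apply: eq_bigr => k _; rewrite !mxE mulrC.
  transitivity (\sum_(i < n) (1 : C)).
    apply: eq_bigr => i _; rewrite (bigD1 i)//= eqxx mul1r -exprMn (bt_conj hlam) expr1n.
    by rewrite big1 ?addr0// => j; rewrite eq_sym => /negbTE ->; rewrite mul0r.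
  by rewrite sumr_const card_ord rmorph_nat.
- move=> k; split.
    suff e : (nu (fun t => normsq (q k t)))%:C%C = 1%:C%C :> C by case: e.
    rewrite -cnu_real; under eq_cnu do rewrite qq.
    rewrite cnu_sum => [|i]; last by apply: ci_sum => j; exact/ciZ/ci_cb.
    transitivity (\sum_(i < n) \sum_(j < n) Q k i * (Q k j)^* * (i == j)%:R).
      apply: eq_bigr => i _; rewrite cnu_sum => [|j]; last exact/ciZ/ci_cb.
      by apply: eq_bigr => j _; rewrite cnuZ ?cnu_btX//; exact/ci_cb.
    transitivity ((Q *m Q^t*) k k); last by rewrite Q1 mxE eqxx.
    rewrite mxE; apply: eq_bigr => i _; rewrite (bigD1 i)//= eqxx mulr1 !mxE.
    by rewrite big1 ?addr0// => j; rewrite eq_sym => /negbTE ->; rewrite mulr0.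
  suff e : (nu (fun t => u t * normsq (q k t)))%:C%C = (d k)%:C%C :> C by case: e.
  have iuij i j : cintegrable (fun t => (u t)%:C%C * (bt t ^+ j * (bt t)^* ^+ i)).
    by apply: ciM => //; exact: cL2_ci.
  (* The integral is the quadratic form of A at the k-th eigenvector, a diagonal entry of the
     diagonalized matrix. *)
  transitivity ((Q *m A *m Q^t*) k k); last first.
    rewrite AE !mulmxA Q1 mul1mx -mulmxA Q1 mulmx1.
    by rewrite !mxE eqxx.
  rewrite -cnu_real.
  transitivity (cnu (fun t => \sum_j \sum_i (Q k i * (Q k j)^*) * ((u t)%:C%C * (bt t ^+ j * (bt t)^* ^+ i)))).
    apply: eq_cnu => t _; rewrite rmorphM /= qq mulr_sumr.
    rewrite [RHS]exchange_big /=; apply: eq_bigr => i _.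
    by rewrite mulr_sumr; apply: eq_bigr => j _; ring.
  rewrite cnu_sum => [|j]; last by apply: ci_sum => i; exact/ciZ.
  rewrite mxE; apply: eq_bigr => j _; rewrite cnu_sum => [|i]; last exact/ciZ.
  rewrite mxE mulr_suml; apply: eq_bigr => i _; rewrite cnuZ// !mxE.
  by ring.
Qed.

End Weighted.

(** * The defect as a nonnegative quadratic form *)

Section Defect.
Local Open Scope sesquilinear_scope.
Variable R : realType.
Local Notation C := R[i].
Local Notation I := `[0, 2 * pi : R]%classic.
Local Notation Re := complex.Re.
Local Notation Im := complex.Im.
Implicit Types (r M : R) (u v : R -> R) (F G H A B : R -> C).
Variable lam : C.
Hypothesis hlam : `|lam| < 1.
Local Notation bt := (bt lam).
Local Notation nu := (nu lam).
Local Notation cnu := (cnu lam).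
Local Notation weighted_mx n u := (weighted_mx lam n (fun t => (u t)%:C%C)).

Definition defect (n : nat) u : R :=
  nu (fun t => u t ^+ 2) - n%:R^-1 * \sum_(i < n) \sum_(j < n) normsq (weighted_mx n u i j).

Lemma rL2M_bounded u (w : R -> R) : rL2 u -> measurable_fun I w ->
  (exists M, forall t, I t -> `|w t| <= M) -> rint (fun t => u t * w t).
Proof. by move=> lu mw [M hM]; exact: (rintM_bounded (rL2_rint lu) mw hM). Qed.

(** Expand the square: since nu (u w_k) = d_k and nu w_k = 1, the terms in d_k add up to -d_k^2, and
    summation over k turns the weights of u^2 into n. *)
Lemma spectral_defect n u (d : 'I_n -> R) (w : 'I_n -> R -> R) : (0 < n)%N -> rL2 u ->
  \sum_k d k ^+ 2 = \sum_i \sum_j normsq (weighted_mx n u i j) ->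
  (forall k, measurable_fun I (w k) /\ exists M, forall t, I t -> `|w k t| <= M) ->
  (forall t, \sum_k w k t = n%:R) ->
  (forall k, nu (w k) = 1 /\ nu (fun t => u t * w k t) = d k) ->
  (forall k, rint (fun t => (d k - u t) ^+ 2 * w k t)) /\
  n%:R^-1 * \sum_k nu (fun t => (d k - u t) ^+ 2 * w k t) = defect n u.
Proof.
move=> n0 lu sd mw sw nw.
have iw k : rint (w k) by have [mk [M hM]] := mw k; exact: (rint_bounded mk hM).
have iuw k : rint (fun t => u t * w k t).
  by have [mk bk] := mw k; exact: rL2M_bounded.
have iu2w k : rint (fun t => u t ^+ 2 * w k t).
  by have [mk [M hM]] := mw k; exact: (rintM_bounded (rL2_sqr lu) mk hM).
have e k t : (d k - u t) ^+ 2 * w k t =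
    (d k ^+ 2 * w k t - (2 * d k) * (u t * w k t)) + u t ^+ 2 * w k t by ring.
have i1 k := rintZ (d k ^+ 2) (iw k).
have i2 k := rintZ (2 * d k) (iuw k).
split=> [k|].
  by apply: (eq_rint (fun t _ => esym (e k t))); apply: rintD => //; exact: rintB.
have nk k : nu (fun t => (d k - u t) ^+ 2 * w k t) = nu (fun t => u t ^+ 2 * w k t) - d k ^+ 2.
  have [w1 uw] := nw k.
  rewrite (eq_nu _ (fun t _ => e k t)) nuD//; last exact: rintB.
  by rewrite nuB// nuZ// nuZ// w1 uw; ring.
under eq_bigr do rewrite nk.
rewrite sumrB sd mulrBr /defect; congr (_ - _).
rewrite -nu_sum// (eq_nu lam (v := fun t => n%:R * u t ^+ 2)) ?nuZ//; last 2 first.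
- exact: rL2_sqr.
- by move=> t _; rewrite -mulr_sumr sw mulrC.
by rewrite mulKf// pnatr_eq0 -lt0n.
Qed.

Lemma defect_ge0 n u : (0 < n)%N -> rL2 u -> 0 <= defect n u.
Proof.
move=> n0 lu; have [Q [d [w [_ sd mw [w0 sw] nw]]]] := spectral_weights hlam n lu.
have [_ <-] := spectral_defect n0 lu sd mw sw nw.
rewrite mulr_ge0 ?invr_ge0// sumr_ge0// => k _.
by apply: nu_ge0 => // t _; rewrite mulr_ge0 ?sqr_ge0.
Qed.

Lemma defect_le n u : defect n u <= nu (fun t => u t ^+ 2).
Proof.
rewrite lerBlDr lerDl mulr_ge0 ?invr_ge0// sumr_ge0// => i _.
by rewrite sumr_ge0// => j _; exact: normsq_ge0.
Qed.

(** By nu w_k = 1 and sum_k w_k = n, the difference is the average over k of nu ((G(d_k) - G(u))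
    w_k), and the modulus of G is applied under the integral. *)
Lemma spectral_estimate n u (G : R -> R) (B eps c : R) (d : 'I_n -> R) (w : 'I_n -> R -> R) :
  (0 < n)%N -> rL2 u ->
  continuous G -> (forall x, `|G x| <= B) ->
  (forall x y, `|G x - G y| <= eps + c * (x - y) ^+ 2) ->
  \sum_k d k ^+ 2 = \sum_i \sum_j normsq (weighted_mx n u i j) ->
  (forall k, measurable_fun I (w k) /\ exists M, forall t, I t -> `|w k t| <= M) ->
  (forall k t, 0 <= w k t) -> (forall t, \sum_k w k t = n%:R) ->
  (forall k, nu (w k) = 1 /\ nu (fun t => u t * w k t) = d k) ->
  `|n%:R^-1 * \sum_k G (d k) - nu (G \o u)| <= eps + c * defect n u.
Proof.
move=> n0 lu cG GB Gm sd mw w0 sw nw.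
have [idw <-] := spectral_defect n0 lu sd mw sw nw.
have n1 : (n%:R : R) != 0 by rewrite pnatr_eq0 -lt0n.
have iw k : rint (w k) by have [mk [M hM]] := mw k; exact: (rint_bounded mk hM).
have mu_ := rint_meas (rL2_rint lu).
have mG : measurable_fun I (G \o u).
  by apply: measurableT_comp => //; exact: continuous_measurable_fun.
have iG : rint (G \o u) by exact: (rint_bounded mG (fun t _ => GB (u t))).
have iGw k : rint (fun t => G (u t) * w k t).
  by have [mk [M hM]] := mw k; exact: (rintM_bounded iG mk hM).
have iGdw k : rint (fun t => G (d k) * w k t) by exact: rintZ.
have idiff k : rint (fun t => (G (d k) - G (u t)) * w k t).
  by apply: (eq_rint _ (rintB (iGdw k) (iGw k))) => t _; rewrite mulrBl.
have -> : n%:R^-1 * \sum_k G (d k) - nu (G \o u) =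
    n%:R^-1 * \sum_k nu (fun t => (G (d k) - G (u t)) * w k t).
  transitivity (n%:R^-1 * (\sum_k (G (d k) - nu (fun t => G (u t) * w k t)))).
    rewrite sumrB mulrBr; congr (_ - _).
    rewrite -nu_sum// [in RHS](eq_nu lam (v := fun t => n%:R * G (u t))) ?nuZ//; last first.
      by move=> t _; rewrite -mulr_sumr sw mulrC.
    by rewrite mulKf.
  congr (_ * _); apply: eq_bigr => k _.
  rewrite -[G (d k) in LHS]mulr1 -(nw k).1 -nuZ// -nuB//.
  by apply: eq_nu => t _; rewrite mulrBl.
rewrite normrM ger0_norm ?invr_ge0//.
have -> : eps + c * (n%:R^-1 * \sum_k nu (fun t => (d k - u t) ^+ 2 * w k t)) =
    n%:R^-1 * \sum_k (eps + c * nu (fun t => (d k - u t) ^+ 2 * w k t)).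
  rewrite big_split/= sumr_const card_ord mulrDr -[eps *+ n]mulr_natl mulKf//.
  by congr (_ + _); rewrite mulrCA mulr_sumr.
rewrite ler_wpM2l ?invr_ge0// (le_trans (ler_norm_sum _ _ _))// ler_sum// => k _.
rewrite (le_trans (norm_nu hlam (idiff k)))//.
rewrite -[eps]mulr1 -(nw k).1 -nuZ// -nuZ// -nuD//; [|exact: rintZ..].
apply: le_nu => //.
- exact: rint_norm.
- by apply: rintD; exact: rintZ.
- by move=> t It; rewrite normrM (ger0_norm (w0 _ _)) mulrA -mulrDl ler_wpM2r.
Qed.

Lemma rL2D u v : rL2 u -> rL2 v -> rL2 (fun t => u t + v t).
Proof.
move=> lu lv; have := cL2D lu lv; rewrite /rL2; congr cL2.
by apply/funext => t; rewrite -rmorphD.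
Qed.
Lemma rL2N u : rL2 u -> rL2 (fun t => - u t).
Proof.
move=> lu; have := cL2N lu; rewrite /rL2; congr cL2.
by apply/funext => t; rewrite -rmorphN.
Qed.
Lemma rL2B u v : rL2 u -> rL2 v -> rL2 (fun t => u t - v t).
Proof. by move=> lu lv; apply: rL2D => //; exact: rL2N. Qed.

Lemma normsq_parallelogram (x y : C) :
  normsq (x + y) + normsq (x - y) = 2 * normsq x + 2 * normsq y.
Proof. by case: x => a b; case: y => c d; rewrite /normsq /=; ring. Qed.

Lemma wmxD n u v : rL2 u -> rL2 v -> weighted_mx n (fun t => u t + v t) = weighted_mx n u + weighted_mx n v.
Proof.
move=> lu lv; apply/matrixP => i j; rewrite !mxE -cnuD//;
  try by apply: ciM; [exact: cL2_ci|exact: cb_btij].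
by apply: eq_cnu => t _; rewrite rmorphD mulrDl.
Qed.
Lemma wmxB n u v : rL2 u -> rL2 v -> weighted_mx n (fun t => u t - v t) = weighted_mx n u - weighted_mx n v.
Proof.
move=> lu lv; apply/matrixP => i j; rewrite !mxE -cnuB//;
  try by apply: ciM; [exact: cL2_ci|exact: cb_btij].
by apply: eq_cnu => t _; rewrite rmorphB mulrBl.
Qed.

Lemma rintM_L2 u v : rL2 u -> rL2 v -> rint (fun t => u t * v t).
Proof.
move=> lu lv; have [+ _] := cL2M lu lv; apply: eq_rint => t _.
by rewrite cReM /= mulr0 subr0.
Qed.

(** In the parallelogram law for the defect, the term of u - v is nonnegative and is dropped. *)
Lemma defect_add n u v : (0 < n)%N -> rL2 u -> rL2 v ->
  defect n (fun t => u t + v t) <= 2 * defect n u + 2 * defect n v.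
Proof.
move=> n0 lu lv.
suff <- : defect n (fun t => u t + v t) + defect n (fun t => u t - v t) =
    2 * defect n u + 2 * defect n v.
  by rewrite lerDl defect_ge0//; exact: rL2B.
have iu := rL2_sqr lu; have iv := rL2_sqr lv; have iuv := rintM_L2 lu lv.
have i1 : rint (fun t => u t ^+ 2 + v t ^+ 2) by exact: rintD.
have i2 := rintZ 2 iuv.
rewrite /defect wmxD// wmxB//.
have -> : nu (fun t => (u t + v t) ^+ 2) = nu (fun t => u t ^+ 2) + nu (fun t => v t ^+ 2) + 2 * nu (fun t => u t * v t).
  rewrite -nuD// -nuZ// -nuD//.
  by apply: eq_nu => t _; ring.
have -> : nu (fun t => (u t - v t) ^+ 2) = nu (fun t => u t ^+ 2) + nu (fun t => v t ^+ 2) - 2 * nu (fun t => u t * v t).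
  rewrite -nuD// -nuZ// -nuB//.
  by apply: eq_nu => t _; ring.
have -> : \sum_(i < n) \sum_(j < n) normsq ((weighted_mx n u - weighted_mx n v) i j) =
    2 * (\sum_(i < n) \sum_(j < n) normsq (weighted_mx n u i j)) +
    2 * (\sum_(i < n) \sum_(j < n) normsq (weighted_mx n v i j)) -
    \sum_(i < n) \sum_(j < n) normsq ((weighted_mx n u + weighted_mx n v) i j).
  rewrite !mulr_sumr -big_split -sumrB/=; apply: eq_bigr => i _.
  rewrite !mulr_sumr -big_split -sumrB/=; apply: eq_bigr => j _.
  have -> : (weighted_mx n u - weighted_mx n v) i j = weighted_mx n u i j - weighted_mx n v i j by rewrite !mxE.
  have -> : (weighted_mx n u + weighted_mx n v) i j = weighted_mx n u i j + weighted_mx n v i j by rewrite !mxE.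
  by rewrite -normsq_parallelogram [RHS]addrAC subrr add0r.
by ring.
Qed.

End Defect.

(** * Decay of the defect *)

Section Korovkin.
Variable R : realType.
Local Notation C := R[i].
Local Notation I := `[0, 2 * pi : R]%classic.
Local Notation Re := complex.Re.
Local Notation Im := complex.Im.
Implicit Types (r M : R) (u v : R -> R) (F G H A B : R -> C) (k : R -> R -> C).
Variable lam : C.
Hypothesis hlam : `|lam| < 1.
Local Notation bt := (bt lam).
Local Notation nu := (nu lam).
Local Notation cnu := (cnu lam).

(* Only finite sums of products A s * B t are integrated over the torus, so iterated
   means suffice and Fubini's theorem is not needed. *)
Definition double_mean k (x : C) : Prop :=
  [/\ forall s, cintegrable (k s), cintegrable (fun s => cnu (k s)) & cnu (fun s => cnu (k s)) = x].

Lemma double_mean_tensor A B : cbounded A -> cbounded B ->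
  double_mean (fun s t => A s * B t) (cnu A * cnu B).
Proof.
move=> bA bB; have iA := ci_cb bA; have iB := ci_cb bB.
have e s : cnu (fun t => A s * B t) = cnu B * A s by rewrite cnuZ// mulrC.
split=> [s||]; first exact: ciZ.
- by apply: (@eq_ci _ (fun s => cnu B * A s)) => [s _|]; [rewrite e|exact: ciZ].
- by rewrite (eq_cnu lam (fun s _ => e s)) cnuZ// mulrC.
Qed.

Lemma double_meanD k1 k2 x1 x2 : double_mean k1 x1 -> double_mean k2 x2 ->
  double_mean (fun s t => k1 s t + k2 s t) (x1 + x2).
Proof.
move=> [a1 b1 <-] [a2 b2 <-].
have e s : cnu (fun t => k1 s t + k2 s t) = cnu (k1 s) + cnu (k2 s) by rewrite cnuD.
split=> [s||]; first exact: ciD.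
- by apply: (@eq_ci _ (fun s => cnu (k1 s) + cnu (k2 s))) => [s _|]; [rewrite e|exact: ciD].
- by rewrite (eq_cnu lam (fun s _ => e s)) cnuD.
Qed.

Lemma double_meanZ c k x : double_mean k x -> double_mean (fun s t => c * k s t) (c * x).
Proof.
move=> [a b <-]; have e s : cnu (fun t => c * k s t) = c * cnu (k s) by rewrite cnuZ.
split=> [s||]; first exact: ciZ.
- by apply: (@eq_ci _ (fun s => c * cnu (k s))) => [s _|]; [rewrite e|exact: ciZ].
- by rewrite (eq_cnu lam (fun s _ => e s)) cnuZ.
Qed.

Lemma eq_double_mean k k' x x' : (forall s t, k s t = k' s t) -> x = x' ->
  double_mean k x -> double_mean k' x'.
Proof.
move=> e ->; have -> // : k = k'.
by apply/funext => s; apply/funext => t.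
Qed.

Lemma double_mean_sum (J : Type) (r : seq J) (k : J -> R -> R -> C) (x : J -> C) :
  (forall j, double_mean (k j) (x j)) ->
  double_mean (fun s t => \sum_(j <- r) k j s t) (\sum_(j <- r) x j).
Proof.
move=> h; elim: r => [|j r IH].
  have := double_mean_tensor (cb_cst 0) (cb_cst 0).
  apply: eq_double_mean => [s t|]; first by rewrite big_nil mul0r.
  by rewrite big_nil /cnu (eq_cmean (G := fun=> 0)) ?cmean_cst ?mul0r// => t _; rewrite mul0r.
by apply: eq_double_mean (double_meanD (h j) IH) => [s t|]; rewrite big_cons.
Qed.

Lemma double_mean_ge0 k (r : R -> R -> R) x : double_mean k x ->
  (forall s t, I s -> I t -> k s t = (r s t)%:C%C) ->
  (forall s t, I s -> I t -> 0 <= r s t) -> 0 <= Re x.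
Proof.
move=> [a b <-] e r0; have -> : cnu (fun s => cnu (k s)) = (nu (fun s => nu (r s)))%:C%C.
  rewrite -cnu_real; apply: eq_cnu => s /set_mem Is.
  by rewrite -cnu_real; apply: eq_cnu => t /set_mem It; rewrite e.
by apply: nu_ge0 => // s Is; apply: nu_ge0 => // t It; exact: r0.
Qed.

Local Notation X i j s := (bt s ^+ i * (bt s)^* ^+ j).

(** The squared modulus of sum_i b(s)^i conj(b(t))^i, expanded into products of a function of s and
    a function of t so that [double_mean_tensor] applies to each term. *)
Definition reproducing n (s t : R) : C := \sum_(i < n) \sum_(j < n) X i j s * (X i j t)^*.

Lemma reproducingE n s t :
  reproducing n s t = (normsq (\sum_(i < n) bt s ^+ i * (bt t)^* ^+ i))%:C%C.
Proof.
rewrite normsqE rmorph_sum mulr_suml; apply: eq_bigr => i _.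
rewrite mulr_sumr; apply: eq_bigr => j _.
move: (bt s) (bt t) => x y.
by rewrite !rmorphM !rmorphXn /= !conjCK; ring.
Qed.

Lemma cbX2 i j : cbounded (fun s => X i j s). Proof. exact: cb_btij. Qed.

Lemma cnuX i j : cnu (fun s => X i j s) = (i == j)%:R.
Proof. by rewrite cnu_btX// eq_sym. Qed.

Lemma double_mean_reproducing n : double_mean (reproducing n) n%:R.
Proof.
apply: (@eq_double_mean (fun s t => \sum_(i < n) \sum_(j < n) X i j s * (X i j t)^*)
  _ (\sum_(i < n) \sum_(j < n) cnu (fun s => X i j s) * cnu (fun s => (X i j s)^*))) => //.
  transitivity (\sum_(i < n) (1 : C)); last by rewrite sumr_const card_ord.
  apply: eq_bigr => i _; rewrite (bigD1 i)//= big1.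
    by rewrite cnu_conj ?cnuX ?eqxx ?conjC1 ?mulr1 ?addr0//; exact/ci_cb/cbX2.
  by move=> j; rewrite eq_sym cnuX => /negbTE; rewrite -val_eqE/= => ->; rewrite mul0r.
apply: double_mean_sum => i; apply: double_mean_sum => j.
by apply: double_mean_tensor; [|apply: cb_conj]; exact: cbX2.
Qed.

Lemma double_mean_increment n H : cbounded H ->
  double_mean (fun s t => reproducing n s t * (normsq (H s - H t))%:C%C)
    (2 * (n%:R * cnu (fun t => H t * (H t)^*)
      - (\sum_(i < n) \sum_(j < n) normsq (weighted_mx lam n H i j))%:C%C)).
Proof.
move=> bH; have bHJ := cb_conj bH.
have bHH : cbounded (fun t => H t * (H t)^*) by exact: cbM.
have bX := cbX2.
pose M (A B : R -> C) i j := cnu (fun s => A s * X i j s) * (cnu (fun s => B s * X i j s))^*.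
have DM A B i j : cbounded A -> cbounded B ->
    double_mean (fun s t => (A s * X i j s) * (B t * X i j t)^*) (M A B i j).
  move=> bA bB; have b1 := cbM bA (bX i j); have b2 := cbM bB (bX i j).
  have := double_mean_tensor b1 (cb_conj b2); apply: eq_double_mean => //.
  by rewrite cnu_conj//; exact: ci_cb.
pose N := fun t => H t * (H t)^*.
pose one := fun _ : R => 1 : C.
have b1 : cbounded one by exact: cb_cst.
have D := double_mean_sum (index_enum 'I_n) (fun i => double_mean_sum (index_enum 'I_n)
  (fun j => double_meanD (double_meanD (DM N one i j bHH b1) (DM one N i j b1 bHH))
    (double_meanZ (-1) (double_meanD (DM H H i j bH bH) (DM _ _ i j bHJ bHJ))))).
apply: eq_double_mean D.
  move=> s t; rewrite /reproducing normsqE mulr_suml; apply: eq_bigr => i _.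
  rewrite mulr_suml; apply: eq_bigr => j _; rewrite /N /one.
  move: (bt s) (bt t) (H s) (H t) => x y a b.
  by rewrite !(rmorphB, rmorphM, rmorph1) /= !conjCK; ring.
have cX i j : (cnu (fun s => one s * X i j s)) = (i == j)%:R.
  by rewrite -cnuX; apply: eq_cnu => s _; rewrite mul1r.
have sN : \sum_(i < n) \sum_(j < n) M N one i j = n%:R * cnu N.
  transitivity (\sum_(i < n) cnu N); last by rewrite sumr_const card_ord mulr_natl.
  apply: eq_bigr => i _; rewrite (bigD1 i)//= big1 ?addr0 /M.
    rewrite cX eqxx conjC1 mulr1; apply: eq_cnu => s _.
    by rewrite -exprMn (bt_conj hlam) expr1n mulr1.
  by move=> j; rewrite eq_sym cX => /negbTE; rewrite -val_eqE/= => ->; rewrite conjC0 mulr0.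
have NJ : (cnu N)^* = cnu N.
  rewrite -cnu_conj//; last exact: ci_cb.
  by apply: eq_cnu => s _; rewrite /N rmorphM /= conjCK mulrC.
have sN' : \sum_(i < n) \sum_(j < n) M one N i j = n%:R * cnu N.
  rewrite -NJ -conjC_nat -rmorphM -sN rmorph_sum; apply: eq_bigr => i _.
  by rewrite rmorph_sum; apply: eq_bigr => j _; rewrite /M rmorphM /= conjCK mulrC.
have sH : \sum_(i < n) \sum_(j < n) M H H i j =
    (\sum_(i < n) \sum_(j < n) normsq (weighted_mx lam n H i j))%:C%C.
  rewrite exchange_big rmorph_sum; apply: eq_bigr => i _; rewrite rmorph_sum.
  by apply: eq_bigr => j _; rewrite /M [RHS]normsqE mxE.
have sH' : \sum_(i < n) \sum_(j < n) M (fun t => (H t)^*) (fun t => (H t)^*) i j =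
    (\sum_(i < n) \sum_(j < n) normsq (weighted_mx lam n H i j))%:C%C.
  rewrite rmorph_sum; apply: eq_bigr => i _; rewrite rmorph_sum.
  apply: eq_bigr => j _; rewrite /M [RHS]normsqE mxE.
  have -> : cnu (fun s => (H s)^* * X i j s) = (cnu (fun s => H s * X j i s))^*.
    rewrite -cnu_conj//; last by apply/ci_cb/cbM.
    apply: eq_cnu => s _; move: (bt s) => x.
    by rewrite !rmorphM !rmorphXn /= conjCK [_^* ^+ _ * _]mulrC.
  by rewrite conjCK mulrC.
transitivity (\sum_(i < n) \sum_(j < n) M N one i j + \sum_(i < n) \sum_(j < n) M one N i j
  - (\sum_(i < n) \sum_(j < n) M H H i j +
     \sum_(i < n) \sum_(j < n) M (fun t => (H t)^*) (fun t => (H t)^*) i j)).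
  rewrite -!big_split -sumrB/=; apply: eq_bigr => i _.
  rewrite -!big_split -sumrB/=; apply: eq_bigr => j _.
  by rewrite mulN1r.
by rewrite sN sN' sH sH'; ring.
Qed.

(** The matrix of b is the n by n shift, with n - 1 entries equal to 1, so the value is 2 (n - (n -
    1)). Its independence of n is the source of the rate c / n. *)
Lemma double_mean_bt n : (0 < n)%N ->
  double_mean (fun s t => reproducing n s t * (normsq (bt s - bt t))%:C%C) 2.
Proof.
case: n => // n _; apply: eq_double_mean (double_mean_increment n.+1 (cb_bt hlam)) => //.
have -> : cnu (fun t => bt t * (bt t)^*) = 1.
  by rewrite -[RHS](_ : cnu (fun t => X 1 1 t) = 1) ?cnuX.
have -> : (\sum_(i < n.+1) \sum_(j < n.+1) normsq (weighted_mx lam n.+1 bt i j)) = n%:R.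
  have e (i j : 'I_n.+1) : normsq (weighted_mx lam n.+1 bt i j) = ((i : nat) == j.+1)%:R.
    rewrite mxE (_ : cnu _ = cnu (fun t => X j.+1 i t)).
      by rewrite cnuX eq_sym /normsq; case: eqP; rewrite /= ?expr0n ?expr1n ?addr0.
    by apply: eq_cnu => t _; rewrite exprS mulrA.
  (* Row 0 of the shift vanishes; each of the remaining n rows has a single 1, just below the
     diagonal. *)
  rewrite big_ord_recl big1 ?add0r; last by move=> j _; rewrite e.
  transitivity (\sum_(i < n) (1 : R)); last by rewrite sumr_const card_ord.
  apply: eq_bigr => i _; rewrite (bigD1 (widen_ord (leqnSn n) i))//= e /= /bump /= add1n eqxx.
  rewrite big1 ?addr0// => j ne; rewrite e /= /bump /= add1n eqSS.
  by move: ne; rewrite -val_eqE/= eq_sym => /negbTE ->.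
by rewrite mulr1 rmorph_nat -natrB// subSnn mulr1.
Qed.

(* The hypothesis on u is integrated against the nonnegative kernel reproducing n. *)
Lemma defect_korovkin n F (eps c : R) : (0 < n)%N -> cbounded F ->
  forall u, (forall t, F t = (u t)%:C%C) ->
  (forall s t, I s -> I t -> (u s - u t) ^+ 2 <= eps + c * normsq (bt s - bt t)) ->
  defect lam n u <= eps / 2 + c / n%:R.
Proof.
move=> n0 bF u Fu h.
have D := double_meanD (double_meanD
  (double_meanZ eps%:C%C (double_mean_reproducing n))
  (double_meanZ c%:C%C (double_mean_bt n0)))
  (double_meanZ (-1) (double_mean_increment n bF)).
have := @double_mean_ge0 _ (fun s t => normsq (\sum_(i < n) bt s ^+ i * (bt t)^* ^+ i) *
  (eps + c * normsq (bt s - bt t) - (u s - u t) ^+ 2)) _ D.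
have n1 : (n%:R : R) != 0 by rewrite pnatr_eq0 -lt0n.
have sd : (n%:R * cnu (fun t => F t * (F t)^*)
      - (\sum_(i < n) \sum_(j < n) normsq (weighted_mx lam n F i j))%:C%C)
    = (n%:R * defect lam n u)%:C%C.
  have -> : F = fun t => (u t)%:C%C by apply/funext.
  rewrite /defect mulrBr mulVKf// rmorphB rmorphM /= rmorph_nat; congr (_ * _ - _).
  rewrite -cnu_real; apply: eq_cnu => t _.
  by apply: complexP; rewrite ?cReM ?cImM ?cReJ ?cImJ /=; ring.
rewrite sd; move: (defect _ _ _) => d H.
have : 0 <= eps * n%:R + c * 2 - 2 * (n%:R * d).
  rewrite (_ : _ - _ = Re (eps%:C%C * n%:R + c%:C%C * 2 + -1 * (2 * (n%:R * d)%:C%C))).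
    apply: H => s t Is It.
      have -> : normsq (F s - F t) = (u s - u t) ^+ 2.
        by rewrite !Fu -rmorphB /normsq /= expr0n addr0.
      rewrite reproducingE; move: (normsq _) (normsq _) (_ ^+ 2) => x y w.
      by apply: complexP; rewrite !(cReD, cImD, cReM, cImM)/=; ring.
    by rewrite mulr_ge0 ?normsq_ge0// subr_ge0 h.
  suff <- : (eps * n%:R + c * 2 - 2 * (n%:R * d))%:C%C =
      eps%:C%C * n%:R + c%:C%C * 2 + -1 * (2 * (n%:R * d)%:C%C) by [].
  by rewrite !(rmorphB, rmorphD, rmorphM, rmorph_nat) /=; ring.
move=> h'.
rewrite -(ler_pM2l (_ : 0 < (2 * n%:R : R))); last by rewrite mulr_gt0// ltr0n.
have -> : 2 * n%:R * (eps / 2 + c / n%:R) = eps * n%:R + c * 2 by field; rewrite n1.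
by rewrite -subr_ge0 mulrA in h' *.
Qed.

End Korovkin.

(** * Quadratic moduli of continuity *)

Section Modulus.
Variable R : realType.
Local Notation C := R[i].
Local Notation I := `[0, 2 * pi : R]%classic.
Local Notation Re := complex.Re.
Local Notation Im := complex.Im.

(** On the compact part of A where h >= eps, m has a positive minimum; c is the maximum of h there
    divided by it. With h an increment and m a squared distance, this yields quadratic moduli of
    continuity. *)
Lemma compact_domination (T : topologicalType) (A : set T) (h m : T -> R) :
  compact A -> continuous h -> continuous m -> (forall x, A x -> 0 <= m x) ->
  (forall x, A x -> m x = 0 -> h x <= 0) ->
  forall eps, 0 < eps -> exists2 c, 0 <= c & forall x, A x -> h x <= eps + c * m x.
Proof.
move=> cA ch cm m0 hm0 eps e0.
pose S := A `&` h @^-1` [set y | eps <= y].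
have cS : compact S.
  apply: compact_closedI => //; apply: closed_comp; last exact: closed_ge.
  by move=> x _; exact: ch.
have [S0|S0] := pselect (S !=set0); last first.
  exists 0 => // x Ax; rewrite mul0r addr0 leNgt; apply/negP => /ltW ex.
  by apply: S0; exists x.
have [a /set_mem Sa ma] := compact_EVT_min S0 cS (continuous_subspaceT cm).
have [b /set_mem Sb hb] := compact_EVT_max S0 cS (continuous_subspaceT ch).
have ma0 : 0 < m a.
  rewrite lt_neqAle m0 ?andbT; last by case: Sa.
  apply/eqP => /esym m0a; case: Sa => Aa /= ea.
  by have := hm0 _ Aa m0a; rewrite leNgt (lt_le_trans e0 ea).
have hb0 : 0 <= h b by case: Sb => _ /= /(le_trans (ltW e0)).
exists (h b / m a); first by rewrite divr_ge0// ltW.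
move=> x Ax; have [ex|/ltW xe] := leP eps (h x); last first.
  by rewrite (le_trans xe)// lerDl mulr_ge0 ?m0// divr_ge0// ltW.
have Sx : S x by [].
rewrite (le_trans (hb _ (mem_set Sx)))// -[leLHS]add0r lerD ?(ltW e0)//.
by rewrite mulrAC ler_pdivlMr// ler_wpM2l ?ma// mem_set.
Qed.

Lemma continuous_pairl (u : R -> R) : continuous u -> continuous (fun x : R * R => u x.1).
Proof. by move=> cu x; apply: continuous_comp; [exact: cvg_fst|exact: cu]. Qed.
Lemma continuous_pairr (u : R -> R) : continuous u -> continuous (fun x : R * R => u x.2).
Proof. by move=> cu x; apply: continuous_comp; [exact: cvg_snd|exact: cu]. Qed.

Lemma continuous_sqrB (T : topologicalType) (u v : T -> R) : continuous u -> continuous v ->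
  continuous (fun x => (u x - v x) ^+ 2).
Proof.
rewrite (_ : (fun x => _) = fun x => (u x - v x) * (u x - v x)); last by apply/funext => x.
by move=> cu cv x; apply: cvgM; apply: cvgB; (exact: cu || exact: cv).
Qed.

(** For t <= s, cos (s - t) = 1 forces sin ((s - t) / 2) = 0, impossible when 0 < s - t < 2 pi; only
    the two identified endpoints remain. *)
Lemma expi_inj (s t : R) : I s -> I t -> (expi s : C) = expi t ->
  [\/ s = t, s = 0 /\ t = 2 * pi | s = 2 * pi /\ t = 0].
Proof.
wlog ts : s t / t <= s.
  move=> W Is It e; have /orP[|] := le_total t s; first by move=> ts; apply: W.
  move=> st; have := W t s st It Is (esym e).
  by case=> [->|[-> ->]|[-> ->]]; [exact: Or31|exact: Or33|exact: Or32].
rewrite /= !in_itv/= => /andP[s0 s1] /andP[t0 t1] [ec es].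
have sn : sin ((s - t) / 2) = 0.
  have h : cos ((s - t) / 2 *+ 2) = 1.
    by rewrite -mulr_natr divfK ?pnatr_eq0// cosB ec es -!expr2 cos2Dsin2.
  move: h; rewrite cos_mulr2n cos2sin2 -mulr_natl => h.
  by apply/eqP; rewrite -sqrf_eq0; apply/eqP; lra.
have [/eqP z|nz] := boolP (s - t == 0).
  by apply: Or31; apply/eqP; rewrite -subr_eq0 z.
have [|p2] := ltP (s - t) (2 * pi).
  move=> lt; have : 0 < sin ((s - t) / 2).
    have st0 : 0 < s - t by rewrite lt0r nz subr_ge0.
    apply: sin_gt0_pi; rewrite divr_gt0//=.
    by rewrite ltr_pdivrMr// mulrC.
  by rewrite sn ltxx.
by apply: Or33; split; lra.
Qed.

Variable lam : C.
Hypothesis hlam : `|lam| < 1.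
Local Notation bt := (bt lam).

(** After clearing denominators, b(s) - b(t) is (1 - |lam|^2) times the difference of the two points
    of the circle. *)
Lemma bt_inj s t : bt s = bt t -> (expi s : C) = expi t.
Proof.
move=> e; have d0 := cden_neq0 hlam s; have d1 := cden_neq0 hlam t.
have s20 : (s2 lam)%:C%C != 0 :> C.
  by apply/eqP => -[h]; have := s2_gt0 hlam; rewrite h ltxx.
have : (expi s - lam) * cden lam t = (expi t - lam) * cden lam s.
  transitivity (bt s * (cden lam s * cden lam t)).
    by rewrite btE /ck; field.
  by rewrite e btE /ck; field.
rewrite /cden => h; apply/eqP; rewrite -subr_eq0 -(mulrI_eq0 _ (mulfI s20)) s2E.
apply/eqP; transitivity ((expi s - lam) * (1 - lam^* * expi t) - (expi t - lam) * (1 - lam^* * expi s)).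
  by ring.
by rewrite h subrr.
Qed.

Lemma ccont_bt : ccont bt.
Proof.
have [c1 c2] := ccont_expi R; have [k1 k2] := ccont_ck hlam.
have ca x : continuous (fun t : R => cos t - x : R) by move=> t; apply: cvgB; [exact: c1|exact: cvg_cst].
have cs x : continuous (fun t : R => sin t - x : R) by move=> t; apply: cvgB; [exact: c2|exact: cvg_cst].
split.
  rewrite (_ : (fun t => _) = (fun t => (cos t - Re lam) * Re (ck lam t) - (sin t - Im lam) * Im (ck lam t))).
    by move=> t; apply: cvgB; apply: cvgM; [exact: ca|exact: k1|exact: cs|exact: k2].
  by apply/funext => t; rewrite btE cReM; case: (lam).
rewrite (_ : (fun t => _) = (fun t => (cos t - Re lam) * Im (ck lam t) + (sin t - Im lam) * Re (ck lam t))).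
  by move=> t; apply: cvgD; apply: cvgM; [exact: ca|exact: k2|exact: cs|exact: k1].
by apply/funext => t; rewrite btE cImM; case: (lam).
Qed.

(** |b(s) - b(t)| vanishes on the diagonal of the square and at two of its corners; at these corners
    g 0 = g (2 pi) makes the increment of g vanish too. *)
Lemma periodic_modulus (g : R -> R) eps : continuous g -> g 0 = g (2 * pi) -> 0 < eps ->
  exists c, forall s t, I s -> I t -> (g s - g t) ^+ 2 <= eps + c * normsq (bt s - bt t).
Proof.
move=> cg gp e0; have [cR cI] := ccont_bt.
have cI' : compact (I `*` I) by apply: compact_setX; exact: segment_compact.
have ch := continuous_sqrB (continuous_pairl cg) (continuous_pairr cg).
have cm : continuous (fun x : R * R => normsq (bt x.1 - bt x.2)).
  rewrite (_ : (fun x => _) = (fun x : R * R => (Re (bt x.1) - Re (bt x.2)) ^+ 2 + (Im (bt x.1) - Im (bt x.2)) ^+ 2)).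
    move=> x; apply: cvgD.
      exact: (continuous_sqrB (continuous_pairl cR) (continuous_pairr cR)).
    exact: (continuous_sqrB (continuous_pairl cI) (continuous_pairr cI)).
  by apply/funext => x; case: (bt x.1) => a b; case: (bt x.2).
have [|x [I1 I2] m0|c _ hc] := compact_domination cI' ch cm _ _ e0.
- by move=> x _; exact: normsq_ge0.
- have : bt x.1 = bt x.2.
    apply/eqP; rewrite -subr_eq0; apply/eqP; move: m0.
    case: (_ - _) => a b /eqP; rewrite /normsq/= paddr_eq0 ?sqr_ge0// !sqrf_eq0.
    by move=> /andP[/eqP -> /eqP ->].
  move=> /bt_inj /(expi_inj I1 I2)[->|[-> ->]|[-> ->]]; rewrite ?gp subrr expr0n//.
- by exists c => s t Is It; apply: (hc (s, t)).
Qed.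

End Modulus.

(** * Approximation in L^2 of the Poisson measure and decay of the defect *)

Section Approximation.
Variable R : realType.
Local Notation C := R[i].
Local Notation mu := (@lebesgue_measure R).
Local Notation I := `[0, 2 * pi : R]%classic.
Local Notation Re := complex.Re.
Local Notation Im := complex.Im.
Implicit Types (r M : R) (u v w g : R -> R).

(** Lets pointwise convergence be checked in the open interval only; at the endpoints the cut-offs
    used below stay 0. *)
Lemma ae_interior : {ae mu, forall t, I t -> 0 < t < 2 * pi}.
Proof.
exists ([set 0] `|` [set 2 * pi]); split.
- by apply: measurableU; exact: measurable_set1.
- have /= e : mu ([set 0] `|` [set 2 * pi]) = 0%E.
    apply: null_set_setU; [exact: measurable_set1|exact: measurable_set1|..];
    exact: lebesgue_measure_set1.
  exact: e.
- move=> t /= /not_implyP[]; rewrite in_itv/= => /andP[t0 t1] h.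
  have [->|nz] := eqVneq t 0; [by left|right].
  by apply/eqP; apply: contra_notT h => h; rewrite !lt_neqAle eq_sym nz h t0 t1.
Qed.

Lemma rmean_dominated (v : nat -> R -> R) w : (forall m, measurable_fun I (v m)) ->
  rint w -> (forall m t, I t -> `|v m t| <= w t) ->
  (forall t, 0 < t < 2 * pi -> v ^~ t @ \oo --> (0 : R)) ->
  forall eps, 0 < eps -> exists m, rmean (v m) <= eps.
Proof.
move=> mv iw vw v0 eps e0.
have [||||| _ _ cv] := @dominated_convergence _ _ _ mu I (@mI R)
    (fun n t => (v n t)%:E) (fun=> 0%E) (EFin \o w).
- by move=> n; apply/measurable_EFinP; exact: mv.
- exact: measurable_cst.
- apply: ae_imply ae_interior => t h It; apply/fine_cvgP; split; first exact: nearW.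
  exact: v0 (h It).
- exact: iw.
- by apply: ae_imply ae_interior => t _ n It; rewrite lee_fin vw.
have iv m : rint (v m) by exact: (rint_le (mv m) (vw m) iw).
have : (fun m => rmean (v m)) @ \oo --> (0 : R).
  rewrite -[X in _ --> X](mulr0 (2 * pi)^-1); apply: cvgM; first exact: cvg_cst.
  move: cv; rewrite integral0 => /fine_cvgP[_]; exact.
move=> /cvgrPdist_le /(_ _ e0)[m _ /(_ m (leqnn m))] /=.
by rewrite sub0r normrN => h; exists m; rewrite (le_trans (ler_norm _)).
Qed.

(** For N >= 0, the truncation of x to [-N, N]; the absolute values make continuity immediate. *)
Definition clamp (N x : R) : R := (`|x + N| - `|x - N|) / 2.

Lemma clamp_id N x : `|x| <= N -> clamp N x = x.
Proof.
rewrite ler_norml => /andP[h1 h2]; rewrite /clamp ger0_norm; last by lra.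
by rewrite ler0_norm; [field|lra].
Qed.
Lemma norm_clamp N x : 0 <= N -> `|clamp N x| <= N.
Proof.
move=> N0; rewrite /clamp ler_norml.
by case: (ler0P (x + N)); case: (ler0P (x - N)) => *; apply/andP; split; lra.
Qed.
Lemma clamp_sub N x : 0 <= N -> `|x - clamp N x| <= `|x|.
Proof.
move=> N0; rewrite /clamp.
by case: (ler0P (x + N)); case: (ler0P (x - N)); case: (ler0P x) => *;
  rewrite ler_norml; apply/andP; split; lra.
Qed.
Lemma clamp_dist N x y : `|x| <= N -> `|x - clamp N y| <= `|x - y|.
Proof.
rewrite /clamp ler_norml => /andP[h1 h2].
by case: (ler0P (y + N)); case: (ler0P (y - N)); case: (ler0P (x - y)) => *;
  rewrite ler_norml; apply/andP; split; lra.
Qed.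
Lemma clamp_continuous N : continuous (clamp N).
Proof.
move=> x; apply: cvgM; last exact: cvg_cst.
by apply: cvgB; apply: cvg_norm; [apply: cvgD|apply: cvgB]; (exact: cvg_id || exact: cvg_cst).
Qed.
Lemma clamp_ge1 x : 1 <= x -> clamp 1 x = 1.
Proof. by move=> x1; rewrite /clamp ger0_norm ?ger0_norm; lra. Qed.
Lemma clamp_ge0 N x : 0 <= N -> 0 <= x -> 0 <= clamp N x.
Proof.
by move=> N0 x0; rewrite /clamp; case: (ler0P (x + N)); case: (ler0P (x - N)) => *; lra.
Qed.

Lemma continuous_clamp N u : continuous u -> continuous (fun t => clamp N (u t)).
Proof. by move=> cu t; apply: continuous_comp; [exact: cu|exact: clamp_continuous]. Qed.

Lemma cb_real u M : measurable_fun I u -> (forall t, I t -> `|u t| <= M) ->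
  cbounded (fun t => (u t)%:C%C).
Proof.
move=> mu_ b; split; first by split => //; exact: measurable_cst.
by exists M => t It; split; [exact: b|rewrite /= normr0 (le_trans _ (b t It))].
Qed.

Variable lam : C.
Hypothesis hlam : `|lam| < 1.
Local Notation bt := (bt lam).
Local Notation nu := (nu lam).
Local Notation p := (poisson lam).

Lemma nu_dominated (v : nat -> R -> R) w : (forall m, measurable_fun I (v m)) ->
  rint w -> (forall m t, I t -> `|v m t| <= w t) ->
  (forall t, 0 < t < 2 * pi -> v ^~ t @ \oo --> (0 : R)) ->
  forall eps, 0 < eps -> exists m, nu (v m) <= eps.
Proof.
move=> mv iw vw v0; apply: (rmean_dominated (w := fun t => w t * p t)).
- by move=> m; apply: measurable_funM => //; exact: (meas_cont (continuous_poisson hlam)).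
- exact: rint_poisson.
- move=> m t It; rewrite normrM [`|p t|]ger0_norm ?poisson_ge0//.
  by rewrite ler_wpM2r ?poisson_ge0 ?vw.
- move=> t ht; rewrite -[X in _ --> X](mul0r (p t)); apply: cvgM; last exact: cvg_cst.
  exact: v0.
Qed.

(** The hypotheses of [defect_korovkin], required for every eps. *)
Definition circle_uniform u : Prop := cbounded (fun t => (u t)%:C%C) /\
  forall eps, 0 < eps -> exists c, forall s t, I s -> I t ->
    (u s - u t) ^+ 2 <= eps + c * normsq (bt s - bt t).

Definition approximable u : Prop := rL2 u /\
  forall eps, 0 < eps -> exists2 v, circle_uniform v & nu (fun t => (u t - v t) ^+ 2) <= eps.

(** Allows the approximation in stages: L^2 by bounded, bounded by continuous, continuous by
    continuous with equal end values. The eps / 4 pays for (x + y)^2 <= 2 x^2 + 2 y^2. *)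
Lemma approximable_trans u : rL2 u ->
  (forall eps, 0 < eps -> exists2 v, approximable v & nu (fun t => (u t - v t) ^+ 2) <= eps) ->
  approximable u.
Proof.
move=> lu h; split=> // eps e0.
have e4 : 0 < eps / 4 by rewrite divr_gt0.
have [v [lv av] uv] := h _ e4; have [w cw vw] := av _ e4.
have lw : rL2 w by apply: cL2_cb; case: cw.
have i1 := rL2_sqr (rL2B lu lv); have i2 := rL2_sqr (rL2B lv lw).
exists w => //.
apply: (@le_trans _ _ (nu (fun t => 2 * (u t - v t) ^+ 2 + 2 * (v t - w t) ^+ 2))).
  apply: le_nu => //; first exact: rL2_sqr (rL2B lu lw).
    by apply: rintD; exact: rintZ.
  move=> t _; rewrite -subr_ge0.
  rewrite (_ : _ - _ = (u t - v t - (v t - w t)) ^+ 2) ?sqr_ge0//; ring.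
rewrite nuD//; [|exact: rintZ..]; rewrite nuZ// nuZ//.
have -> : eps = 2 * (eps / 4) + 2 * (eps / 4) by field.
by rewrite lerD// ler_wpM2l.
Qed.

(* The cut-offs min(1, m (1 - cos t)) make g vanish at both ends of [0, 2pi]. *)
Lemma approximable_continuous g : continuous g -> approximable g.
Proof.
move=> cg; have [M hM] := continuous_bounded cg.
have bg := cb_real (meas_cont cg) hM; have lg : rL2 g by exact: cL2_cb.
split=> // eps e0.
pose chi (m : nat) t : R := clamp 1 (m%:R * (1 - cos t)).
have cchi m : continuous (chi m).
  apply: continuous_clamp => t; apply: cvgM; first exact: cvg_cst.
  by apply: cvgB; [exact: cvg_cst|exact: continuous_cos].
pose F m t := g t * chi m t.
have cF m : continuous (F m) by move=> t; apply: cvgM; [exact: cg|exact: cchi].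
have cost t : 0 <= 1 - cos t by rewrite subr_ge0 cos_le1.
have chi01 m t : 0 <= chi m t <= 1.
  apply/andP; split; first by apply: clamp_ge0 => //; exact: mulr_ge0.
  by rewrite (le_trans (ler_norm _))// norm_clamp.
have [||m t It|t /andP[t0 t1]|m hm] := @nu_dominated (fun m t => (g t - F m t) ^+ 2) (fun t => g t ^+ 2) _ _ _ _ eps e0.
- move=> m; apply: measurable_funX; apply: measurable_funB; exact: meas_cont.
- exact: rL2_sqr.
- rewrite ger0_norm ?sqr_ge0// /F -[X in X - _]mulr1 -mulrBr exprMn ler_piMr ?sqr_ge0//.
  have /andP[c0 c1] := chi01 m t.
  by rewrite expr_le1 ?subr_ge0// gerBl.
(* Inside the interval the cut-off equals 1 as soon as m >= 1 / (1 - cos t), so the sequence is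
   eventually 0. *)
- have c1 : 0 < 1 - cos t.
    rewrite lt0r cost andbT subr_eq0; apply/eqP => /esym ct.
    have sn : sin (t / 2) = 0.
      have h : cos (t / 2 *+ 2) = 1 by rewrite -mulr_natr divfK ?pnatr_eq0.
      move: h; rewrite cos_mulr2n cos2sin2 -mulr_natl => h.
      by apply/eqP; rewrite -sqrf_eq0; apply/eqP; lra.
    have : 0 < sin (t / 2).
      by apply: sin_gt0_pi; rewrite divr_gt0//= ltr_pdivrMr// mulrC.
    by rewrite sn ltxx.
  apply: cvg_near_cst; exists (Num.truncn (1 - cos t)^-1).+1 => // m /= hm.
  rewrite /F /chi clamp_ge1 ?mulr1 ?subrr ?expr0n//.
  rewrite -ler_pdivrMr// div1r ltW// (lt_le_trans (truncnS_gt _))//.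
  by rewrite ler_nat.
- exists (F m) => //; split.
    by have [N hN] := continuous_bounded (cF m); exact: (cb_real (meas_cont (cF m)) hN).
  move=> e ep; apply: periodic_modulus => //.
  have c2 : cos (2 * pi) = 1 :> R by rewrite mulr_natl cos2pi.
  by rewrite /F /chi c2 cos0 subrr mulr0 clamp_id ?normr0 ?ler01// !mulr0.
Qed.

(** Continuous functions are dense in L^1. Truncating the approximant g at M turns L^1 into L^2
    closeness, as the square of the error is then at most 2 M |u - g|. *)
Lemma approximable_bounded u M : measurable_fun I u -> (forall t, I t -> `|u t| <= M) ->
  approximable u.
Proof.
move=> mu_ hM; have bu := cb_real mu_ hM; have lu : rL2 u by exact: cL2_cb.
have iu := rL2_rint lu.
have M0 : 0 <= M by rewrite (le_trans _ (hM 0 _))//= in_itv/= lexx ltW// twopi_gt0.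
apply: approximable_trans => // eps e0.
have [g [cg ig g0]] := approximation_continuous_integrable (@mI R) (muI_fin R) iu.
have [B hB] := continuous_bounded (continuous_poisson hlam).
have B0 : 0 <= B by rewrite (le_trans _ (hB 0 _))//= in_itv/= lexx ltW// twopi_gt0.
have iug k : rint (fun t => `|u t - g k t|) by apply/rint_norm/rintB => //; exact: ig.
have : (fun k => rmean (fun t => `|u t - g k t|)) @ \oo --> (0 : R).
  rewrite -[X in _ --> X](mulr0 (2 * pi)^-1); apply: cvgM; first exact: cvg_cst.
  by move: g0 => /fine_cvgP[_]; exact.
(* B bounds the Poisson kernel; the added 1 keeps the denominator positive when M or B is 0. *)
have e1 : 0 < eps / (2 * M * B + 1).
  by rewrite divr_gt0// ltr_wpDl// mulr_ge0// mulr_ge0.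
move=> /cvgrPdist_le /(_ _ e1)[k _ /(_ k (leqnn k))] /=.
rewrite sub0r normrN => /(le_trans (ler_norm _)) hk.
have cc := @continuous_clamp M _ (cg k).
exists (fun t => clamp M (g k t)); first exact: approximable_continuous.
have lc : rL2 (fun t => clamp M (g k t)) by case: (approximable_continuous cc).
apply: (@le_trans _ _ (rmean (fun t => 2 * M * B * `|u t - g k t|))).
  apply: le_rmean; [|exact: rintZ|].
    exact/rint_poisson/rL2_sqr/rL2B.
  move=> t It; have ut := hM t It.
  have d1 : `|u t - clamp M (g k t)| <= 2 * M.
    rewrite (le_trans (ler_normB _ _))// mulr_natl mulr2n lerD//.
    exact: norm_clamp.
  have d2 := clamp_dist (g k t) ut.
  rewrite -[_ ^+ 2]real_normK ?num_real// expr2.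
  apply: (@le_trans _ _ (2 * M * `|u t - g k t| * B)).
    have p0 := poisson_ge0 hlam t; have dd := ler_pM (normr_ge0 _) (normr_ge0 _) d1 d2.
    have := hB t It; rewrite [`|p t|]ger0_norm// => pB.
    exact: ler_pM (mulr_ge0 (normr_ge0 _) (normr_ge0 _)) p0 dd pB.
  by rewrite mulrAC.
rewrite rmeanZ//.
have d0 : 0 < 2 * M * B + 1 by rewrite ltr_wpDl// mulr_ge0// mulr_ge0.
apply: (@le_trans _ _ ((2 * M * B) * (eps / (2 * M * B + 1)))).
  by rewrite ler_wpM2l// mulr_ge0// mulr_ge0.
rewrite mulrA ler_pdivrMr// mulrC ler_wpM2l ?(ltW e0)//.
by rewrite lerDl.
Qed.

Lemma approximable_L2 u : rL2 u -> approximable u.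
Proof.
move=> lu; have mu_ := rint_meas (rL2_rint lu); apply: approximable_trans => // eps e0.
have mc N : measurable_fun I (fun t => clamp N (u t)).
  by apply: measurableT_comp => //; exact: (continuous_measurable_fun (@clamp_continuous N)).
have [||m t It|t _|m hm] := @nu_dominated (fun m t => (u t - clamp m%:R (u t)) ^+ 2) (fun t => u t ^+ 2) _ _ _ _ eps e0.
- by move=> m; apply: measurable_funX; exact: measurable_funB.
- exact: rL2_sqr.
- rewrite ger0_norm ?sqr_ge0// -[leLHS]real_normK ?num_real// -[leRHS]real_normK ?num_real//.
  by rewrite lerXn2r ?nnegrE// clamp_sub.
- apply: cvg_near_cst; exists (Num.truncn `|u t|).+1 => // m /= hm.
  rewrite clamp_id ?subrr ?expr0n//.
  by rewrite ltW// (lt_le_trans (truncnS_gt _))// ler_nat.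
- exists (fun t => clamp m%:R (u t)) => //.
  by apply: (@approximable_bounded _ m%:R) => // t _; exact: norm_clamp.
Qed.

Lemma defect_small u eps : rL2 u -> 0 < eps -> \forall n \near \oo, defect lam n u <= eps.
Proof.
move=> lu e0; have [_ au] := approximable_L2 lu.
(* The final sum is 2 (eps/12 + eps/6) + 2 (eps/6) = 5 eps/6: the defect of v is bounded by
   Korovkin's estimate, that of u - v by its squared norm. *)
have e6 : 0 < eps / 6 by rewrite divr_gt0.
have [v [bv cv] uv] := au _ e6; have [c hc] := cv _ e6.
have lv : rL2 v by exact: cL2_cb.
exists (Num.truncn (`|c| / (eps / 6))).+2 => // n /= hn.
have n0 : (0 < n)%N by exact: leq_trans hn.
rewrite (_ : defect lam n u = defect lam n (fun t => v t + (u t - v t))); last first.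
  by congr defect; apply/funext => t; rewrite addrC subrK.
rewrite (le_trans (defect_add hlam n0 lv (rL2B lu lv)))//.
have h1 := defect_korovkin hlam n0 bv (fun=> erefl) hc.
have h2 := le_trans (defect_le lam n (fun t => u t - v t)) uv.
have h3 : c / n%:R <= eps / 6.
  rewrite ler_pdivrMr ?ltr0n// (le_trans (ler_norm c))//.
  rewrite mulrC -ler_pdivrMr// ltW// (lt_le_trans (truncnS_gt _))// ler_nat.
  exact: ltnW.
lra.
Qed.

End Approximation.

(** * Change of variable *)

Section Density.
Context d (T : measurableType d) (R : realType) (m : {measure set T -> \bar R}).
Variables (q : T -> R) (mq : measurable_fun [set: T] q) (q0 : forall x, 0 <= q x).

Definition density_measure (A : set T) : \bar R := (\int[m]_(x in A) (q x)%:E)%E.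

Let density_set0 : density_measure set0 = 0%E.
Proof. by rewrite /density_measure integral_set0. Qed.

Let density_ge0 A : (0 <= density_measure A)%E.
Proof. by apply: integral_ge0 => x _; rewrite lee_fin. Qed.

Let density_sigma_additive : semi_sigma_additive density_measure.
Proof.
move=> /= F mF tF mUF; rewrite /density_measure; apply: cvg_toP.
  apply: ereal_nondecreasing_is_cvgn => i j ij.
  by apply: lee_sum_nneg_natr => // k _ _; exact: density_ge0.
rewrite ge0_integral_bigcup//=.
- by apply/measurable_funTS/measurable_EFinP.
- by move=> x _; rewrite lee_fin.
Qed.

HB.instance Definition _ := isMeasure.Build _ _ _
  density_measure density_set0 density_ge0 density_sigma_additive.

Definition density : {measure set T -> \bar R} := density_measure.

Local Open Scope ereal_scope.
Import HBNNSimple.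

(** Monotone convergence reduces the identity to simple functions and then to indicators, for which
    it is the definition of the density measure. *)
Lemma ge0_integral_density (f : T -> \bar R) :
  measurable_fun [set: T] f -> (forall x, 0 <= f x) ->
  \int[density]_x f x = \int[m]_x (f x * (q x)%:E).
Proof.
move=> mf f0; pose f_ := nnsfun_approx measurableT mf.
have mqE : measurable_fun [set: T] (EFin \o q) by exact/measurable_EFinP.
have mind (n : nat) (r : R) : measurable_fun [set: T] (fun x => (r * \1_(f_ n @^-1` [set r]) x)%:E).
  by apply/measurable_EFinP/measurable_funM => //; exact: measurable_indic.
transitivity (limn (fun n => \int[density]_x (f_ n x)%:E)).
  rewrite -monotone_convergence//.
  - by apply: eq_integral => x _; apply/esym/cvg_lim => //; exact: cvg_nnsfun_approx.
  - by move=> n; exact/measurable_EFinP.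
  - by move=> n x _; rewrite lee_fin.
  - by move=> x _ a b ab; rewrite lee_fin; exact/lefP/nd_nnsfun_approx.
transitivity (limn (fun n => \int[m]_x ((f_ n x)%:E * (q x)%:E))); last first.
  rewrite -monotone_convergence//.
  - apply: eq_integral => x _; apply/cvg_lim => //.
    by apply: cvgeZr => //; exact: cvg_nnsfun_approx.
  - by move=> n; apply: emeasurable_funM => //; exact/measurable_EFinP.
  - by move=> n x _; rewrite mule_ge0// lee_fin.
  - move=> x _ a b ab; rewrite lee_wpmul2r ?lee_fin//.
    exact/lefP/nd_nnsfun_approx.
congr (limn _); apply/funext => n.
under eq_integral do rewrite fimfunE -fsumEFin//.
under [RHS]eq_integral.
  move=> x _; rewrite fimfunE -fsumEFin// ge0_mule_fsuml; last first.
    by move=> r; rewrite EFinM nnfun_muleindic_ge0.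
  over.
rewrite !ge0_integral_fsum//.
- apply: eq_fsbigr => r _; rewrite integralZl_indic_nnsfun// integral_indic//= setIT.
  have [r0|r0] := leP 0%R r.
    transitivity (r%:E * \int[m]_x ((\1_(f_ n @^-1` [set r]) x)%:E * (q x)%:E)).
      congr (_ * _); rewrite [LHS]integral_mkcond; apply: eq_integral => x _.
      rewrite patchE indicE; case: ifP => _; by rewrite ?mul1e ?mul0e.
    rewrite -ge0_integralZl//.
    - by apply: eq_integral => x _; rewrite EFinM muleA.
    - by apply: emeasurable_funM => //; exact/measurable_EFinP.
    - by move=> x _; rewrite mule_ge0// lee_fin.
  have -> : f_ n @^-1` [set r] = set0 by exact: preimage_nnfun0.
  rewrite measure0 mule0; apply/esym/integral0_eq => x _.
  by rewrite indic0 mulr0 mul0e.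
- by move=> r; exact: (emeasurable_funM (mind n r) mqE).
- by move=> r x _; rewrite mule_ge0 ?lee_fin// -lee_fin EFinM nnfun_muleindic_ge0.
- exact: mind.
- by move=> r x _; rewrite EFinM nnfun_muleindic_ge0.
Qed.

End Density.

(** * Substitution along an increasing bijection of the line *)

Section Substitution.
Variable R : realType.
Local Notation mu := (@lebesgue_measure R).
Variables (phi q : R -> R).
Hypotheses (dphi : forall x : R, is_derive x 1 phi (q x)) (cq : continuous q)
  (q_gt0 : forall x, 0 < q x) (phi_surj : forall y, exists x, phi x = y).

Lemma substitution_continuous : continuous phi.
Proof.
by move=> x; apply: differentiable_continuous; apply/derivable1_diffP; case: (dphi x).
Qed.

Lemma substitution_mono : {mono phi : x y / x <= y}.
Proof.
apply: le_mono => x y xy.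
have cphi := continuous_subspaceT substitution_continuous.
have [c _ e] := MVT xy (fun z _ => dphi z) (cphi _).
by rewrite -subr_gt0 e mulr_gt0 ?q_gt0// subr_gt0.
Qed.

Lemma measurable_substitution : measurable_fun [set: R] phi.
Proof. by apply: continuous_measurable_fun; exact: substitution_continuous. Qed.

(** Lebesgue measure is determined by half-open intervals. Their preimages under the increasing
    bijection phi are again such intervals, and the fundamental theorem of calculus integrates q =
    phi' over them. *)
Lemma pushforward_density (A : set R) : measurable A ->
  pushforward (density mu (continuous_measurable_fun cq) (fun x => ltW (q_gt0 x)))
    (phi : measurableTypeR R -> measurableTypeR R) A = mu A.
Proof.
have mphi : measurable_fun [set: measurableTypeR R] (phi : measurableTypeR R -> measurableTypeR R).
  exact: measurable_substitution.
pose mphi_mixin := isMeasurableFun.Build _ _ _ _ _ mphi.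
pose mphi_pack : {mfun _ >-> _} := HB.pack (phi : measurableTypeR R -> measurableTypeR R) mphi_mixin.
move=> mA; apply/esym.
apply: (@lebesgue_measure_unique _ (pushforward (density mu
  (continuous_measurable_fun cq) (fun x => ltW (q_gt0 x))) mphi_pack)) => // _ [[a b]] _ <-.
have [xa <-] := phi_surj a; have [xb <-] := phi_surj b.
rewrite [RHS](_ : _ = density_measure mu q (phi @^-1` `]phi xa, phi xb]))//.
have -> : phi @^-1` `]phi xa, phi xb] = `]xa, xb]%classic.
  apply/seteqP; split => x /=; rewrite !in_itv/= !ltNge !substitution_mono//.
rewrite lebesgue_measure_itv/= lte_fin ltNge substitution_mono -ltNge.
case: ltP => ab; last first.
  by rewrite set_itv_ge /density_measure ?integral_set0//= -leNgt.
rewrite /density_measure integral_itv_obnd_cbnd; last first.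
  by apply/measurable_EFinP/measurable_funTS; exact: continuous_measurable_fun.
by rewrite (FTC ab cq dphi) EFinB.
Qed.

Lemma ge0_integral_substitution (h : R -> \bar R) : measurable_fun [set: R] h ->
  (forall y, 0%:E <= h y)%E ->
  (\int[mu]_y h y = \int[mu]_x (h (phi x) * (q x)%:E))%E.
Proof.
move=> mh h0.
have mphi : measurable_fun [set: measurableTypeR R] (phi : measurableTypeR R -> measurableTypeR R).
  exact: measurable_substitution.
transitivity (\int[pushforward (density mu (continuous_measurable_fun cq) (fun x => ltW (q_gt0 x)))
    (phi : measurableTypeR R -> measurableTypeR R)]_y h y)%E.
  by apply: eq_measure_integral => A mA _; rewrite /= pushforward_density.
rewrite ge0_integral_pushforward// preimage_setT ge0_integral_density//.
  by apply: measurableT_comp => //; exact: measurable_substitution.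
by move=> x; exact: h0.
Qed.

End Substitution.

(** * The argument of b along the circle *)

Section Angle.
Variable R : realType.
Local Notation C := R[i].
Local Notation mu := (@lebesgue_measure R).
Local Notation I := `[0, 2 * pi : R]%classic.
Local Notation Re := complex.Re.
Local Notation Im := complex.Im.
Variable lam : C.
Hypothesis hlam : `|lam| < 1.
Local Notation p := (poisson lam).
Local Notation cden := (cden lam).
Local Notation bt := (bt lam).

(* b = z conj(w) / w with w = 1 - conj lam z, and Re w > 0. *)
Definition angle (t : R) : R := t - 2 * atan (Im (cden t) / Re (cden t)).

Lemma expi_atan (x y : R) : 0 < x ->
  (x +i* y)%C = (x / cos (atan (y / x)))%:C%C * expi (atan (y / x)).
Proof.
move=> x0; set a := atan _.
have c0 : cos a != 0.
  by apply/lt0r_neq0/cos_gt0_pihalf; rewrite atan_gtNpi2 atan_ltpi2.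
have ta : tan a = y / x by rewrite atanK.
apply: complexP; rewrite ?cReM ?cImM /= ?mul0r ?subr0 ?addr0.
  by rewrite divfK.
have -> : sin a = tan a * cos a by rewrite /tan divfK.
by rewrite ta; field; rewrite c0 gt_eqF.
Qed.

Lemma expiN (t : R) : expi (- t) = (expi t)^* :> C.
Proof. by apply: complexP; rewrite ?cReJ ?cImJ /= ?cosN ?sinN. Qed.

Lemma expi_angle t : expi (angle t) = bt t.
Proof.
have w0 := cden_gt0 hlam t; have e := expi_atan (Im (cden t)) w0.
rewrite /angle; set a := atan _ in e *.
have we : cden t = (Re (cden t) / cos a)%:C%C * expi a by rewrite -e; case: (cden t).
set r := (Re _ / _)%:C%C in we.
have w1 := cden_neq0 hlam t.
have r0 : r != 0 by apply: contraNneq w1 => r0; rewrite we r0 mul0r.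
have rJ : r^* = r by apply: complexP; rewrite ?cReJ ?cImJ /= ?oppr0.
have -> : t - 2 * a = t + - a + - a by ring.
rewrite !expiD !expiN.
rewrite btE /ck sub_lamE we rmorphM /= rJ invfM -conj_expi.
transitivity (expi t * (expi a)^* * (expi a)^* * (r * r^-1)); last by ring.
by rewrite mulfV// mulr1.
Qed.

Lemma poisson_cden t : p t = s2 lam / (Re (cden t) ^+ 2 + Im (cden t) ^+ 2).
Proof.
rewrite /poisson; congr (_ * _).
have N0 := normr_cden_gt0 hlam t.
rewrite /ck; case: (cden t) N0 => x y /= N0.
by field; rewrite gt_eqF.
Qed.

Lemma is_derive_angle_aux (x y : R -> R) (t dx dy : R) : x t != 0 ->
  is_derive t 1 x dx -> is_derive t 1 y dy ->
  is_derive t 1 (fun s => s - 2 * atan (y s / x s))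
    (1 - 2 * ((dy * x t - y t * dx) / (x t ^+ 2 + y t ^+ 2))).
Proof.
move=> x0 hx hy; have dV := is_deriveV x0 hx.
have dM : is_derive t 1 (fun s => y s / x s) _ := is_deriveM hy dV.
have dA : is_derive t 1 (fun s => atan (y s / x s)) _ :=
  @is_derive1_comp _ _ (fun s => y s / x s) t _ _ (is_derive1_atan (y t / x t)) dM.
have dZ : is_derive t 1 (fun s => 2 * atan (y s / x s)) _ := is_deriveZ 2 dA.
have dB : is_derive t 1 (fun s => s - 2 * atan (y s / x s)) _ :=
  is_deriveB (is_derive_id t 1) dZ.
apply: is_derive_eq dB _; rewrite /GRing.scale/=.
have N0 : x t ^+ 2 + y t ^+ 2 != 0.
  by rewrite gt_eqF// ltr_wpDr ?sqr_ge0// exprn_even_gt0.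
by field; rewrite x0 N0.
Qed.

Lemma is_derive_angle (t : R) : is_derive t 1 angle (p t).
Proof.
have N0 := normr_cden_gt0 hlam t; have x0 := cden_gt0 hlam t.
pose x s := 1 - (Re lam * cos s + Im lam * sin s) : R.
pose y s := - (Re lam * sin s - Im lam * cos s) : R.
have xE s : Re (cden s) = x s by rewrite cdenE.
have yE s : Im (cden s) = y s by rewrite cdenE.
have -> : angle = fun s => s - 2 * atan (y s / x s).
  by apply/funext => s; rewrite /angle xE yE.
have xt0 : x t != 0 by rewrite -xE gt_eqF.
have dx : is_derive t 1 x (Re lam * sin t - Im lam * cos t).
  by rewrite /x; apply: is_derive_eq; rewrite /GRing.scale/=; ring.
have dy : is_derive t 1 y (- (Re lam * cos t + Im lam * sin t)).
  by rewrite /y; apply: is_derive_eq; rewrite /GRing.scale/=; ring.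
apply: is_derive_eq (is_derive_angle_aux xt0 dx dy) _.
rewrite poisson_cden !xE !yE in N0 *.
rewrite /s2.
have c2 := cos2Dsin2 t.
have -> : - (Re lam * cos t + Im lam * sin t) = x t - 1 by rewrite /x; ring.
have -> : Re lam * sin t - Im lam * cos t = - y t by rewrite /y; ring.
(* With w = 1 - conj lam z one has |1 - w| = |lam|, hence 1 - |lam|^2 = 2 Re w - |w|^2. *)
have -> : 1 - (Re lam ^+ 2 + Im lam ^+ 2) = 2 * x t - (x t ^+ 2 + y t ^+ 2).
  have -> : Re lam ^+ 2 + Im lam ^+ 2 =
      (Re lam ^+ 2 + Im lam ^+ 2) * (cos t ^+ 2 + sin t ^+ 2) by rewrite c2 mulr1.
  by rewrite /x /y; ring.
by move: (x t) (y t) N0 => X Y N0; field; rewrite gt_eqF.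
Qed.

(** Since atan stays in (-pi/2, pi/2), the angle is within pi of t; this gives surjectivity and
    limits the number of periods met by the unfolding. *)
Lemma angle_bound t : t - pi < angle t < t + pi.
Proof.
have := atan_gtNpi2 (Im (cden t) / Re (cden t)).
have := atan_ltpi2 (Im (cden t) / Re (cden t)).
by rewrite /angle => h1 h2; apply/andP; split; lra.
Qed.

Lemma cden_periodic t : cden (t + 2 * pi) = cden t.
Proof.
by rewrite !cdenE mulr_natl cosD2pi sinD2pi.
Qed.

Lemma angle_periodic t : angle (t + 2 * pi) = angle t + 2 * pi.
Proof. by rewrite /angle cden_periodic addrAC. Qed.

Lemma poisson_periodic t : p (t + 2 * pi) = p t.
Proof. by rewrite !poisson_cden cden_periodic. Qed.

Lemma poisson_gt0 t : 0 < p t.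
Proof. by rewrite poisson_cden divr_gt0 ?(s2_gt0 hlam)// normr_cden_gt0. Qed.

Lemma angle_surj y : exists t, angle t = y.
Proof.
have ca : continuous angle := substitution_continuous is_derive_angle.
have pi0 := pi_gt0 R.
have /andP[_ h1] := angle_bound (y - pi); have /andP[h2 _] := angle_bound (y + pi).
have [|||t _ e] := @IVT R angle (y - pi) (y + pi) y.
- by lra.
- exact: continuous_subspaceT.
- by rewrite ge_min le_max; apply/andP; split; apply/orP; [left|right]; lra.
- by exists t.
Qed.

End Angle.

(** * Change of variable by b_{-lam} over one period *)

Section ChangeOfVariable.
Variable R : realType.
Local Notation C := R[i].
Local Notation mu := (@lebesgue_measure R).
Local Notation I := `[0, 2 * pi : R]%classic.
Local Notation A := `[0, 2 * pi[%classic.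
Local Notation Re := complex.Re.
Local Notation Im := complex.Im.

Lemma ge0_integral_shift (c : R) (g : R -> R) : measurable_fun [set: R] g ->
  (forall s, 0 <= g s) -> (\int[mu]_s (g s)%:E = \int[mu]_s (g (s + c))%:E)%E.
Proof.
move=> mg g0.
have d (x : R) : is_derive x 1 (fun s : R => s + c) ((fun=> 1) x).
  by apply: is_derive_eq; rewrite addr0.
rewrite (ge0_integral_substitution d)//.
- by apply: eq_integral => s _; rewrite mule1.
- exact: cst_continuous.
- by move=> y; exists (y - c); rewrite subrK.
- exact/measurable_EFinP.
Qed.

Lemma integralD_ge0 (u v : R -> R) : measurable_fun [set: R] u ->
  measurable_fun [set: R] v -> (forall s, 0 <= u s) -> (forall s, 0 <= v s) ->
  (\int[mu]_s (u s + v s)%:E = \int[mu]_s (u s)%:E + \int[mu]_s (v s)%:E)%E.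
Proof.
move=> mu_ mv u0 v0; rewrite -ge0_integralD//.
- by move=> s _; rewrite lee_fin.
- exact/measurable_EFinP.
- by move=> s _; rewrite lee_fin.
- exact/measurable_EFinP.
Qed.

Lemma integral_A (u : R -> R) : measurable_fun [set: R] u ->
  (\int[mu]_s (u s * \1_A s)%:E = \int[mu]_(s in I) (u s)%:E)%E.
Proof.
move=> mu_; rewrite -integral_itv_bndo_bndc; last exact/measurable_EFinP/measurable_funTS.
rewrite [RHS]integral_mkcond; apply: eq_integral => s _.
by rewrite patchE indicE; case: (s \in _); rewrite ?mulr1 ?mulr0.
Qed.

Variable lam : C.
Hypothesis hlam : `|lam| < 1.
Let hlamN : `|- lam| < 1. Proof. by rewrite normrN. Qed.
Local Notation ang := (angle (- lam)).
Local Notation q := (poisson (- lam)).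
Local Notation p := (poisson lam).

Lemma s2N : s2 (- lam) = s2 lam.
Proof. by rewrite /s2; case: lam => a b /=; rewrite !sqrrN. Qed.

(** Over the denominator 1 + conj lam z of b_{-lam}, the terms in z cancel in 1 - conj lam
    b_{-lam}(z). *)
Lemma cden_angle s : cden lam (ang s) * cden (- lam) s = (s2 lam)%:C%C.
Proof.
have cN : cden (- lam) s = 1 + lam^* * expi s.
  by rewrite /cden rmorphN mulNr opprK.
transitivity (cden (- lam) s - lam^* * ((expi s - - lam) * (cden (- lam) s * ck (- lam) s))).
  by rewrite {1}/cden (expi_angle hlamN) btE; ring.
by rewrite (ck_cden hlamN) s2E cN; ring.
Qed.

Lemma normsqM (x y : C) : normsq (x * y) = normsq x * normsq y.
Proof. by case: x => a b; case: y => c d; rewrite /normsq /=; ring. Qed.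

(** The two Poisson kernels are the derivatives of the angles of the mutually inverse maps b_lam and
    b_{-lam}, hence reciprocal. *)
Lemma poisson_angle s : p (ang s) * q s = 1.
Proof.
have n1 := normr_cden_gt0 hlam (ang s); have n2 := normr_cden_gt0 hlamN s.
rewrite (poisson_cden hlam) (poisson_cden hlamN) s2N mulf_div.
rewrite -[X in _ / X]/(normsq _ * normsq _) -normsqM cden_angle.
rewrite /normsq /= expr0n /= addr0 -expr2 divff// expf_neq0// gt_eqF//.
exact: s2_gt0.
Qed.

Lemma expi_periodic t : expi (t + 2 * pi) = expi t :> C.
Proof. by apply: complexP; rewrite /= mulr_natl ?cosD2pi ?sinD2pi. Qed.

(* The angle maps [0, 2pi) to a translate of it; |angle t - t| < pi, so unfolding over three
   consecutive periods is enough. *)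
Lemma blaschke_substitution (K : C -> R) :
  measurable_fun I (fun t => K (expi t)) -> (forall x, 0 <= K x) ->
  measurable_fun I (fun t => K (blaschke (- lam) (expi t))) /\
  (\int[mu]_(t in I) (K (blaschke (- lam) (expi t)))%:E =
   \int[mu]_(t in I) (K (expi t) * p t)%:E)%E.
Proof.
move=> mK K0; pose h t := K (expi t) * p t.
have mA : measurable (A : set (measurableTypeR R)) by exact: measurable_itv.
have hp t : h (t + 2 * pi) = h t by rewrite /h expi_periodic (poisson_periodic hlam).
have hm t : h (t - 2 * pi) = h t by rewrite -[in RHS](subrK (2 * pi) t) hp.
(* A is half-open, so its translates by multiples of 2 pi tile the line without overlap. *)
pose h0 := h \_ A.
have h_ge0 t : 0 <= h t by rewrite mulr_ge0 ?poisson_ge0.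
have h0_ge0 t : 0 <= h0 t by rewrite /h0 patchE; case: ifP.
have mh0 : measurable_fun [set: R] h0.
  apply: (measurable_restrictT h _).1; first exact: measurable_itv.
  apply: (measurable_funS (@mI R)) => [t /=|].
    by rewrite !in_itv/= => /andP[-> /ltW].
  by apply: measurable_funM => //; exact: (meas_cont (continuous_poisson hlam)).
have cang := substitution_continuous (is_derive_angle hlamN).
have mang : measurable_fun [set: R] ang by exact: continuous_measurable_fun.
have mq : measurable_fun [set: R] q by apply: continuous_measurable_fun; exact: continuous_poisson.
pose F s := h0 (ang s) * q s.
have F0 s : 0 <= F s by rewrite mulr_ge0 ?poisson_ge0.
have mF : measurable_fun [set: R] F by apply: measurable_funM => //; exact: measurableT_comp.
have mAc c : measurable_fun [set: R] (fun s : R => \1_A (s + c) : R).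
  have m1 : measurable_fun [set: R] (\1_A : R -> R) by exact: measurable_indic.
  have m2 : measurable_fun [set: R] (fun s : R => s + c) by exact: measurable_funD.
  exact: (measurableT_comp m1 m2).
have mFc c : measurable_fun [set: R] (fun s : R => F (s + c)).
  by apply: measurableT_comp => //; exact: measurable_funD.
have i0 (s : R) : 0 <= \1_A s :> R by rewrite indicE.
(* On I this is the full periodization of F: exactly one of the three translates of [ang s] falls in
   A. *)
pose W s := F (s - 2 * pi) + F s + F (s + 2 * pi).
have mW : measurable_fun [set: R] W by do 2 apply: measurable_funD => //; exact: mFc.
have pi0 := pi_gt0 R.
have inA t : (t \in (A : set R)) = (0 <= t < 2 * pi).
  by apply/idP/idP; rewrite inE /= in_itv.
have WE s : I s -> W s = K (blaschke (- lam) (expi s)).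
  rewrite /= in_itv/= => /andP[s0 s1]; have /andP[a1 a2] := angle_bound (- lam) s.
  have am : ang (s - 2 * pi) = ang s - 2 * pi.
    by rewrite -[in RHS](subrK (2 * pi) s) angle_periodic addrK.
  have qm : q (s - 2 * pi) = q s.
    by rewrite -[in RHS](subrK (2 * pi) s) poisson_periodic.
  have -> : K (blaschke (- lam) (expi s)) = h (ang s) * q s.
    by rewrite /h -mulrA poisson_angle mulr1 (expi_angle hlamN).
  rewrite /W /F am qm angle_periodic poisson_periodic// -!mulrDl; congr (_ * _).
  rewrite /h0 !patchE !inA.
  have -> : (0 <= ang s - 2 * pi < 2 * pi) = (2 * pi <= ang s).
    by apply/idP/idP => [/andP[]|] *; [lra|apply/andP; split; lra].
  have -> : (0 <= ang s + 2 * pi < 2 * pi) = (ang s < 0).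
    by apply/idP/idP => [/andP[]|] *; [lra|apply/andP; split; lra].
  by case: (ltP (ang s) 0) => c1; case: (ltP (ang s) (2 * pi)) => c2 /=;
    rewrite ?hp ?hm ?addr0 ?add0r//; lra.
split.
  apply: (eq_measurable_fun W) => [t /set_mem It|]; first exact: WE.
  exact: measurable_funTS.
transitivity (\int[mu]_(t in I) (W t)%:E)%E.
  by apply: eq_integral => t /set_mem It; rewrite WE.
rewrite -integral_A//.
(* Unfolding: translating each summand moves the shift from F to the indicator, which turns the
   periodization over one period into F over the line. *)
transitivity (\int[mu]_s (F s)%:E)%E.
  have e s : W s * \1_A s = F (s - 2 * pi) * \1_A s + (F s * \1_A s + F (s + 2 * pi) * \1_A s).
    by rewrite /W !mulrDl -addrA.
  have mFA c c' : measurable_fun [set: R] (fun s => F (s + c) * \1_A (s + c')).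
    exact: (measurable_funM (mFc c) (mAc c')).
  have mFA0 c : measurable_fun [set: R] (fun s => F (s + c) * \1_A s).
    have m1 : measurable_fun [set: R] (\1_A : R -> R) by exact: measurable_indic.
    exact: (measurable_funM (mFc c) m1).
  have mF0A c : measurable_fun [set: R] (fun s => F s * \1_A (s + c)).
    exact: (measurable_funM mF (mAc c)).
  have mF0A0 : measurable_fun [set: R] (fun s => F s * \1_A s).
    have m1 : measurable_fun [set: R] (\1_A : R -> R) by exact: measurable_indic.
    exact: (measurable_funM mF m1).
  have sh c : (\int[mu]_s (F (s + c) * \1_A s)%:E = \int[mu]_s (F s * \1_A (s - c))%:E)%E.
    rewrite [RHS](ge0_integral_shift c)//.
      by apply: eq_integral => s _; rewrite addrK.
    by move=> s; rewrite mulr_ge0.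
  have FA0 c s : 0 <= F (s + c) * \1_A s by rewrite mulr_ge0.
  have F0A c s : 0 <= F s * \1_A (s + c) by rewrite mulr_ge0.
  have F0A0 s : 0 <= F s * \1_A s by rewrite mulr_ge0.
  transitivity (\int[mu]_s (F (s - 2 * pi) * \1_A s +
      (F s * \1_A s + F (s + 2 * pi) * \1_A s))%:E)%E.
    by apply: eq_integral => s _; rewrite e.
  rewrite integralD_ge0//; [|exact: measurable_funD|by move=> s; exact: addr_ge0].
  rewrite integralD_ge0// !sh -integralD_ge0// -integralD_ge0//; last 2 first.
  - exact: measurable_funD.
  - by move=> s; exact: addr_ge0.
  apply: eq_integral => s _; congr (_%:E); rewrite -!mulrDr.
  (* Where F s is nonzero, [ang s] is in A, so s is within pi of A and exactly one of the three
     indicators equals 1. *)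
  have [Fs0|Fs0] := eqVneq (F s) 0; first by rewrite Fs0 mul0r.
  have : ang s \in (A : set R).
    apply: contraNT Fs0 => nA; rewrite /F /h0 patchE (negbTE nA) mul0r//.
  rewrite inA => /andP[a1 a2]; have /andP[a3 a4] := angle_bound (- lam) s.
  rewrite !indicE !inA opprK -[RHS]mulr1; congr (_ * _).
  have -> : (0 <= s + 2 * pi < 2 * pi) = (s < 0).
    by apply/idP/idP => [/andP[]|] *; [lra|apply/andP; split; lra].
  have -> : (0 <= s - 2 * pi < 2 * pi) = (2 * pi <= s).
    by apply/idP/idP => [/andP[]|] *; [lra|apply/andP; split; lra].
  by case: (ltP s 0) => c1; case: (ltP s (2 * pi)) => c2 /=;
    rewrite ?addr0 ?add0r//; lra.
transitivity (\int[mu]_s (h0 s)%:E)%E.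
  rewrite [RHS](ge0_integral_substitution (is_derive_angle hlamN)).
  - by apply: eq_integral => s _; rewrite /F EFinM.
  - exact: continuous_poisson.
  - exact: poisson_gt0.
  - exact: angle_surj.
  - exact/measurable_EFinP.
  - by move=> y; rewrite lee_fin.
rewrite -integral_itv_bndo_bndc; last first.
  apply/measurable_EFinP/measurable_funS; [exact: (@mI R)| |].
    by move=> t /=; rewrite !in_itv/= => /andP[-> /ltW].
  by apply: measurable_funM => //; exact: (meas_cont (continuous_poisson hlam)).
rewrite [RHS]integral_mkcond; apply: eq_integral => s _.
by rewrite /h0 !patchE; case: (s \in _).
Qed.

Lemma nu_cst r : nu lam (fun=> r) = r.
Proof.
have h1 : nu lam (fun=> 1) = 1.
  suff : (nu lam (fun=> 1))%:C%C = 1%:C%C :> C by case.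
  rewrite -cnu_real -[RHS](cnu_btX hlam 0 0); apply: eq_cnu => t _.
  by rewrite mulr1.
rewrite -[in LHS](mulr1 r) (nuZ hlam) ?h1 ?mulr1//; exact: rint_cst.
Qed.

Lemma blaschke_change_var (H : C -> R) (B : R) :
  measurable_fun I (fun t => H (expi t)) -> (forall x, `|H x| <= B) ->
  rmean (fun t => H (blaschke (- lam) (expi t))) = nu lam (fun t => H (expi t)).
Proof.
move=> mH HB; have iH : rint (fun t => H (expi t)).
  exact: (rint_bounded mH (fun t _ => HB _)).
(* The shift by B makes the integrand nonnegative; both sides are probability means, so B cancels at
   the end. *)
have [|x|mb e] := @blaschke_substitution (fun x => H x + B).
- exact: measurable_funD.
- by have := HB x; rewrite ler_norml -lerBlDr sub0r => /andP[].
have ibB : rint (fun t => H (blaschke (- lam) (expi t)) + B).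
  apply: (rint_bounded (M := B + `|B|) mb) => t _.
  by rewrite (le_trans (ler_normD _ _))// lerD.
have ib : rint (fun t => H (blaschke (- lam) (expi t))).
  by apply: (eq_rint _ (rintB ibB (rint_cst B))) => t _; rewrite addrK.
have : rmean (fun t => H (blaschke (- lam) (expi t)) + B) = nu lam (fun t => H (expi t) + B).
  by rewrite /nu /rmean /Rintegral e.
rewrite rmeanD ?rmean_cst//; last exact: rint_cst.
rewrite (nuD hlam)// ?nu_cst; last exact: rint_cst.
exact: addIr.
Qed.

End ChangeOfVariable.

(** * The limit *)

Section Limit.
Local Open Scope sesquilinear_scope.
Variable R : realType.
Local Notation C := R[i].
Local Notation I := `[0, 2 * pi : R]%classic.
Local Notation Re := complex.Re.
Local Notation Im := complex.Im.

Lemma continuous_Re_Im (T : topologicalType) (G : T -> C^o) : continuous G ->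
  continuous (fun x => Re (G x)) /\ continuous (fun x => Im (G x)).
Proof.
move=> cG; split=> x; apply/cvgrPdist_lt => e e0.
- have e0' : 0 < e%:C%C :> C by rewrite ltcR.
  have /cvgrPdist_lt/(_ _ e0') := cG x; apply: filterS => y.
  rewrite normc_def ltcR; apply: le_lt_trans; rewrite -sqrtr_sqr.
  case: (G x) => a b; case: (G y) => c d /=.
  by rewrite ler_wsqrtr// lerDl sqr_ge0.
- have e0' : 0 < e%:C%C :> C by rewrite ltcR.
  have /cvgrPdist_lt/(_ _ e0') := cG x; apply: filterS => y.
  rewrite normc_def ltcR; apply: le_lt_trans; rewrite -sqrtr_sqr.
  case: (G x) => a b; case: (G y) => c d /=.
  by rewrite ler_wsqrtr// lerDr sqr_ge0.
Qed.

Lemma continuous_real_complex : continuous (fun x : R => x%:C%C : C^o).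
Proof.
move=> x; apply/cvgrPdist_lt => e e0.
have eE : e = (Re e)%:C%C.
  by move: e0; rewrite ltcE => /andP[/eqP h _]; apply: complexP.
have e0' : 0 < Re e by rewrite -ltcR -eE.
have /cvgrPdist_lt/(_ _ e0') := @cvg_id _ (nbhs x); apply: filterS => y.
rewrite eE -rmorphB /= => h.
by rewrite normc_def /= expr0n addr0 sqrtr_sqr ltcR.
Qed.

Lemma cvg_complex (z : nat -> C^o) (l : C^o) :
  (fun n => Re (z n)) @ \oo --> Re l -> (fun n => Im (z n)) @ \oo --> Im l ->
  z @ \oo --> l.
Proof.
move=> zR zI; apply/cvgrPdist_lt => e e0.
have eE : e = (Re e)%:C%C.
  by move: e0; rewrite ltcE => /andP[/eqP h _]; apply: complexP.
have e0' : 0 < Re e by rewrite -ltcR -eE.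
have e2 : 0 < Re e / 2 by rewrite divr_gt0.
move/cvgrPdist_lt : zR => /(_ _ e2) hR; move/cvgrPdist_lt : zI => /(_ _ e2) hI.
apply: filterS2 hR hI => n; move: (z n) => w h1 h2.
rewrite eE [l - w]complexE (le_lt_trans (ler_normD _ _))// normrM.
rewrite (_ : `|'i%C| = 1 :> C) ?mul1r; last first.
  by rewrite normc_def/= expr0n/= add0r expr1n sqrtr1.
rewrite !normc_def/= expr0n/= !addr0 !sqrtr_sqr -rmorphD ltcR.
have -> : Re (l - w) = Re l - Re w by case: (l : C) => ? ?; case: (w : C).
have -> : Im (l - w) = Im l - Im w by case: (l : C) => ? ?; case: (w : C).
by rewrite [ltRHS](splitr (Re e)) ltrD.
Qed.

(** On the square of [-N, N], [compact_domination] applies. If one point leaves [-N, N], its value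
    is 0, and the other value is either 0 or bounded by B at distance at least 1, hence by B (x -
    y)^2. *)
Lemma support_modulus (g : R -> R) (A : R) : continuous g ->
  (forall x, A < `|x| -> g x = 0) ->
  (exists B, forall x, `|g x| <= B) /\
  forall eps, 0 < eps -> exists c, forall x y, `|g x - g y| <= eps + c * (x - y) ^+ 2.
Proof.
(* The margin 1 beyond the support is the distance that makes (x - y)^2 >= 1 in the outer case. *)
move=> cg gA; pose N : R := `|A| + 1.
have N0 : 0 < N by rewrite ltr_wpDl.
have NA x : ~~ (- N <= x <= N) -> g x = 0.
  move=> h; apply: gA; rewrite ltNge; apply: contraNN h => h.
  rewrite -ler_norml (le_trans h)// (le_trans (ler_norm A))// lerDl//.
have AA x : `|A| < `|x| -> g x = 0 by move=> h; apply/gA/(le_lt_trans (ler_norm A)).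
have [B hB] : exists B, forall x, `|g x| <= B.
  have cgn : {within `[- N, N], continuous (fun x => `|g x|)}.
    by apply: continuous_subspaceT => x; apply: cvg_norm; exact: cg.
  have [|c _ hc] := EVT_max _ cgn; first by rewrite (le_trans _ (ltW N0))// oppr_le0 ltW.
  exists `|g c| => x; have [xN|/NA ->] := boolP (- N <= x <= N); last by rewrite normr0.
  exact: hc.
split; first by exists B.
have B0 : 0 <= B by rewrite (le_trans _ (hB 0)).
move=> eps e0.
pose J := `[- N, N]%classic : set R.
have cJ : compact (J `*` J) by apply: compact_setX; exact: segment_compact.
have ch : continuous (fun x : R * R => `|g x.1 - g x.2|).
  move=> x; apply: cvg_norm; apply: cvgB.
    exact: (continuous_pairl cg).
  exact: (continuous_pairr cg).
have cid_ : continuous (@id R) by move=> x; exact: cvg_id.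
have cm := continuous_sqrB (continuous_pairl cid_) (continuous_pairr cid_).
have [|x _ /eqP|c c0 hc] := compact_domination cJ ch cm _ _ e0.
- by move=> x _; exact: sqr_ge0.
- by rewrite sqrf_eq0 subr_eq0 => /eqP ->; rewrite subrr normr0.
have W x y : ~~ (- N <= x <= N) -> `|g x - g y| <= eps + (c + B) * (x - y) ^+ 2.
  move=> xN; rewrite (NA _ xN) sub0r normrN.
  have [yA|/AA ->] := leP `|y| `|A|; last first.
    by rewrite normr0 addr_ge0 ?(ltW e0)// mulr_ge0 ?sqr_ge0// addr_ge0.
  rewrite -[leLHS]add0r lerD ?(ltW e0)// (le_trans (hB y))//.
  suff x1 : 1 <= (x - y) ^+ 2.
    by rewrite -{1}[B]mulr1 ler_pM// lerDr.
  rewrite -[_ ^+ 2]real_normK ?num_real// exprn_ege1//.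
  have xN' : N < `|x| by rewrite ltNge ler_norml.
  have := ler_distD y x 0; rewrite !subr0 => h.
  by rewrite -(lerD2r `|y|) (le_trans _ h)// addrC (le_trans _ (ltW xN'))// /N lerD.
exists (c + B) => x y.
have [xN|/W//] := boolP (- N <= x <= N).
have [yN|yN] := boolP (- N <= y <= N); last first.
  by rewrite distrC -(sqrrN (x - y)) opprB; exact: W.
have Jxy : (J `*` J) (x, y) by split; rewrite /J /= in_itv.
apply: le_trans (hc _ Jxy) _.
by rewrite lerD2l ler_wpM2r ?sqr_ge0// lerDl.
Qed.

Variable lam : C.
Hypothesis hlam : `|lam| < 1.
Variable f : C -> R.
Hypothesis hf : L2 (fun z => (f z)%:C%C).
Local Notation K n := (model_space (fun z => blaschke lam z ^+ n)).
Local Notation T n := (toeplitz_compression (fun z => (f z)%:C%C) (K n)).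
Local Notation u := (fun t : R => f (expi t)).

Let lu : rL2 u. Proof. exact: (L2_cL2 _).1 hf. Qed.

(** One real family d serves both spectral sums and the estimate: the unitary Q W diagonalizes the
    matrix taken in the unspecified basis. *)
Lemma model_spectrum n : exists d : 'I_n -> R,
  [/\ forall G : C -> C, \sum_(k <- eigenvalues (K n) (T n)) G k = \sum_i G (d i)%:C%C,
      forall G : R -> C, \sum_(s <- singular_values (K n) (T n)) G s = \sum_i G `|d i| &
      forall (g : R -> R) (B eps c : R), (0 < n)%N -> continuous g ->
        (forall x, `|g x| <= B) ->
        (forall x y, `|g x - g y| <= eps + c * (x - y) ^+ 2) ->
        `|n%:R^-1 * \sum_k g (d k) - nu lam (g \o u)| <= eps + c * defect lam n u].
Proof.
have [W [W1 W2 ME]] := compression_mx hlam (f := fun z => (f z)%:C%C) lu n.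
have [Q [d [w [[Q1 Q2 AE] sd mw [w0 sw] nw]]]] := spectral_weights hlam n lu.
have V1 : (Q *m W)^t* *m (Q *m W) = 1%:M.
  by rewrite trmx_mul map_mxM !mulmxA -[_ *m Q^t* *m Q]mulmxA Q2 mulmx1.
have V2 : (Q *m W) *m (Q *m W)^t* = 1%:M.
  by rewrite trmx_mul map_mxM !mulmxA -[_ *m W *m W^t*]mulmxA W2 mulmx1.
have VE : matrix_of (K n) (T n) = (Q *m W)^t* *m diag_mx (\row_i (d i)%:C%C) *m (Q *m W).
  rewrite ME (takenaka_mxE hlam (fun z => (f z)%:C%C)).
  have -> : weighted_mx lam n ((fun z => (f z)%:C%C) \o @expi R) = Q^t* *m diag_mx (\row_i (d i)%:C%C) *m Q.
    exact: AE.
  by rewrite trmx_mul map_mxM !mulmxA.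
have [e1 e2] := hermitian_eigenvalues_sum V1 V2 VE.
exists d; split=> // g B eps c n0 cg gB gm.
exact: (spectral_estimate hlam n0 lu cg gB gm sd mw w0 sw nw).
Qed.

Definition spectrum n := sval (cid (model_spectrum n)).

Lemma spectrum_limit (g : R -> R) (A : R) : continuous g ->
  (forall x, A < `|x| -> g x = 0) ->
  (fun n => n%:R^-1 * \sum_(i < n) g (spectrum i)) @ \oo -->
    rmean (fun t => g (f (blaschke (- lam) (expi t)))).
Proof.
move=> cg gA; have [[B hB] hm] := support_modulus cg gA.
have mu_ := rint_meas (rL2_rint lu).
have -> : rmean (fun t => g (f (blaschke (- lam) (expi t)))) = nu lam (g \o u).
  apply: (blaschke_change_var hlam (H := fun z => g (f z)) (B := B)) => [|x]; last exact: hB.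
  by apply: measurableT_comp => //; exact: continuous_measurable_fun.
apply/cvgrPdist_le => e e0.
have e2 : 0 < e / 2 by rewrite divr_gt0.
have [c hc] := hm _ e2.
(* c may be zero or negative; |c| + 1 is a positive bound for it. *)
have d0 : 0 < e / 2 / (`|c| + 1) by rewrite divr_gt0// ltr_wpDl.
near=> n; have n0 : (0 < n)%N by near: n; exists 1%N.
have dn : defect lam n u <= e / 2 / (`|c| + 1) by near: n; exact: defect_small.
have dn0 := defect_ge0 hlam n0 lu.
rewrite distrC.
have [_ _ h] := svalP (cid (model_spectrum n)).
rewrite (le_trans (h g B _ c n0 cg hB hc))//.
rewrite [leRHS](splitr e) lerD2l.
rewrite (le_trans (ler_wpM2r dn0 (ler_norm c)))//.
rewrite (le_trans (ler_wpM2l (normr_ge0 c) dn))//.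
by rewrite mulrCA ler_piMr ?(ltW e2)// ler_pdivrMr ?mul1r ?lerDl// ltr_wpDl.
Unshelve. all: by end_near. Qed.

End Limit.

(** * Complex test functions and compact supports *)

Section Assembly.
Variable R : realType.
Local Notation C := R[i].
Local Notation Re := complex.Re.
Local Notation Im := complex.Im.

(** The continuous p is bounded on the compact support. It is the real part for G on the complex
    plane, and the identity for G on the line. *)
Lemma compact_support_bounded (T : topologicalType) (p : T -> R) (G : T -> C) :
  continuous p -> has_compact_support G ->
  exists A : R, forall x, A < `|p x| -> G x = 0.
Proof.
move=> cp sG.
have : compact (p @` closure [set x | G x != 0]).
  by apply: continuous_compact => //; exact: continuous_subspaceT.
move=> /compact_bounded[M [Mr hM]].
exists (M + 1) => x hx; apply/eqP/negPn/negP => Gx.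
have : M < M + 1 by rewrite ltrDl.
move=> /hM/(_ (p x)) /= h; have {}h : `|p x| <= M + 1.
  by apply: h; exists x => //; exact: subset_closure.
by have := lt_le_trans hx h; rewrite ltxx.
Qed.

Lemma Re_Im_avg (n : nat) (z : 'I_n -> C) :
  Re (n%:R^-1 * \sum_i z i) = n%:R^-1 * \sum_i Re (z i) /\
  Im (n%:R^-1 * \sum_i z i) = n%:R^-1 * \sum_i Im (z i).
Proof.
have -> : (n%:R^-1 : C) = (n%:R^-1)%:C%C by rewrite fmorphV rmorph_nat.
have eR : Re (\sum_i z i) = \sum_i Re (z i).
  by apply: (big_morph (@complex.Re R)) => // -[? ?] [? ?].
have eI : Im (\sum_i z i) = \sum_i Im (z i).
  by apply: (big_morph (@complex.Im R)) => // -[? ?] [? ?].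
rewrite -eR -eI; case: (\sum_i z i) => a b /=.
by rewrite !mul0r subr0 addr0.
Qed.

Lemma complex_spectrum_limit (lam : C) (hlam : `|lam| < 1) (f : C -> R)
    (hf : L2 (fun z => (f z)%:C%C)) (G : R -> C^o) (A : R) : continuous G ->
  (forall x, A < `|x| -> G x = 0) ->
  (fun n => n%:R^-1 * \sum_(i < n) G (spectrum hlam hf i) : C^o) @ \oo -->
    (circle_mean (fun z => G (f (blaschke (- lam) z))) : C^o).
Proof.
move=> cG GA; have [cR cI] := continuous_Re_Im cG.
apply: cvg_complex => /=.
- under eq_fun do rewrite (Re_Im_avg _).1.
  by apply: spectrum_limit cR _ => x /GA ->.
- under eq_fun do rewrite (Re_Im_avg _).2.
  by apply: spectrum_limit cI _ => x /GA ->.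
Qed.

Lemma model_spectrum_eigenvalues (lam : C) (hlam : `|lam| < 1) (f : C -> R)
    (hf : L2 (fun z => (f z)%:C%C)) n (G : C -> C) :
  let K := model_space (fun z => blaschke lam z ^+ n) in
  \sum_(k <- eigenvalues K (toeplitz_compression (fun z => (f z)%:C%C) K)) G k =
  \sum_(i < n) G (spectrum hlam hf i)%:C%C.
Proof. by have [h _ _] := svalP (cid (model_spectrum hlam hf n)); exact: h. Qed.

Lemma model_spectrum_singular_values (lam : C) (hlam : `|lam| < 1) (f : C -> R)
    (hf : L2 (fun z => (f z)%:C%C)) n (G : R -> C) :
  let K := model_space (fun z => blaschke lam z ^+ n) in
  \sum_(s <- singular_values K (toeplitz_compression (fun z => (f z)%:C%C) K)) G s =
  \sum_(i < n) G `|spectrum hlam hf i|.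
Proof. by have [_ h _] := svalP (cid (model_spectrum hlam hf n)); exact: h. Qed.

End Assembly.

Unset Implicit Arguments.
Set Strict Implicit.
Set Printing Implicit Defensive.

Theorem theorem14 (R : realType) (lam : R[i]) (hlam : `|lam| < 1)
    (f : R[i] -> R) (hf : L2 (fun z => (f z)%:C%C)) :
  let K (n : nat) := model_space (fun z => blaschke lam z ^+ n) in
  let T (n : nat) := toeplitz_compression (fun z => (f z)%:C%C) (K n) in
  (forall G : R[i]^o -> R[i]^o, continuous G -> has_compact_support G ->
     ((hdim (K n))%:R^-1 * \sum_(k <- eigenvalues (K n) (T n)) G k : R[i]^o)
       @[n --> \oo]
     --> (circle_mean (fun z => G (f (blaschke (- lam) z))%:C%C) : R[i]^o)) /\
  (forall G : R -> R[i]^o, continuous G -> has_compact_support G ->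
     ((hdim (K n))%:R^-1 * \sum_(s <- singular_values (K n) (T n)) G s : R[i]^o)
       @[n --> \oo]
     --> (circle_mean (fun z => G `|f (blaschke (- lam) z)|) : R[i]^o)).
Proof.
move=> K T; split=> G cG sG.
(* The eigenvalues and the values of f are real, so the limit concerns G restricted to the real
   axis. *)
- have [cR _] := continuous_Re_Im (G := @id R[i]^o) (fun z => cvg_id).
  have [A hA] := compact_support_bounded cR sG.
  have GA (x : R) : A < `|x| -> G x%:C%C = 0 by exact: (hA x%:C%C).
  have cG' : continuous (fun x : R => G x%:C%C).
    by move=> x; exact: (continuous_comp (@continuous_real_complex R x) (cG _)).
  have := complex_spectrum_limit hlam hf cG' GA.
  apply: cvg_trans; apply: near_eq_cvg; apply: nearW => n.
  by rewrite hdim_model// (model_spectrum_eigenvalues hlam hf).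
- have cid_ : continuous (@id R) by move=> x; exact: cvg_id.
  have [A hA] := compact_support_bounded cid_ sG.
  (* The singular values are the |d_k|, so the real limit is applied to G composed with the absolute
     value. *)
  have GA (x : R) : A < `|x| -> G `|x| = 0 by move=> h; apply: hA; rewrite normr_id.
  have cG' : continuous (fun x : R => G `|x|).
    by move=> x; exact: (continuous_comp (@norm_continuous _ _ x) (cG _)).
  have := complex_spectrum_limit hlam hf cG' GA.
  apply: cvg_trans; apply: near_eq_cvg; apply: nearW => n.
  by rewrite hdim_model// (model_spectrum_singular_values hlam hf).
Qed.
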